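(* Let $(q_j)_{j\in\mathbb{N}}$ be a sequence of positive real numbers and, for $n\in\mathbb{N}$, $n\geq 1$, let $$g_n(x)=(2\pi\hbar)^{-n/2}e^{-\frac1{2\hbar}\sum_{j=1}^nq_jx_j^2},\qquad x\in\mathbb{R}^n.$$ Consider the linear functional $L_n:M^{\infty,1}(\mathbb{R}^n)\to\mathbb{C}$, $L_n(f)=\widetilde{\int_{\mathbb{R}^n}}e^{\frac{i}{2\hbar}|x|^2}f(x)\,dx$, and its operator norm $$\|L_n\|_{(g)}=\sup_{f\in M^{\infty,1}(\mathbb{R}^n)\setminus\{0\}}\frac{|L_n(f)|}{\|f\|_{M^{\infty,1}_{(g_n)}(\mathbb{R}^n)}}.$$ Then $$\|L_n\|_{(g)}=\prod_{j=1}^n(q_j^2+1)^{1/4}=\inf_{\gamma}\frac{1}{|\langle g_n,\gamma\rangle|}\,\|F_+\|_{M^{1,\infty}_{(\gamma)}(\mathbb{R}^n)},$$ where the infimum is over all $\gamma\in\mathcal{S}(\mathbb{R}^n)$ with $\langle g_n,\gamma\rangle\neq0$.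
   Context: Fix $\hbar\in(0,1]$; $i^{s}=e^{i\pi s/2}$, so $(2\pi i\hbar)^{-n/2}=(2\pi\hbar)^{-n/2}e^{-i\pi n/4}$. $\langle f,g\rangle=\int_{\mathbb{R}^n}f\overline g\,dy$, extended to $f\in\mathcal{S}'$, $g\in\mathcal{S}$ by $\langle f,g\rangle=f(\overline g)$. Gabor transform: $V_gf(x,\xi)=\langle f,\pi(x,\xi)g\rangle$ with $\pi(x,\xi)g(y)=(2\pi\hbar)^{-n/2}e^{\frac i\hbar\xi\cdot y}g(y-x)$; for functions, $V_gf(x,\xi)=(2\pi\hbar)^{-n/2}\int_{\mathbb{R}^n}e^{-\frac i\hbar\xi\cdot y}f(y)\overline{g(y-x)}\,dy$. Norms: $\|f\|_{M^{\infty,1}_{(g)}(\mathbb{R}^n)}=\int_{\mathbb{R}^n}\sup_{x\in\mathbb{R}^n}|V_gf(x,\xi)|\,d\xi$ and $\|f\|_{M^{1,\infty}_{(g)}(\mathbb{R}^n)}=\sup_{\xi\in\mathbb{R}^n}\int_{\mathbb{R}^n}|V_gf(x,\xi)|\,dx$. $M^{\infty,1}(\mathbb{R}^n)$ is the space of $f\in\mathcal{S}'(\mathbb{R}^n)$ with $\|f\|_{M^{\infty,1}_{(g)}}<\infty$ for some (equivalently every) $g\in\mathcal{S}(\mathbb{R}^n)\setminus\{0\}$; its elements are bounded continuous functions. $\widetilde{\int_{\mathbb{R}^n}}e^{\frac i{2\hbar}|x|^2}f(x)\,dx:=\lim_{\varepsilon\downarrow0}(2\pi i\hbar)^{-n/2}\int_{\mathbb{R}^n}e^{\frac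 i{2\hbar}|x|^2}f(x)\varphi(\varepsilon x)\,dx$ for any $\varphi\in\mathcal{S}(\mathbb{R}^n)$ with $\varphi(0)=1$ (for $f\in M^{\infty,1}(\mathbb{R}^n)$ the limit exists and is independent of $\varphi$). $F_+(x)=(2\pi i\hbar)^{-n/2}e^{\frac i{2\hbar}|x|^2}$, $x\in\mathbb{R}^n$. *)

(* Defs.v *)
From HB Require Import structures.
From mathcomp Require Import all_boot all_order all_algebra.
From mathcomp Require Import complex.
From mathcomp Require Import all_classical all_reals all_analysis.
Set Implicit Arguments.
Unset Strict Implicit.
Unset Printing Implicit Defensive.
Import Order.TTheory GRing.Theory Num.Theory.
Import numFieldNormedType.Exports.
Local Open Scope classical_set_scope.
Local Open Scope ring_scope.
Local Open Scope complex_scope.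

(* Lebesgue measure on R^n, on the sigma-algebra generated by the coordinates
   (which is the Borel one).  [lebesgue_rV n.+1] is the image of
   [lebesgue_measure \x lebesgue_rV n] under (a, v) |-> (a, v_1, ..., v_n). *)

Definition measure_rV_display : measure_display.
Proof. exact: (measure_tuple_display default_measure_display). Qed.

Section measurable_rV.
Context {R : realType} (n : nat).

Let coors (i : 'I_n) (v : 'rV[R]_n) : measurableTypeR R := v ord0 i.

Let rV_set0 : g_sigma_preimage coors set0.
Proof. exact: sigma_algebra0. Qed.

Let rV_setC A : g_sigma_preimage coors A -> g_sigma_preimage coors (~` A).
Proof. exact: sigma_algebraC. Qed.

Let rV_bigcup (F : (set 'rV[R]_n)^nat) :
  (forall i, g_sigma_preimage coors (F i)) ->
  g_sigma_preimage coors (\bigcup_i (F i)).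
Proof. exact: sigma_algebra_bigcup. Qed.

HB.instance Definition _ := @isMeasurable.Build measure_rV_display
  'rV[R]_n (g_sigma_preimage coors) rV_set0 rV_setC rV_bigcup.

Lemma measurable_coor (i : 'I_n) :
  measurable_fun [set: 'rV[R]_n] (fun v => v ord0 i : measurableTypeR R).
Proof.
move=> _ Y mY; rewrite setTI; apply: sub_sigma_algebra => /=.
rewrite -bigcup_seq/=; exists i => /=; first by rewrite mem_index_enum.
by exists Y => //; rewrite setTI.
Qed.

Lemma measurable_fun_rV d (T : measurableType d) (f : T -> 'rV[R]_n) :
  (forall i, measurable_fun [set: T] (fun t => f t ord0 i : measurableTypeR R)) ->
  measurable_fun [set: T] f.
Proof.
move=> mf; apply: (@measurability _ _ _ _ _ _
  (\big[setU/set0]_(i < n) preimage_set_system setT (coors i) measurable)) => //.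
move=> _ [B + <-]; rewrite -bigcup_seq => -[i _ [A mA <-]].
by rewrite setTI; have := mf i measurableT _ mA; rewrite !setTI.
Qed.

End measurable_rV.

Lemma product_measure1_sigma_finite d1 d2 (T1 : measurableType d1)
    (T2 : measurableType d2) (R : realType)
    (m1 : {sigma_finite_measure set T1 -> \bar R})
    (m2 : {sigma_finite_measure set T2 -> \bar R}) :
  sigma_finite setT (m1 \x m2)%E.
Proof.
have /sigma_finiteP[F [TF ndF Foo]] := sigma_finiteT m1.
have /sigma_finiteP[G [TG ndG Goo]] := sigma_finiteT m2.
exists (fun n => F n `*` G n).
  rewrite -setXTT TF TG predeqE => -[x y]; split.
    move=> [/= [n _ Fnx] [k _ Gky]]; exists (maxn n k) => //; split.
    - by move: x Fnx; exact/subsetPset/ndF/leq_maxl.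
    - by move: y Gky; exact/subsetPset/ndG/leq_maxr.
  by move=> [n _ []/= ? ?]; split; exists n.
move=> k; have [? ?] := Foo k; have [? ?] := Goo k.
split; first exact: measurableX.
by rewrite product_measure1E// lte_mul_pinfty// ge0_fin_numE.
Qed.

Section rV_cons.
Context {R : realType} (n : nat).

Definition rV_cons (p : measurableTypeR R * 'rV[R]_n) : 'rV[R]_n.+1 :=
  row_mx (p.1 : R)%:M p.2.

Definition rV_uncons (v : 'rV[R]_n.+1) : measurableTypeR R * 'rV[R]_n :=
  (v ord0 ord0, @rsubmx R 1 1 n v).

Lemma rV_consK : cancel rV_cons rV_uncons.
Proof.
move=> [a v]; rewrite /rV_uncons /rV_cons row_mxKr; congr pair => /=.
have -> : ord0 = lshift n (ord0 : 'I_1) by apply: val_inj.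
by rewrite (@row_mxEl R 1 1 n) mxE.
Qed.

Lemma measurable_rV_cons : measurable_fun setT rV_cons.
Proof.
apply: measurable_fun_rV => i.
case: (@split_ordP 1 n i) => j ->.
  apply: (eq_measurable_fun fst); last exact: measurable_fst.
  by move=> -[a v] _; rewrite /rV_cons (@row_mxEl R 1 1 n) mxE !ord1.
apply: (eq_measurable_fun
    ((fun v : 'rV[R]_n => v ord0 j : measurableTypeR R) \o snd)).
  by move=> -[a v] _; rewrite /rV_cons (@row_mxEr R 1 1 n).
by apply: measurableT_comp; [exact: measurable_coor|exact: measurable_snd].
Qed.

Lemma measurable_rV_uncons : measurable_fun setT rV_uncons.
Proof.
apply/measurable_fun_pairP; split; first exact: measurable_coor.
apply: measurable_fun_rV => i.
apply: (eq_measurable_fun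
    (fun v : 'rV[R]_n.+1 => v ord0 (rshift 1 i) : measurableTypeR R)).
  by move=> v _; rewrite /= mxE.
exact: measurable_coor.
Qed.

Variable mu : {sigma_finite_measure set 'rV[R]_n -> \bar R}.

Definition measure_rV_cons : set 'rV[R]_n.+1 -> \bar R :=
  pushforward (@lebesgue_measure R \x mu)%E rV_cons.

Let m : {measure set 'rV[R]_n.+1 -> \bar R} :=
  measure_function_pushforward__canonical__measure_function_Measure
    (@lebesgue_measure R \x mu)%E measurable_rV_cons.

HB.instance Definition _ := isMeasure.Build _ _ _ measure_rV_cons
  (measure0 m) (measure_ge0 m) (@measure_semi_sigma_additive _ _ _ m).

Let sigma_finite_measure_rV_cons : sigma_finite setT measure_rV_cons.
Proof.
have [F FT Ffin] : sigma_finite setT (@lebesgue_measure R \x mu)%E.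
  exact: product_measure1_sigma_finite.
exists (fun k => rV_uncons @^-1` F k).
  by rewrite -preimage_bigcup -FT preimage_setT.
move=> k; have [mF Fk] := Ffin k; split.
  by rewrite -[X in measurable X]setTI; exact: measurable_rV_uncons.
rewrite /measure_rV_cons /pushforward -comp_preimage.
by rewrite (_ : rV_uncons \o rV_cons = id) //; apply/funext => p; exact: rV_consK.
Qed.

HB.instance Definition _ := Measure_isSigmaFinite.Build _ _ _
  measure_rV_cons sigma_finite_measure_rV_cons.

End rV_cons.

Fixpoint lebesgue_rV (R : realType) (n : nat) :
    {sigma_finite_measure set 'rV[R]_n -> \bar R} :=
  match n with
  | 0 => \d_(0 : 'rV[R]_0)
  | k.+1 => measure_rV_cons (lebesgue_rV R k)
  end.

(* Sanity check: the volume of a box. *)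
Lemma lebesgue_rV_box (R : realType) (n : nat) (a b : 'I_n -> R) :
  (forall i, a i <= b i) ->
  lebesgue_rV R n [set v | forall i, v ord0 i \in `[a i, b i]] =
  (\prod_(i < n) (b i - a i))%:E.
Proof.
elim: n a b => [|n IHn] a b ab.
  by rewrite big_ord0 /= diracE mem_set // => -[].
rewrite big_ord_recl /= /measure_rV_cons /pushforward.
pose B := [set v : 'rV[R]_n | forall i,
  v ord0 i \in `[a (lift ord0 i), b (lift ord0 i)]].
have mB : measurable B.
  rewrite (_ : B = \big[setI/setT]_(i < n)
    ((fun v : 'rV[R]_n => v ord0 i : measurableTypeR R) @^-1`
      `[a (lift ord0 i), b (lift ord0 i)])).
    apply: bigsetI_measurable => i _; rewrite -[X in measurable X]setTI.
    exact: (measurable_coor i).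
  apply/seteqP; split=> [v Bv|v].
    by rewrite -bigcap_seq => i _; exact: Bv.
  by rewrite -bigcap_seq => H i; apply: H; rewrite /= mem_index_enum.
rewrite (_ : _ @^-1` _ = `[a ord0, b ord0] `*` B).
  rewrite product_measure1E // [X in (_ * X)%E](IHn (a \o lift ord0) (b \o lift ord0)).
    rewrite EFinM; congr (_ * _)%E.
    apply: etrans (lebesgue_measure_itv _) _; rewrite /= lte_fin EFinB.
    by have := ab ord0; case: ltgtP => // -> _; rewrite -EFinB subrr.
  by move=> i; exact: ab.
have E0 x (w : 'rV[R]_n) : rV_cons (x, w) ord0 ord0 = x.
  exact: (congr1 fst (rV_consK (x, w))).
have ES x (w : 'rV[R]_n) i : rV_cons (x, w) ord0 (lift ord0 i) = w ord0 i.
  rewrite (_ : lift ord0 i = rshift 1 i); last exact: val_inj.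
  by rewrite /rV_cons (@row_mxEr R 1 1 n).
apply/seteqP; split=> [[x w] /= H|[x w] /= [H1 H2]].
  split; first by have := H ord0; rewrite E0.
  by move=> i; have := H (lift ord0 i); rewrite ES.
by move=> i; case: (unliftP ord0 i) => [j|] ->; rewrite ?E0 ?ES; [exact: H2|].
Qed.

Section time_frequency.
Context {R : realType} {n : nat}.
Local Notation C := R[i].
Local Notation E := 'rV[R]_n.
Local Notation leb := (lebesgue_rV R n).
Implicit Types (f g phi : E -> C) (u : (E -> C) -> C).

Definition cmod (z : C) : R := Normc.normc z.

Definition expi (t : R) : C := cos t +i* sin t.

Definition dotp (x y : E) : R := \sum_(i < n) x ord0 i * y ord0 i.

Definition Cintegral f : C :=
  (\int[leb]_y complex.Re (f y)) +i* (\int[leb]_y complex.Im (f y)).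

Definition inner f g : C := Cintegral (fun y => f y * (g y)^*).

(* R[i] carries no topology in the library, so continuity, differentiability
   and limits of complex-valued functions are taken on Re and Im. *)

Definition partial (i : 'I_n) f : E -> C := fun x =>
  ('D_(delta_mx ord0 i) (fun y => complex.Re (f y)) x) +i*
  ('D_(delta_mx ord0 i) (fun y => complex.Im (f y)) x).

(* Multi-indices are encoded as lists of coordinates: [partials t f] is the
   iterated partial derivative along t, and \prod_(i <- s) x_i is the monomial
   of s.  The bound below says that all Schwartz seminorms sup |x^s d^t f| with
   orders at most N are at most c. *)
Definition partials (t : seq 'I_n) f : E -> C := foldr partial f t.

Definition smooth f : Prop := forall (t : seq 'I_n) (x : E),
  differentiable (fun y => complex.Re (partials t f y)) x /\
  differentiable (fun y => complex.Im (partials t f y)) x.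

Definition seminorms_le (N : nat) (c : R) f : Prop :=
  forall (s t : seq 'I_n) (x : E), (size s <= N)%N -> (size t <= N)%N ->
    cmod ((\prod_(i <- s) x ord0 i)%:C * partials t f x) <= c.

Definition schwartz f : Prop :=
  smooth f /\ forall N, exists c, seminorms_le N c f.

(* S'(R^n): functionals are total on E -> C, but only their values on Schwartz
   functions are constrained, or ever used.  Continuity is continuity at 0 for
   the topology defined by the Schwartz seminorms. *)
Definition tempered u : Prop :=
  (forall (a : C) f g, schwartz f -> schwartz g ->
     u (fun x => a * f x + g x) = a * u f + u g) /\
  (forall e : R, 0 < e -> exists N, exists2 d : R, 0 < d &
     forall f, schwartz f -> seminorms_le N d f -> cmod (u f) <= e).

Definition nonzero_distr u : Prop := exists2 phi, schwartz phi & u phi != 0.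

Definition distr f : (E -> C) -> C := fun phi => Cintegral (fun y => f y * phi y).

Definition bounded_continuous f : Prop :=
  [/\ exists c : R, forall x, cmod (f x) <= c,
      continuous (fun x => complex.Re (f x)) &
      continuous (fun x => complex.Im (f x))].

(* The bounded continuous function with which a distribution is identified. *)
Definition function_of u : E -> C :=
  xget (fun=> 0) [set f | bounded_continuous f /\
    forall phi, schwartz phi -> u phi = distr f phi].

Variable hbar : R.

Definition tfshift (x xi : E) g : E -> C := fun y =>
  ((2 * pi * hbar) `^ (- (n%:R / 2)))%:C * expi (dotp xi y / hbar) * g (y - x).

(* V_g u(x, xi) = <u, pi(x, xi) g> = u(conj(pi(x, xi) g)). *)
Definition gabor g u (x xi : E) : C := u (fun y => (tfshift x xi g y)^*).

Definition normMinf1 g u : \bar R :=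
  (\int[leb]_xi ereal_sup (range (fun x => (cmod (gabor g u x xi))%:E)))%E.

Definition normM1inf g u : \bar R :=
  ereal_sup (range (fun xi => \int[leb]_x (cmod (gabor g u x xi))%:E))%E.

Definition Minf1 : set ((E -> C) -> C) := [set u | tempered u /\
  exists g, [/\ schwartz g, exists x, g x != 0 & (normMinf1 g u < +oo)%E]].

(* (2 pi i hbar)^(-n/2) *)
Definition fresnel_cst : C :=
  ((2 * pi * hbar) `^ (- (n%:R / 2)))%:C * expi (- (pi * n%:R / 4)).

Definition chirp (x : E) : C := expi (dotp x x / (2 * hbar)).

Definition Fplus (x : E) : C := fresnel_cst * chirp x.

Definition osc_approx f phi (e : R) : C :=
  fresnel_cst * Cintegral (fun x => chirp x * f x * phi (e *: x)).

(* The common limit for all regularizers phi (0 if there is none). *)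
Definition osc_integral f : C := xget (0 : C) [set l : C | forall phi,
  schwartz phi -> phi 0 = 1 ->
  complex.Re (osc_approx f phi e) @[e --> 0^'+] --> complex.Re l /\
  complex.Im (osc_approx f phi e) @[e --> 0^'+] --> complex.Im l].

Definition fresnel_functional u : C := osc_integral (function_of u).

Definition opnorm_fresnel g : \bar R := ereal_sup
  [set ((cmod (fresnel_functional u))%:E / normMinf1 g u)%E | u in
    [set u | Minf1 u /\ nonzero_distr u]].

Definition gaussian (q : nat -> R) (x : E) : C :=
  ((2 * pi * hbar) `^ (- (n%:R / 2)) *
   expR (- ((2 * hbar)^-1 * \sum_(j < n) q j.+1 * x ord0 j ^+ 2)))%:C.

End time_frequency.

(* Main.v *)
(* With h = hbar, z_j = q_j + i and A the claimed value, four estimates are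
   combined.

   Infimum >= A: the integral of x |-> V_gamma F_+ (x, 0) against
   exp (- sum (i + 1 / z_j) x_j^2 / 2h), a weight of modulus at most 1, is by
   Fubini a multiple of <g, gamma> with coefficient of modulus A.

   Infimum <= A: for the window exp ((i - a) |y|^2 / 2h) the modulus of the
   Gabor transform of F_+ is a Gaussian in x - xi of total mass 1, and
   <g, gamma> tends to 1 / A in modulus as a -> 0+.

   Norm <= A: integrating V_g f (- xi, xi) against a Gaussian weight of modulus
   at most 1 gives a multiple of the integral of exp ((i - d) |y|^2 / 2h) f(y),
   which is the oscillatory integral regularized by a Gaussian with d = eps^2;
   let d -> 0+.

   Norm >= A: f = exp (- (a + i) |y|^2 / 2h) attains A as a -> 0+.

   Every integral above is a product of one-dimensional complex Gaussian
   integrals, of which only the moduli sqrt (2 pi / |al|) matter. *)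
Require Import Defs.
From HB Require Import structures.
From mathcomp Require Import all_boot all_order all_algebra.
From mathcomp Require Import complex.
From mathcomp Require Import all_classical all_reals all_analysis.
From mathcomp Require Import measurable_realfun.
From mathcomp Require Import ring lra.
Set Implicit Arguments.
Unset Strict Implicit.
Unset Printing Implicit Defensive.
Import Order.TTheory GRing.Theory Num.Theory.
Import numFieldNormedType.Exports.
Local Open Scope classical_set_scope.
Local Open Scope ring_scope.
Local Open Scope complex_scope.

(** * The complex exponential *)

Section cexp.
Context {R : realType}.
Local Notation C := R[i].
Implicit Types (z w : C) (x y t : R).

(** The two bounds that concern an arbitrary gamma or f are dualities, and the slices of phase space
    on which they live lose nothing. A translate of F_+ is a modulated F_+, so its Gabor transform
    has the same integral over x for every xi, and xi = 0 is as good as any. The points (- xi, xi)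
    carry the ridge of the transform of exp (- i |y|^2 / 2h), the phase that the functional detects.
    Each weight comes from solving for the quadratic coefficient that makes the inner integral the
    required Gaussian; in the limit its modulus is 1 where the optimal transform has its mass, which
    is why the bounds meet. Two obstacles shape the preliminaries. Completing the square produces
    Gaussians with a complex centre; instead of a contour shift, invariance under real translations
    forces the complex derivative in the centre to vanish. And the supremum over x inside the
    M^{infinity,1} norm is not shown to be measurable, so comparisons with it rest on monotonicity
    of the lower integral. *)

Definition cexp z : C := (expR (complex.Re z))%:C * expi (complex.Im z).

Lemma ReD z w : complex.Re (z + w) = complex.Re z + complex.Re w.
Proof. by case: z w => [? ?] [? ?]. Qed.
Lemma ImD z w : complex.Im (z + w) = complex.Im z + complex.Im w.
Proof. by case: z w => [? ?] [? ?]. Qed.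
Lemma ReN z : complex.Re (- z) = - complex.Re z.
Proof. by case: z. Qed.
Lemma ImN z : complex.Im (- z) = - complex.Im z.
Proof. by case: z. Qed.
Lemma ReM z w : complex.Re (z * w) =
  complex.Re z * complex.Re w - complex.Im z * complex.Im w.
Proof. by case: z w => [? ?] [? ?]. Qed.
Lemma ImM z w : complex.Im (z * w) =
  complex.Re z * complex.Im w + complex.Im z * complex.Re w.
Proof. by case: z w => [? ?] [? ?]. Qed.

Lemma Re_sum (I : Type) (r : seq I) (P : pred I) (F : I -> C) :
  complex.Re (\sum_(i <- r | P i) F i) = \sum_(i <- r | P i) complex.Re (F i).
Proof. exact: (big_morph (@complex.Re R) ReD). Qed.
Lemma cmodE z : cmod z = Num.sqrt (complex.Re z ^+ 2 + complex.Im z ^+ 2).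
Proof. by case: z. Qed.

Lemma cmod_ge0 z : 0 <= cmod z.
Proof. by rewrite cmodE sqrtr_ge0. Qed.

Lemma sqr_cmod z : cmod z ^+ 2 = complex.Re z ^+ 2 + complex.Im z ^+ 2.
Proof. by rewrite cmodE sqr_sqrtr// addr_ge0// sqr_ge0. Qed.

Lemma cmod0 : cmod (0 : C) = 0. Proof. exact: Normc.normc0. Qed.
Lemma cmod1 : cmod (1 : C) = 1. Proof. exact: Normc.normc1. Qed.

Lemma cmodM z w : cmod (z * w) = cmod z * cmod w.
Proof. exact: Normc.normcM. Qed.

Lemma cmodV z : cmod z^-1 = (cmod z)^-1.
Proof. exact: Normc.normcV. Qed.

Lemma cmodD z w : cmod (z + w) <= cmod z + cmod w.
Proof. exact: (@le_normcD R z w). Qed.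

Lemma cmodN z : cmod (- z) = cmod z.
Proof. by rewrite !cmodE ReN ImN !sqrrN. Qed.

Lemma cmod_eq0 z : cmod z = 0 -> z = 0.
Proof. exact: Normc.eq0_normc. Qed.

Lemma cmod_gt0 z : z != 0 -> 0 < cmod z.
Proof.
by move=> z0; rewrite lt_neqAle cmod_ge0 andbT eq_sym;
  apply: contra z0 => /eqP/cmod_eq0 ->.
Qed.

Lemma cmodJ z : cmod z^* = cmod z.
Proof. by case: z => a b; rewrite !cmodE/= sqrrN. Qed.

Lemma cmodR x : cmod x%:C = `|x|.
Proof. by rewrite cmodE/= expr0n/= addr0 sqrtr_sqr. Qed.

Lemma cmodR_ge0 x : 0 <= x -> cmod x%:C = x.
Proof. by move=> x0; rewrite cmodR ger0_norm. Qed.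

Lemma cmodX z n : cmod (z ^+ n) = cmod z ^+ n.
Proof. by elim: n => [|n IH]; rewrite ?expr0 ?cmod1// !exprS cmodM IH. Qed.

Lemma cmod_prod (I : Type) (r : seq I) (P : pred I) (F : I -> C) :
  cmod (\prod_(i <- r | P i) F i) = \prod_(i <- r | P i) cmod (F i).
Proof. by apply: (big_morph cmod) => [z w|]; [exact: cmodM|exact: cmod1]. Qed.

Lemma Re_le_cmod z : `|complex.Re z| <= cmod z.
Proof. by rewrite cmodE -sqrtr_sqr ler_wsqrtr// lerDl sqr_ge0. Qed.

Lemma Im_le_cmod z : `|complex.Im z| <= cmod z.
Proof. by rewrite cmodE -sqrtr_sqr ler_wsqrtr// lerDr sqr_ge0. Qed.

Lemma cmod_le_ReIm z : cmod z <= `|complex.Re z| + `|complex.Im z|.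
Proof.
rewrite -(ger0_norm (cmod_ge0 z)) -ler_sqr ?nnegrE ?addr_ge0//.
rewrite real_normK ?num_real// sqr_cmod sqrrD !real_normK ?num_real//.
have : 0 <= `|complex.Re z| * `|complex.Im z| by rewrite mulr_ge0.
by move: (_ * _) => p p0; lra.
Qed.

Lemma cmod_expi t : cmod (expi t : C) = 1.
Proof. by rewrite cmodE/= cos2Dsin2 sqrtr1. Qed.

Lemma expiD s t : expi (s + t) = expi s * expi t :> C.
Proof.
by rewrite /expi cosD sinD; simpc; congr (_ +i* _); rewrite addrC// (mulrC (sin t)).
Qed.

Lemma expi0 : expi 0 = 1 :> C.
Proof. by rewrite /expi cos0 sin0. Qed.

Lemma expiE t : expi t = cexp (0 +i* t) :> C.
Proof. by rewrite /cexp/= expR0 mul1r. Qed.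

Lemma cexpD z w : cexp (z + w) = cexp z * cexp w.
Proof. by rewrite /cexp ReD ImD expRD expiD rmorphM mulrACA. Qed.

Lemma cexp0 : cexp 0 = 1.
Proof. by rewrite /cexp/= expR0 expi0 mulr1. Qed.

Lemma cexp_neq0 z : cexp z != 0.
Proof.
apply/eqP => e; have := cexpD z (- z); rewrite subrr cexp0 e mul0r => /eqP.
by rewrite oner_eq0.
Qed.

Lemma cexp_sum (I : Type) (r : seq I) (P : pred I) (F : I -> C) :
  cexp (\sum_(i <- r | P i) F i) = \prod_(i <- r | P i) cexp (F i).
Proof. by apply: (big_morph cexp) => [z w|]; [exact: cexpD|exact: cexp0]. Qed.

Lemma cmod_cexp z : cmod (cexp z) = expR (complex.Re z).
Proof. by rewrite /cexp cmodM cmod_expi mulr1 cmodR_ge0// expR_ge0. Qed.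

Lemma conj_cexp z : (cexp z)^* = cexp z^*.
Proof.
case: z => a b; rewrite /cexp/= /expi cosN sinN.
by apply/eqP; rewrite eq_complex/=; apply/andP; split; apply/eqP; ring.
Qed.

Lemma cexpR x : cexp x%:C = (expR x)%:C.
Proof. by rewrite /cexp/= expi0 mulr1. Qed.

End cexp.

(** * Integrals of complex-valued functions *)

Section complex_integral.
Context d (T : measurableType d) (R : realType).
Local Notation C := R[i].
Variable mu : {measure set T -> \bar R}.
Implicit Types (f g : T -> C) (c : C).

Definition Cmeasurable f : Prop :=
  measurable_fun setT (fun x => complex.Re (f x) : R) /\
  measurable_fun setT (fun x => complex.Im (f x) : R).

Definition Cintegrable f : Prop :=
  mu.-integrable setT (fun x => (complex.Re (f x))%:E) /\
  mu.-integrable setT (fun x => (complex.Im (f x))%:E).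

(** Over [lebesgue_rV R n] this is convertible to [Cintegral]; the general measure covers the real
    line and the product measures of Fubini. *)
Definition Cint f : C :=
  (\int[mu]_x complex.Re (f x)) +i* (\int[mu]_x complex.Im (f x)).

Lemma CmeasurableD f g :
  Cmeasurable f -> Cmeasurable g -> Cmeasurable (fun x => f x + g x).
Proof.
move=> [f1 f2] [g1 g2]; split.
  by under eq_fun do rewrite ReD; exact: measurable_funD.
by under eq_fun do rewrite ImD; exact: measurable_funD.
Qed.

Lemma CmeasurableM f g :
  Cmeasurable f -> Cmeasurable g -> Cmeasurable (fun x => f x * g x).
Proof.
move=> [f1 f2] [g1 g2]; split.
  under eq_fun do rewrite ReM.
  by apply: measurable_funB; exact: measurable_funM.
under eq_fun do rewrite ImM.
by apply: measurable_funD; exact: measurable_funM.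
Qed.

Lemma Cmeasurable_cst c : Cmeasurable (fun=> c).
Proof. by split; exact: measurable_cst. Qed.

Lemma CmeasurableR (h : T -> R) :
  measurable_fun setT h -> Cmeasurable (fun x => (h x)%:C).
Proof. by move=> mh; split => //; exact: measurable_cst. Qed.

Lemma CmeasurableJ f : Cmeasurable f -> Cmeasurable (fun x => (f x)^*).
Proof.
move=> [f1 f2]; split.
  by rewrite (_ : (fun _ => _) = (fun x => complex.Re (f x)))//;
    apply/funext => x; case: (f x).
rewrite (_ : (fun _ => _) = (fun x => - complex.Im (f x))).
  by apply: measurableT_comp => //; exact: oppr_measurable.
by apply/funext => x; case: (f x).
Qed.

Lemma Cmeasurable_sum (I : Type) (s : seq I) (F : I -> T -> C) :
  (forall i, Cmeasurable (F i)) -> Cmeasurable (fun x => \sum_(i <- s) F i x).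
Proof.
move=> mF; elim: s => [|i s IH].
  by under eq_fun do rewrite big_nil; exact: Cmeasurable_cst.
by under eq_fun do rewrite big_cons; exact: CmeasurableD.
Qed.

Lemma Cmeasurable_cexp f : Cmeasurable f -> Cmeasurable (fun x => cexp (f x)).
Proof.
move=> [f1 f2]; apply: CmeasurableM.
  by apply: CmeasurableR; exact: measurableT_comp.
by split => /=; apply: measurableT_comp => //; apply: continuous_measurable_fun;
  [exact: continuous_cos|exact: continuous_sin].
Qed.

Lemma measurable_cmod f : Cmeasurable f -> measurable_fun setT (fun x => cmod (f x)).
Proof.
move=> [f1 f2]; under eq_fun do rewrite cmodE.
apply: (measurableT_comp (continuous_measurable_fun (@sqrt_continuous R))).
by apply: measurable_funD; exact: measurable_funX.
Qed.

Lemma Cmeasurable_integrable f : Cintegrable f -> Cmeasurable f.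
Proof. by move=> [/measurable_int/measurable_EFinP ? /measurable_int/measurable_EFinP ?]. Qed.

Lemma Cintegrable_le f (h : T -> R) : Cmeasurable f ->
  mu.-integrable setT (EFin \o h) -> (forall x, cmod (f x) <= h x) ->
  Cintegrable f.
Proof.
move=> [f1 f2] ih fh; split.
  apply: (le_integrable measurableT _ _ ih); first exact/measurable_EFinP.
  move=> x _ /=; rewrite lee_fin (le_trans (Re_le_cmod _))//.
  by rewrite (le_trans (fh x))// ler_norm.
apply: (le_integrable measurableT _ _ ih); first exact/measurable_EFinP.
move=> x _ /=; rewrite lee_fin (le_trans (Im_le_cmod _))//.
by rewrite (le_trans (fh x))// ler_norm.
Qed.

Lemma integrable_cmod f : Cintegrable f ->
  mu.-integrable setT (fun x => (cmod (f x))%:E).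
Proof.
move=> fi; have mf := Cmeasurable_integrable fi; have [f1 f2] := fi.
apply: (le_integrable measurableT _ _ (integrableD measurableT
  (integrable_abse f1) (integrable_abse f2))).
  by apply/measurable_EFinP; exact: measurable_cmod.
move=> x _ /=; rewrite lee_fin ger0_norm ?cmod_ge0//.
by rewrite (le_trans (cmod_le_ReIm _))// ler_norm.
Qed.

Lemma Cintegrable_dom f g : Cmeasurable f -> Cintegrable g ->
  (forall x, cmod (f x) <= cmod (g x)) -> Cintegrable f.
Proof.
by move=> mf ig fg; apply: (Cintegrable_le mf) fg; exact: integrable_cmod.
Qed.

Lemma CintegrableP f : Cmeasurable f ->
  (\int[mu]_x (cmod (f x))%:E < +oo)%E -> Cintegrable f.
Proof.
move=> mf foo; apply: (@Cintegrable_le _ (fun x => cmod (f x))) => //.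
apply/integrableP; split; first by apply/measurable_EFinP/measurable_cmod.
by under eq_integral do rewrite /= ger0_norm ?cmod_ge0//.
Qed.

Lemma CintegrableD f g :
  Cintegrable f -> Cintegrable g -> Cintegrable (fun x => f x + g x).
Proof.
move=> [f1 f2] [g1 g2]; split.
  by under eq_fun do rewrite ReD EFinD; exact: integrableD.
by under eq_fun do rewrite ImD EFinD; exact: integrableD.
Qed.

Lemma CintegrableZl c f : Cintegrable f -> Cintegrable (fun x => c * f x).
Proof.
move=> [f1 f2]; split.
  under eq_fun do rewrite ReM EFinB !EFinM.
  by apply: integrableB => //; exact: integrableZl.
under eq_fun do rewrite ImM EFinD !EFinM.
by apply: integrableD => //; exact: integrableZl.
Qed.

Lemma CintD f g : Cintegrable f -> Cintegrable g ->
  Cint (fun x => f x + g x) = Cint f + Cint g.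
Proof.
move=> [f1 f2] [g1 g2]; rewrite /Cint.
rewrite -[RHS]/(Complex (_ + _) (_ + _)) -!RintegralD//.
by congr Complex; apply: eq_Rintegral => x _; rewrite ?ReD ?ImD.
Qed.

Lemma CintZl c f : Cintegrable f -> Cint (fun x => c * f x) = c * Cint f.
Proof.
move=> [f1 f2]; rewrite /Cint; case: c => a b.
rewrite -[RHS]/(Complex (_ - _) (_ + _)) -!RintegralZl//.
rewrite -RintegralB//; last 2 first.
- exact: (integrableZl measurableT a f1).
- exact: (integrableZl measurableT b f2).
rewrite -RintegralD//; last 2 first.
- exact: (integrableZl measurableT a f2).
- exact: (integrableZl measurableT b f1).
by congr Complex; apply: eq_Rintegral => x _; rewrite ?ReM ?ImM.
Qed.

Lemma eq_Cint f g : f =1 g -> Cint f = Cint g.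
Proof. by move=> /funext ->. Qed.

(* Rotating the integral onto the positive half-line reduces this to the real
   inequality. *)
Lemma cmod_Cint_le f : Cintegrable f ->
  ((cmod (Cint f))%:E <= \int[mu]_x (cmod (f x))%:E)%E.
Proof.
move=> fi; set z := Cint f.
have icf := integrable_cmod fi.
have fin : (\int[mu]_x (cmod (f x))%:E)%E \is a fin_num.
  exact: integrable_fin_num.
rewrite -(fineK fin) lee_fin -/(Rintegral _ _ _).
have [->|z0] := eqVneq z 0; first by rewrite cmod0 Rintegral_ge0// => x _; exact: cmod_ge0.
rewrite -(ler_pM2l (cmod_gt0 z0)) -expr2 sqr_cmod.
have <- : complex.Re (z^* * z) = complex.Re z ^+ 2 + complex.Im z ^+ 2.
  by rewrite ReM; case: (z) => a b /=; ring.
rewrite {2}/z -CintZl//= -RintegralZl//.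
apply: le_Rintegral => //.
- by have [] := CintegrableZl z^* fi.
- exact: (integrableZl measurableT (cmod z) icf).
- move=> x _; rewrite (le_trans (ler_norm _))// (le_trans (Re_le_cmod _))//.
  by rewrite cmodM cmodJ.
Qed.

End complex_integral.

(** * Fubini's theorem and image measures for complex integrands *)

Section complex_fubini.
Context d1 d2 (T1 : measurableType d1) (T2 : measurableType d2) (R : realType).
Variables (m1 : {sigma_finite_measure set T1 -> \bar R})
  (m2 : {sigma_finite_measure set T2 -> \bar R}).
Implicit Types F : T1 * T2 -> R[i].

Lemma Cmeasurable_comp d (T : measurableType d) d' (U : measurableType d')
    (f : U -> R[i]) (p : T -> U) :
  Cmeasurable f -> measurable_fun setT p -> Cmeasurable (fun x => f (p x)).
Proof.
by move=> [f1 f2] mp; split; [exact: (measurableT_comp f1 mp)|exact: (measurableT_comp f2 mp)].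
Qed.

Lemma Cintegrable_prod12 F : Cmeasurable F ->
  (\int[m1]_x \int[m2]_y (cmod (F (x, y)))%:E < +oo)%E ->
  Cintegrable (m1 \x m2)%E F.
Proof.
move=> mF h; apply: CintegrableP => //.
rewrite fubini_tonelli1//; first by apply/measurable_EFinP/measurable_cmod.
by move=> x; rewrite lee_fin cmod_ge0.
Qed.

(** Integrability is asked of every section, so the inner integrals are finite at every point and
    [fine] does not distort them. *)
Lemma Cint_prod12 F : Cintegrable (m1 \x m2)%E F ->
  (forall x, Cintegrable m2 (fun y => F (x, y))) ->
  Cint (m1 \x m2)%E F = Cint m1 (fun x => Cint m2 (fun y => F (x, y))).
Proof.
move=> [F1 F2] sF; rewrite /Cint; congr Complex; rewrite /Rintegral.
  rewrite -(integral12_prod_meas1 F1); congr fine; apply: eq_integral => x _.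
  by rewrite /fubini_F fineK//; apply: integrable_fin_num => //; have [] := sF x.
rewrite -(integral12_prod_meas1 F2); congr fine; apply: eq_integral => x _.
by rewrite /fubini_F fineK//; apply: integrable_fin_num => //; have [] := sF x.
Qed.

Lemma Cint_prod21 F : Cintegrable (m1 \x m2)%E F ->
  (forall y, Cintegrable m1 (fun x => F (x, y))) ->
  Cint (m1 \x m2)%E F = Cint m2 (fun y => Cint m1 (fun x => F (x, y))).
Proof.
move=> [F1 F2] sF; rewrite /Cint; congr Complex; rewrite /Rintegral.
  rewrite -(integral21_prod_meas1 F1); congr fine; apply: eq_integral => x _.
  by rewrite /fubini_G fineK//; apply: integrable_fin_num => //; have [] := sF x.
rewrite -(integral21_prod_meas1 F2); congr fine; apply: eq_integral => x _.
by rewrite /fubini_G fineK//; apply: integrable_fin_num => //; have [] := sF x.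
Qed.

Lemma Cfubini F : Cintegrable (m1 \x m2)%E F ->
  (forall x, Cintegrable m2 (fun y => F (x, y))) ->
  (forall y, Cintegrable m1 (fun x => F (x, y))) ->
  Cint m1 (fun x => Cint m2 (fun y => F (x, y))) =
  Cint m2 (fun y => Cint m1 (fun x => F (x, y))).
Proof. by move=> iF F1 F2; rewrite -Cint_prod12// Cint_prod21. Qed.

End complex_fubini.

(** [nu] is tied to the image measure only by its values on measurable sets, so that translations of
    Lebesgue measure and [rV_cons] are both covered. *)
Lemma Cint_pushforward d1 d2 (X : measurableType d1) (Y : measurableType d2)
    (R : realType) (phi : X -> Y) (mphi : measurable_fun setT phi)
    (mu : {measure set X -> \bar R}) (nu : {measure set Y -> \bar R})
    (f : Y -> R[i]) :
  (forall A, measurable A -> nu A = pushforward mu phi A) ->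
  Cintegrable mu (f \o phi) -> Cmeasurable f ->
  Cintegrable nu f /\ Cint nu f = Cint mu (f \o phi).
Proof.
move=> nuE [f1 f2] [mf1 mf2].
pose m := measure_function_pushforward__canonical__measure_function_Measure mu mphi.
have eqi (g : Y -> \bar R) : (\int[nu]_x g x = \int[m]_x g x)%E.
  by apply: eq_measure_integral => A mA _; rewrite nuE.
have H (h : Y -> R) : measurable_fun setT h ->
   mu.-integrable setT (fun x => (h (phi x))%:E) ->
   nu.-integrable setT (EFin \o h) /\ (\int[nu]_x h x = \int[mu]_x h (phi x))%R.
  move=> mh ih.
  have mh' : measurable_fun setT (EFin \o h) by exact/measurable_EFinP.
  split.
    apply/integrableP; split => //; rewrite eqi.
    by have /integrableP[] := integrable_pushforward mphi mh' ih measurableT.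
  by rewrite /Rintegral eqi (integral_pushforward mphi mh' ih measurableT).
have [h1 h2] := H _ mf1 f1; have [h3 h4] := H _ mf2 f2.
by split; [split|rewrite /Cint h2 h4].
Qed.

(** * Lebesgue measure on R^n *)

Section lebesgue_affine.
Context {R : realType}.
Local Notation mu := (@lebesgue_measure R).

Lemma measurable_affine (c b : R) :
  measurable_fun [set: measurableTypeR R]
    ((fun x => c * x + b) : measurableTypeR R -> measurableTypeR R).
Proof. by apply: measurable_funD => //; exact: measurable_funM. Qed.

(** The right-hand side is a measure in A, so by uniqueness of Lebesgue measure only half-open
    intervals have to be compared. *)
Lemma lebesgue_measure_affine (c b : R) (c0 : 0 < c) (A : set (measurableTypeR R)) :
  measurable A ->
  mu A = (c%:E * mu ((fun x : R => (c * x + b)%R) @^-1` A))%E.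
Proof.
move=> mA.
pose m := measure_function_pushforward__canonical__measure_function_Measure
  mu (measurable_affine c b).
pose m' := mscale (NngNum (ltW c0)) m.
rewrite -[RHS]/(m' A).
apply: lebesgue_measure_unique => // _ [[s t] _ <-].
pose s' := (s - b) / c; pose t' := (t - b) / c.
have E : (fun x : R => c * x + b) @^-1` `]s, t] = `]s', t']%classic.
  by apply/seteqP; split => x /=; rewrite !in_itv/= ler_pdivlMr// ltr_pdivrMr//
    mulrC ltrBlDr lerBrDr.
transitivity (c%:E * mu `]s', t']%classic)%E; last first.
  by rewrite /m' /mscale/= /m/= /pushforward; congr (_ * mu _)%E; rewrite E.
rewrite (lebesgue_measure_itv `]s', t']) lebesgue_measure_itv/= !lte_fin.
rewrite /s' /t' ltr_pM2r ?invr_gt0// ltrD2r; case: ifPn => _; last by rewrite mule0.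
by rewrite -!EFinB -EFinM; congr EFin; field; rewrite gt_eqF.
Qed.

Lemma ge0_integral_affine (c b : R) (c0 : 0 < c) (f : measurableTypeR R -> \bar R) :
  measurable_fun setT f -> (forall x, 0 <= f x)%E ->
  (\int[mu]_x f x = c%:E * \int[mu]_x f ((c * x + b)%R))%E.
Proof.
move=> mf f0.
pose m := measure_function_pushforward__canonical__measure_function_Measure
  mu (measurable_affine c b).
pose m' := mscale (NngNum (ltW c0)) m.
rewrite (_ : (\int[mu]_x f x = \int[m']_x f x)%E); last first.
  apply: eq_measure_integral => A mA _.
  exact: (lebesgue_measure_affine b c0 mA).
rewrite ge0_integral_mscale//=; congr (_ * _)%E.
rewrite ge0_integral_pushforward//; exact: measurable_affine.
Qed.

End lebesgue_affine.

Section lebesgue_rV_theory.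
Context {R : realType}.

Lemma rV_cons0 n (p : measurableTypeR R * 'rV[R]_n) : rV_cons p ord0 ord0 = p.1.
Proof. by case: p => x w; exact: (congr1 fst (rV_consK (x, w))). Qed.

Lemma rV_consS n (p : measurableTypeR R * 'rV[R]_n) i :
  rV_cons p ord0 (lift ord0 i) = p.2 ord0 i.
Proof.
rewrite (_ : lift ord0 i = rshift 1 i); last exact: val_inj.
by rewrite /rV_cons (@row_mxEr R 1 1 n).
Qed.

Lemma rV_consE n (p : measurableTypeR R * 'rV[R]_n) (v : 'rV[R]_n.+1) :
  v ord0 ord0 = p.1 -> (forall i, v ord0 (lift ord0 i) = p.2 ord0 i) ->
  rV_cons p = v.
Proof.
move=> v0 vS; apply/rowP => i; case: (unliftP ord0 i) => [j|] ->.
  by rewrite rV_consS vS.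
by rewrite rV_cons0.
Qed.

Lemma ge0_integral_rVS n (f : 'rV[R]_n.+1 -> \bar R) :
  measurable_fun setT f -> (forall x, 0 <= f x)%E ->
  (\int[lebesgue_rV R n.+1]_x f x =
   \int[lebesgue_measure]_a \int[lebesgue_rV R n]_v f (rV_cons (a, v)))%E.
Proof.
move=> mf f0; have mc := @measurable_rV_cons R n.
transitivity (\int[pushforward (lebesgue_measure \x lebesgue_rV R n)%E
  (@rV_cons R n)]_x f x)%E; first by apply: eq_measure_integral.
rewrite ge0_integral_pushforward//= fubini_tonelli1//.
exact: measurableT_comp.
Qed.

Lemma ge0_integral_rV0 (f : 'rV[R]_0 -> \bar R) :
  measurable_fun setT f -> (forall x, 0 <= f x)%E ->
  (\int[lebesgue_rV R 0]_x f x = f 0%R)%E.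
Proof.
move=> mf f0; rewrite [LHS](integral_dirac (0 : 'rV[R]_0) measurableT mf).
by rewrite diracT mul1e.
Qed.

Lemma measurable_rV_affine n (c : R) (b : 'rV[R]_n) :
  measurable_fun setT (fun v : 'rV[R]_n => c *: v + b).
Proof.
apply: measurable_fun_rV => i; under eq_fun do rewrite !mxE.
apply: measurable_funD => //; apply: measurable_funM => //.
exact: measurable_coor.
Qed.

(** Induction on n: Tonelli separates the head coordinate, whose change of variable gives one factor
    c, from the tail, which gives c ^+ n with the tail [b'] of b as shift. *)
Lemma ge0_integral_rV_affine n (c : R) (b : 'rV[R]_n) (c0 : 0 < c)
    (f : 'rV[R]_n -> \bar R) :
  measurable_fun setT f -> (forall x, 0 <= f x)%E ->
  (\int[lebesgue_rV R n]_x f x =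
   (c ^+ n)%:E * \int[lebesgue_rV R n]_x f ((c *: x + b)%R))%E.
Proof.
elim: n b f => [|n IH] b f mf f0.
  rewrite !ge0_integral_rV0//; last first.
    by apply: (measurableT_comp mf); exact: measurable_rV_affine.
  by rewrite expr0 mul1e; congr f; apply/rowP => -[].
have mc := @measurable_rV_cons R n.
have mfc : measurable_fun setT (f \o @rV_cons R n) by exact: measurableT_comp.
pose b' : 'rV[R]_n := \row_i b ord0 (lift ord0 i).
have mfa : measurable_fun setT (fun x : 'rV[R]_n.+1 => f (c *: x + b)%R).
  by apply: (measurableT_comp mf); exact: measurable_rV_affine.
rewrite !ge0_integral_rVS//.
pose G a := (\int[lebesgue_rV R n]_v f (rV_cons (a, v)))%E.
have mG : measurable_fun setT G.
  by apply: (measurable_fun_fubini_tonelli_F (f \o @rV_cons R n)) => // ?; exact: f0.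
have G0 a : (0 <= G a)%E by apply: integral_ge0.
rewrite -/(G _) (ge0_integral_affine (b ord0 ord0) c0 mG G0).
rewrite exprSr EFinM -muleA [RHS]muleCA; congr (_ * _)%E.
rewrite -ge0_integralZl//; last 3 first.
- have mfac : measurable_fun setT ((fun x : 'rV[R]_n.+1 => f (c *: x + b)%R) \o @rV_cons R n).
    exact: measurableT_comp.
  by apply: (measurable_fun_fubini_tonelli_F (_ \o @rV_cons R n) mfac) => ?; exact: f0.
- by move=> a _; apply: integral_ge0.
- by rewrite lee_fin exprn_ge0// ltW.
apply: eq_integral => a _; rewrite /G (IH b'); first last.
- by [].
- apply: (measurableT_comp mfc); exact: measurable_pair1.
congr (_ * _)%E; apply: eq_integral => v _; congr f.
apply: rV_consE => [|i]; first by rewrite mxE [X in X + _]mxE rV_cons0.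
by rewrite mxE [X in X + _]mxE rV_consS !mxE.
Qed.

Lemma lebesgue_rV_affine n (c : R) (b : 'rV[R]_n) (c0 : 0 < c) A :
  measurable A -> (lebesgue_rV R n A =
  (c ^+ n)%:E * lebesgue_rV R n ((fun v => (c *: v + b)%R) @^-1` A))%E.
Proof.
move=> mA; have mB : measurable ((fun v : 'rV[R]_n => (c *: v + b)%R) @^-1` A).
  by rewrite -[X in measurable X]setTI; apply: measurable_rV_affine.
have := @ge0_integral_rV_affine n c b c0 (EFin \o \1_A).
rewrite integral_indic// setIT => ->; last 2 first.
- exact/measurable_EFinP.
- by move=> x; rewrite lee_fin.
by rewrite -(setIT (_ @^-1` A)) -integral_indic// setIT.
Qed.

Lemma Cint_translate n (b : 'rV[R]_n) (f : 'rV[R]_n -> R[i]) :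
  Cmeasurable f -> Cintegrable (lebesgue_rV R n) (fun x => f (x + b)) ->
  Cintegrable (lebesgue_rV R n) f /\
  Cint (lebesgue_rV R n) f = Cint (lebesgue_rV R n) (fun x => f (x + b)).
Proof.
move=> mf fi.
have mb : measurable_fun setT (fun x : 'rV[R]_n => x + b).
  rewrite (_ : (fun _ => _) = (fun x : 'rV[R]_n => 1 *: x + b)); first exact: measurable_rV_affine.
  by apply/funext => x; rewrite scale1r.
have hb A : measurable A -> lebesgue_rV R n A =
    pushforward (lebesgue_rV R n) (fun x : 'rV[R]_n => x + b) A.
  move=> mA; rewrite (@lebesgue_rV_affine n 1 b ltr01 A mA) expr1n mul1e.
  rewrite /pushforward; congr (lebesgue_rV R n _).
  by apply/seteqP; split => x /=; rewrite scale1r.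
exact: (Cint_pushforward mb hb fi mf).
Qed.

Lemma CintS n (f : 'rV[R]_n.+1 -> R[i]) :
  Cmeasurable f -> Cintegrable (lebesgue_measure \x lebesgue_rV R n)%E (f \o @rV_cons R n) ->
  Cintegrable (lebesgue_rV R n.+1) f /\
  Cint (lebesgue_rV R n.+1) f =
  Cint (lebesgue_measure \x lebesgue_rV R n)%E (f \o @rV_cons R n).
Proof. by move=> mf fi; exact: (Cint_pushforward (@measurable_rV_cons R n)). Qed.

End lebesgue_rV_theory.

(** * Borel measurability on row vectors *)

Section borel_rV.
Context {R : realType} {n : nat}.
Local Notation E := 'rV[R]_n.

Lemma measurable_rV_box (A : 'I_n -> set R) : (forall i, measurable (A i)) ->
  measurable [set v : E | forall i, A i (v ord0 i)].
Proof.
move=> mA; rewrite (_ : [set _ | _] = \big[setI/setT]_(i < n)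
    ((fun v : E => v ord0 i : measurableTypeR R) @^-1` A i)).
  apply: bigsetI_measurable => i _; rewrite -[X in measurable X]setTI.
  exact: (measurable_coor i measurableT (mA i)).
apply/seteqP; split=> [v Bv|v].
  by rewrite -bigcap_seq => i _; exact: Bv.
by rewrite -bigcap_seq => H i; apply: H; rewrite /= mem_index_enum.
Qed.

(** The sigma-algebra is generated by the coordinates; an open set belongs to it as the countable
    union of the boxes of rational centre and radius 1 / (k + 1) that it contains. *)
Lemma open_measurable_rV (U : set E) : open U -> measurable U.
Proof.
move=> oU.
pose box (p : 'rV[rat]_n * nat) : set E :=
  [set v | forall i, `|v ord0 i - ratr (p.1 ord0 i)| < p.2.+1%:R^-1].
pose F p := if `[< box p `<=` U >] then box p else set0.
have -> : U = \bigcup_p F p.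
  apply/seteqP; split => [x Ux|x [p _]]; last first.
    by rewrite /F; case: ifPn => // /asboolP; apply.
  have /nbhs_ballP[e /= e0 xeU] := oU x Ux.
  have [k ke] : exists k, k.+1%:R^-1 < e / 2 :> R.
    have e20 : 0 < e / 2 by rewrite divr_gt0.
    have [k _ /(_ k (leqnn _))/= ke] := near_infty_natSinv_lt (PosNum e20).
    by exists k.
  have /fin_all_exists[p hp] (i : 'I_n) :
      exists p : rat, `|x ord0 i - ratr p| < k.+1%:R^-1.
    have k0 : (0 : R) < k.+1%:R^-1 by rewrite invr_gt0.
    have lt : x ord0 i - k.+1%:R^-1 < x ord0 i + k.+1%:R^-1 by rewrite ltrD2l gtrN.
    have [p] := rat_in_itvoo lt; rewrite in_itv/= => /andP[h1 h2].
    exists p; rewrite ltr_norml; move: (k.+1%:R^-1) h1 h2 => d h1 h2.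
    by apply/andP; split; lra.
  exists (\row_i p i, k) => //; rewrite /F; case: ifPn => [_ i /=|/asboolPn[]].
    by rewrite mxE.
  move=> v bv; apply: xeU; split => // i j.
  have b1 := lt_trans (hp j) ke; have b2 := lt_trans (bv j) ke.
  rewrite (ord1 i) /ball/= (splitr e).
  apply: le_lt_trans (ltrD b1 b2); rewrite /= mxE.
  by rewrite (distrC (v _ _)) (le_trans _ (ler_normD _ _))// addrA subrK.
apply: countable_bigcupT_measurable => [|p]; first exact: countableP.
rewrite /F; case: ifPn => // _; apply: (measurable_rV_box (A := fun i =>
  [set t | `|t - ratr (p.1 ord0 i)| < p.2.+1%:R^-1])) => i.
rewrite (_ : [set _ | _] = ball (ratr (p.1 ord0 i) : R) p.2.+1%:R^-1).
  exact: measurable_ball.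
by apply/seteqP; split => t; rewrite /ball/= distrC.
Qed.

Lemma continuous_measurable_rV (f : E -> R) :
  continuous f -> measurable_fun setT f.
Proof.
move=> /continuousP cf; apply: (measurability _ (RGenOpens.measurableE R)).
move=> _ [_ [a [b ->] <-]]; rewrite setTI; apply: open_measurable_rV.
exact/cf/interval_open.
Qed.
End borel_rV.

(** * Gaussian integrals *)

Section exp_estimates.
Context {R : realType}.
Implicit Types x y : R.

Lemma mean_value_at0 (f df : R -> R) x :
  (forall t : R, is_derive t 1 f (df t)) ->
  exists2 c, `|c| <= `|x| & f x - f 0 = x * df c.
Proof.
move=> fdf.
have cf : continuous f.
  move=> t; apply: differentiable_continuous; apply/derivable1_diffP.
  by case: (fdf t).
have [x0|x0|->] := ltgtP x 0.
- have [|c] := MVT x0 (fun t _ => fdf t); first exact: continuous_subspaceT.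
  rewrite in_itv/= => /andP[xc c0] e; exists c.
    by rewrite !ltr0_norm// lerN2 ltW.
  by rewrite -opprB e sub0r mulrN opprK mulrC.
- have [|c] := MVT x0 (fun t _ => fdf t); first exact: continuous_subspaceT.
  rewrite in_itv/= => /andP[c0 cx] e; exists c; first by rewrite !gtr0_norm// ltW.
  by rewrite e subr0 mulrC.
- by exists 0; rewrite ?subrr ?mul0r.
Qed.

Lemma ler_norm_sin x : `|sin x| <= `|x|.
Proof.
have [c _] := @mean_value_at0 sin cos x (fun t => is_derive_sin t).
rewrite sin0 subr0 => ->; rewrite normrM ler_piMr//.
by rewrite ler_norml cos_geN1 cos_le1.
Qed.

Lemma one_sub_cos x : 1 - cos x = sin (x / 2) ^+ 2 *+ 2.
Proof.
rewrite [in LHS](splitr x) cosD -!expr2 mulr2n; have := cos2Dsin2 (x / 2); lra.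
Qed.

Lemma norm_cos_sub1 x : `|cos x - 1| <= x ^+ 2.
Proof.
rewrite distrC one_sub_cos ger0_norm ?mulrn_wge0 ?sqr_ge0//.
have : sin (x / 2) ^+ 2 <= (x / 2) ^+ 2.
  by rewrite -[leLHS]real_normK ?num_real// -[leRHS]real_normK ?num_real//
    lerXn2r ?nnegrE// ler_norm_sin.
rewrite exprMn; have := sqr_ge0 x; move: (x ^+ 2) (sin _ ^+ 2) => u v.
lra.
Qed.

Lemma norm_cos_sub1_lin x : `|cos x - 1| <= `|x|.
Proof.
rewrite distrC one_sub_cos ger0_norm ?mulrn_wge0 ?sqr_ge0//.
have h1 : `|sin (x / 2)| <= `|x| / 2.
  by rewrite (le_trans (ler_norm_sin _))// normrM (ger0_norm (x := 2^-1)).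
have h2 : `|sin (x / 2)| <= 1 by rewrite ler_norml sin_geN1 sin_le1.
rewrite -[_ ^+ 2]real_normK ?num_real// mulr2n expr2.
have := normr_ge0 (sin (x / 2)); move: (`|sin _|) h1 h2 => s; nra.
Qed.

Lemma norm_sin_sub x : `|sin x - x| <= x ^+ 2.
Proof.
have [c cx] := @mean_value_at0 (fun t => sin t - t) (fun t => cos t - 1) x
  (fun t => is_deriveB (is_derive_sin t) (is_derive_id t 1)).
rewrite sin0 !subr0 => ->; rewrite normrM -[leRHS]real_normK ?num_real// expr2.
by rewrite ler_wpM2l// (le_trans (norm_cos_sub1_lin _)).
Qed.

Lemma norm_expR_sub1 x : `|expR x - 1| <= `|x| * expR `|x|.
Proof.
have [c cx] := @mean_value_at0 expR expR x (fun t => is_derive_expR t).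
rewrite expR0 => ->; rewrite normrM ler_wpM2l// ger0_norm ?expR_ge0//.
by rewrite ler_expR (le_trans (ler_norm _)).
Qed.

Lemma norm_expR_sub1x x : `|expR x - 1 - x| <= x ^+ 2 * expR `|x|.
Proof.
have [c cx] := @mean_value_at0 (fun t => expR t - t) (fun t => expR t - 1) x
  (fun t => is_deriveB (is_derive_expR t) (is_derive_id t 1)).
rewrite expR0 subr0 addrAC => ->.
rewrite normrM -[x ^+ 2]real_normK ?num_real// expr2 -mulrA ler_wpM2l//.
rewrite (le_trans (norm_expR_sub1 _))// ler_pM ?expR_ge0//.
by rewrite ler_expR.
Qed.

(** For z = x + i y the remainder splits into exp x times the error of [expi y], the error of exp x,
    and the cross term i y (exp x - 1). Together they are at most 3 |z|^2 exp |z|; the 4 is rounded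
    up. *)
Lemma cmod_cexp_sub1x (z : R[i]) :
  cmod (cexp z - 1 - z) <= 4 * cmod z ^+ 2 * expR (cmod z).
Proof.
case: z => x y; set z := x +i* y.
have -> : cexp z - 1 - z = (expR x)%:C * (expi y - 1 - (0 +i* y)) +
    ((expR x - 1 - x)%:C + (0 +i* y) * (expR x - 1)%:C).
  by apply/eqP; rewrite eq_complex/=; apply/andP; split; apply/eqP; ring.
have xz : `|x| <= cmod z := Re_le_cmod z.
have yz : `|y| <= cmod z := Im_le_cmod z.
have ez : expR `|x| <= expR (cmod z) by rewrite ler_expR.
have x2 : x ^+ 2 + y ^+ 2 = cmod z ^+ 2 by rewrite sqr_cmod.
set m := cmod z in xz yz ez x2 *; set e := expR m in ez *.
have e0 : 0 < e by exact: expR_gt0.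
have h1 : cmod ((expR x)%:C * (expi y - 1 - (0 +i* y))) <= e * (y ^+ 2 + y ^+ 2).
  rewrite cmodM cmodR_ge0 ?expR_ge0// ler_pM ?expR_ge0 ?cmod_ge0//.
    by rewrite (le_trans _ ez)// ler_expR ler_norm.
  rewrite (le_trans (cmod_le_ReIm _))//= lerD//.
    by rewrite oppr0 addr0 norm_cos_sub1.
  by rewrite oppr0 addr0 norm_sin_sub.
have h2 : cmod (expR x - 1 - x)%:C <= x ^+ 2 * e.
  by rewrite cmodR (le_trans (norm_expR_sub1x _))// ler_wpM2l// sqr_ge0.
have h3 : cmod ((0 +i* y) * (expR x - 1)%:C) <= `|y| * (`|x| * e).
  rewrite cmodM cmodR [cmod (_ +i* _)]cmodE/= expr0n add0r sqrtr_sqr ler_wpM2l//.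
  by rewrite (le_trans (norm_expR_sub1 _))// ler_wpM2l.
rewrite (le_trans (cmodD _ _))// (le_trans (lerD h1 (cmodD _ _)))//.
rewrite (le_trans (lerD (lexx _) (lerD h2 h3)))//.
have m0 : 0 <= m := cmod_ge0 _.
have xy : `|y| * `|x| <= m ^+ 2 by rewrite expr2 ler_pM.
have -> : e * (y ^+ 2 + y ^+ 2) + (x ^+ 2 * e + `|y| * (`|x| * e)) =
  (y ^+ 2 + (x ^+ 2 + y ^+ 2) + `|y| * `|x|) * e by ring.
rewrite ler_wpM2r ?(ltW e0)// x2.
have hy : y ^+ 2 <= m ^+ 2 by rewrite -x2 lerDr sqr_ge0.
by have := sqr_ge0 m; move: (m ^+ 2) (y ^+ 2) (`|y| * _) xy hy => u v w; lra.
Qed.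

End exp_estimates.

(** * Gaussian integrals on the line with real coefficients *)

Section real_gaussian.
Context {R : realType}.
Local Notation mu := (@lebesgue_measure R).
Implicit Types a b k : R.

(** Completing the square exhibits the integrand as a multiple of the normal density of mean b / a
    and variance 1 / a, whose mass is 1. *)
Lemma integral_real_gaussian a b k : 0 < a ->
  (\int[mu]_x (expR (k + b * x - a / 2 * x ^+ 2))%:E =
   (Num.sqrt (2 * pi / a) * expR (k + b ^+ 2 / (2 * a)))%:E)%E.
Proof.
move=> a0; set s := Num.sqrt a^-1.
have s2 : s ^+ 2 = a^-1 by rewrite sqr_sqrtr// invr_ge0 ltW.
have s0 : s != 0 by rewrite gt_eqF// sqrtr_gt0 invr_gt0.
have P0 : 0 < (normal_peak s)^-1 by rewrite invr_gt0 normal_peak_gt0.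
have E x : expR (k + b * x - a / 2 * x ^+ 2) =
    ((normal_peak s)^-1 * expR (k + b ^+ 2 / (2 * a))) * normal_pdf (b / a) s x.
  rewrite normal_pdfE//= /normal_fun [RHS]mulrACA mulVf ?mul1r; last first.
    by rewrite gt_eqF// normal_peak_gt0.
  rewrite -expRD s2; congr expR; field; exact: lt0r_neq0.
under eq_integral do rewrite E EFinM.
rewrite integralZl//; last exact: integrable_normal_pdf.
rewrite integral_normal_pdf mule1; congr ((_ * _)%:E).
rewrite /normal_peak invrK s2; congr Num.sqrt.
by rewrite mulr2n; field; exact: lt0r_neq0.
Qed.

Lemma measurable_real_gaussian a b k :
  measurable_fun [set: R] (fun x => expR (k + b * x - a / 2 * x ^+ 2)).
Proof.
apply: measurableT_comp => //; apply: measurable_funB.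
  by apply: measurable_funD => //; exact: measurable_funM.
by apply: measurable_funM => //; exact: measurable_funX.
Qed.

Lemma integrable_real_gaussian a b k : 0 < a ->
  mu.-integrable setT (EFin \o (fun x => expR (k + b * x - a / 2 * x ^+ 2))).
Proof.
move=> a0; apply/integrableP; split.
  by apply/measurable_EFinP; exact: measurable_real_gaussian.
under eq_integral do rewrite /= ger0_norm ?expR_ge0//.
by rewrite integral_real_gaussian// ltry.
Qed.

End real_gaussian.

Section complex_gaussian.
Context {R : realType}.
Local Notation C := R[i].
Local Notation mu := (@lebesgue_measure R).
Implicit Types (x : R) (al be k w h : C).

(** Normal form of all one-dimensional exponents below. The sign and the factor 1/2 make 0 < Re al
    the integrability condition and sqrt (2 pi / al) exp (k + be^2 / (2 al)) the integral of its
    exponential. *)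
Definition cquad k be al x : C := k + be * x%:C - al / 2 * x%:C ^+ 2.

Lemma real_complexX (x : R) m : (x ^+ m)%:C = x%:C ^+ m :> C.
Proof. exact: rmorphXn. Qed.

Lemma Cmeasurable_cquad k be al :
  Cmeasurable ((fun x => cexp (cquad k be al x)) : measurableTypeR R -> C).
Proof.
have mx : Cmeasurable ((fun x => x%:C) : measurableTypeR R -> C).
  exact: CmeasurableR.
apply: Cmeasurable_cexp.
rewrite (_ : cquad _ _ _ = fun x => k + be * x%:C + (- (al / 2)) * (x%:C * x%:C)).
  apply: CmeasurableD.
    by apply: CmeasurableD; [|apply: CmeasurableM => //]; exact: Cmeasurable_cst.
  by apply: CmeasurableM; [exact: Cmeasurable_cst|exact: CmeasurableM].
by apply/funext => x; rewrite /cquad expr2 mulNr.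
Qed.

Lemma ReMr (z : C) x : complex.Re (z * x%:C) = complex.Re z * x.
Proof. by rewrite ReM/= mulr0 subr0. Qed.

Lemma inv2C : (2 : C)^-1 = (2^-1)%:C.
Proof. by rewrite -[2]/(2%:R) -(rmorph_nat (real_complex R)) -fmorphV. Qed.

Lemma Re_cquad k be al x : complex.Re (cquad k be al x) =
  complex.Re k + complex.Re be * x - complex.Re al / 2 * x ^+ 2.
Proof.
by rewrite /cquad !ReD ReN -real_complexX !ReMr inv2C ReMr.
Qed.

Lemma Cintegrable_cquad k be al : 0 < complex.Re al ->
  Cintegrable mu (fun x => cexp (cquad k be al x)).
Proof.
move=> al0; apply: (Cintegrable_le (Cmeasurable_cquad _ _ _)
  (integrable_real_gaussian (complex.Re be) (complex.Re k) al0)) => x.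
by rewrite cmod_cexp Re_cquad.
Qed.

Definition cgauss al w x : C := cexp (- (al / 2) * (x%:C - w) ^+ 2).

Lemma cgaussE al w x : cgauss al w x = cexp (cquad (- (al / 2) * w ^+ 2) (al * w) al x).
Proof. by congr cexp; rewrite /cquad; field. Qed.

End complex_gaussian.

(** * Independence of the Gaussian integral from its complex centre *)

Section gaussian_shift.
Context {R : realType}.
Local Notation C := R[i].
Local Notation mu := (@lebesgue_measure R).
Implicit Types (x : R) (w h : C).

Lemma Cint_translate1 (s : R) (f : measurableTypeR R -> C) :
  Cmeasurable f -> Cintegrable mu (fun x : R => f (x + s)) ->
  Cint mu f = Cint mu (fun x : R => f (x + s)).
Proof.
move=> mf fi.
have mb : measurable_fun [set: measurableTypeR R]
    ((fun x => x + s) : measurableTypeR R -> measurableTypeR R).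
  exact: measurable_funD.
have hb A : measurable A ->
    mu A = pushforward mu ((fun x => x + s) : measurableTypeR R -> measurableTypeR R) A.
  move=> mA; rewrite (lebesgue_measure_affine s ltr01 mA) mul1e.
  rewrite /pushforward; congr (mu _).
  by apply/seteqP; split => x /=; rewrite mul1r.
by have [] := Cint_pushforward mb hb fi mf.
Qed.

Variables (al : C) (al_gt0 : 0 < complex.Re al).
Local Notation cgauss := (cgauss al).
Local Notation a := (complex.Re al).

Lemma Cintegrable_cgauss w : Cintegrable mu (cgauss w).
Proof.
by under [cgauss w]funext do rewrite cgaussE; exact: Cintegrable_cquad.
Qed.

Lemma Cint_cgauss_translate w (s : R) :
  Cint mu (cgauss (w + s%:C)) = Cint mu (cgauss w).
Proof.
have e : (fun x : R => cgauss (w + s%:C) (x + s)) = cgauss w.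
  by apply/funext => x; rewrite /cgauss; congr (cexp (_ * _ ^+ 2)); rewrite rmorphD/=; ring.
rewrite (Cint_translate1 (s := s)) ?e//; last exact: Cintegrable_cgauss.
exact/Cmeasurable_integrable/Cintegrable_cgauss.
Qed.

(** The derivative of [cgauss w x] in the complex centre w. *)
Let dgauss w x : C := al * (x%:C - w) * cgauss w x.

(** For |w| <= r and |h| <= 1, moving the centre from w to w + h adds to the exponent a term of
    modulus at most |h| times [growth r x]. *)
Let growth (r x : R) : R := cmod al * (`|x| + (r + 1)).

Let scale (r : R) : R := r ^+ 2 * cmod al / 2 + 2 * cmod al * (r + 1) +
   (2 * cmod al + r * cmod al) ^+ 2 / a.

(** Both exp (2 [growth]) and the linear term of the exponent are exponentials of multiples of |x|,
    up to constants; half of the Gaussian decay absorbs them, with [scale r] as the constant,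
    uniformly in |w| <= r. *)
Lemma cmod_cgauss_le w (r x : R) : cmod w <= r ->
  cmod (cgauss w x) * expR (2 * growth r x) <=
  expR (scale r + 0 * x - (a / 2) / 2 * x ^+ 2).
Proof.
move=> wr; rewrite cgaussE cmod_cexp Re_cquad -expRD ler_expR /growth /scale.
have h1 : `|complex.Re (al * w)| <= r * cmod al.
  by rewrite (le_trans (Re_le_cmod _))// cmodM mulrC ler_wpM2r ?cmod_ge0.
have h2 : complex.Re (- (al / 2) * w ^+ 2) <= r ^+ 2 * cmod al / 2.
  rewrite (le_trans (ler_norm _))// (le_trans (Re_le_cmod _))//.
  rewrite cmodM cmodN cmodM cmodX inv2C cmodR_ge0 ?invr_ge0//.
  rewrite [leLHS]mulrC mulrA ler_wpM2r ?invr_ge0// ler_wpM2r ?cmod_ge0//.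
  by rewrite lerXn2r// nnegrE ?cmod_ge0// (le_trans _ wr)// cmod_ge0.
have h3 : complex.Re (al * w) * x <= r * cmod al * `|x|.
  by rewrite (le_trans (ler_norm _))// normrM ler_wpM2r.
have x2 : x ^+ 2 = `|x| ^+ 2 by rewrite real_normK ?num_real.
set B := 2 * cmod al + r * cmod al.
(* Completing the square. *)
have h4 : B * `|x| <= a / 4 * x ^+ 2 + B ^+ 2 / a.
  rewrite x2 -subr_ge0.
  have -> : a / 4 * `|x| ^+ 2 + B ^+ 2 / a - B * `|x| = (a / 2 * `|x| - B) ^+ 2 / a.
    by field; rewrite gt_eqF.
  by rewrite divr_ge0 ?sqr_ge0// ltW.
have -> : 2 * (cmod al * (`|x| + (r + 1))) =
  2 * cmod al * (r + 1) + 2 * cmod al * `|x| by ring.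
have : 2 * cmod al * `|x| + r * cmod al * `|x| <= a / 4 * x ^+ 2 + B ^+ 2 / a.
  by rewrite -mulrDl.
move: h2 h3; move: (2 * cmod al * `|x|) (r * cmod al * `|x|) (B ^+ 2 / a)
  (complex.Re _) (complex.Re _ * _) (r ^+ 2 * _ / 2) (2 * _ * _) => *.
by rewrite mul0r addr0; lra.
Qed.

(** The exponent is quadratic in the centre, so the shifted Gaussian is [cgauss w x] times [cexp Z],
    and the remainder consists of cexp Z - 1 - Z and the h^2 term of Z. With s = [growth r x], the
    bounds |Z| <= |h| s and s^2 <= 4 exp s give 16 |h|^2 exp (2 s) for the former; the latter adds
    one more |h|^2 exp (2 s), whence 17. *)
Lemma cgauss_taylor w h (r x : R) : cmod w <= r -> cmod h <= 1 ->
  cmod (cgauss (w + h) x - cgauss w x - h * dgauss w x) <=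
  cmod h ^+ 2 * (17 * expR (scale r + 0 * x - (a / 2) / 2 * x ^+ 2)).
Proof.
move=> wr h1; pose Z := al * (x%:C - w) * h - al / 2 * h ^+ 2.
have -> : cgauss (w + h) x - cgauss w x - h * dgauss w x =
    cgauss w x * ((cexp Z - 1 - Z) - al / 2 * h ^+ 2).
  have -> : cgauss (w + h) x = cgauss w x * cexp Z.
    by rewrite /cgauss -cexpD; congr cexp; rewrite /Z; field.
  by rewrite /dgauss /Z; ring.
set s := growth r x.
have al0 := cmod_ge0 al; have h0 := cmod_ge0 h.
have xr : cmod (x%:C - w) <= `|x| + r.
  by rewrite (le_trans (cmodD _ _))// cmodN cmodR lerD2l.
have hl : cmod (al / 2 * h ^+ 2) = cmod al / 2 * cmod h ^+ 2.
  by rewrite cmodM cmodX cmodM inv2C cmodR_ge0 ?invr_ge0.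
have r0 : 0 <= r by rewrite (le_trans (cmod_ge0 w)).
have s0 : 0 <= s by rewrite mulr_ge0// addr_ge0// addr_ge0.
have als : cmod al <= s by rewrite ler_peMr// addrA lerDr addr_ge0.
have Zs : cmod Z <= cmod h * s.
  rewrite (le_trans (cmodD _ _))// cmodN hl !cmodM expr2.
  have -> : cmod h * s = cmod al * (`|x| + r) * cmod h + cmod al * cmod h.
    by rewrite /s /growth; ring.
  rewrite lerD// ?ler_wpM2r// ?ler_wpM2l//.
  by rewrite mulrA ler_pM ?mulr_ge0// -mulrA ler_piMr// mulrC ler_pdivrMr// mul1r
    (le_trans h1)// ler1n.
have Zs' : cmod Z <= s by rewrite (le_trans Zs)// ler_piMl.
have e1 : 1 + s <= expR s by exact: expR_ge1Dx.
have e2 : s ^+ 2 <= 4 * expR s.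
  have := expR_ge1Dx (s / 2); rewrite [in 4 * _](splitr s) expRD.
  by move: (expR _) => t; nra.
have e3 : cmod (cexp Z - 1 - Z) <= cmod h ^+ 2 * (16 * (expR s * expR s)).
  rewrite (le_trans (cmod_cexp_sub1x _))//.
  have : cmod Z ^+ 2 <= cmod h ^+ 2 * (4 * expR s).
    rewrite (le_trans _ (ler_wpM2l (sqr_ge0 _) e2))// -exprMn.
    by rewrite lerXn2r// nnegrE ?cmod_ge0// mulr_ge0.
  have : expR (cmod Z) <= expR s by rewrite ler_expR.
  have -> : cmod h ^+ 2 * (16 * (expR s * expR s)) =
    4 * (cmod h ^+ 2 * (4 * expR s)) * expR s by ring.
  move=> hZ hZ2; apply: ler_pM => //; last exact: ler_wpM2l.
  by rewrite mulr_ge0// sqr_ge0.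
have e4 : cmod al / 2 * cmod h ^+ 2 <= cmod h ^+ 2 * (expR s * expR s).
  by rewrite mulrC ler_wpM2l ?sqr_ge0//; nra.
rewrite cmodM; apply: (@le_trans _ _
    (cmod (cgauss w x) * (cmod h ^+ 2 * (17 * expR (2 * s))))).
  rewrite ler_wpM2l ?cmod_ge0// (le_trans (cmodD _ _))// cmodN hl.
  rewrite (le_trans (lerD e3 e4))// -mulrDr ler_wpM2l ?sqr_ge0//.
  have -> : 2 * s = s + s by ring.
  by rewrite expRD; move: (expR s * _) => t; lra.
rewrite [leLHS]mulrCA ler_wpM2l ?sqr_ge0// mulrCA ler_wpM2l//.
exact: cmod_cgauss_le.
Qed.

Lemma Cintegrable_dgauss w : Cintegrable mu (dgauss w).
Proof.
have mc : Cmeasurable ((fun x => al * (x%:C - w)) : measurableTypeR R -> C).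
  apply: CmeasurableM; first exact: Cmeasurable_cst.
  by apply: CmeasurableD; [exact: CmeasurableR|exact: Cmeasurable_cst].
have mg : Cmeasurable (cgauss w : measurableTypeR R -> C).
  exact/Cmeasurable_integrable/Cintegrable_cgauss.
have a20 : 0 < a / 2 by rewrite divr_gt0.
apply: (Cintegrable_le (CmeasurableM mc mg) (integrable_real_gaussian 0 (scale (cmod w)) a20)) => x.
rewrite (le_trans _ (cmod_cgauss_le x (lexx _)))// cmodM mulrC ler_wpM2l ?cmod_ge0//.
set s := growth (cmod w) x.
have s0 : 0 <= s.
  by rewrite /s /growth mulr_ge0 ?cmod_ge0// addr_ge0// addr_ge0// cmod_ge0.
have h : cmod (al * (x%:C - w)) <= s.
  rewrite cmodM ler_wpM2l ?cmod_ge0// (le_trans (cmodD _ _))// cmodN cmodR.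
  by rewrite lerD2l lerDl.
have := expR_ge1Dx (2 * s); move: (expR _) => t; lra.
Qed.

Let M w : C := Cint mu (cgauss w).
Let N w : C := Cint mu (dgauss w).

(** Integrating the pointwise expansion against its fixed real Gaussian majorant shows that M has
    the complex derivative N, with a remainder uniform in |w| <= r. *)
Lemma Cint_cgauss_taylor (r : R) : exists2 K : R, 0 <= K & forall w h,
  cmod w <= r -> cmod h <= 1 ->
  cmod (M (w + h) - M w - h * N w) <= K * cmod h ^+ 2.
Proof.
have a20 : 0 < a / 2 by rewrite divr_gt0.
pose G x := expR (scale r + 0 * x - (a / 2) / 2 * x ^+ 2).
pose I := Num.sqrt (2 * pi / (a / 2)) * expR (scale r + 0 ^+ 2 / (2 * (a / 2))).
have iG : (\int[mu]_x (G x)%:E = I%:E)%E by exact: integral_real_gaussian.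
exists (17 * I); first by rewrite mulr_ge0// mulr_ge0 ?sqrtr_ge0 ?expR_ge0.
move=> w h wr h1.
have i1 := CintegrableZl (-1) (Cintegrable_cgauss w).
have i2 := CintegrableZl (- h) (Cintegrable_dgauss w).
have i3 := CintegrableD (CintegrableD (Cintegrable_cgauss (w + h)) i1) i2.
have -> : M (w + h) - M w - h * N w = Cint mu (fun x =>
    cgauss (w + h) x + -1 * cgauss w x + - h * dgauss w x).
  rewrite CintD//; last exact: CintegrableD (Cintegrable_cgauss _) i1.
  rewrite CintD//; last exact: Cintegrable_cgauss.
  rewrite CintZl; last exact: Cintegrable_cgauss.
  rewrite CintZl; last exact: Cintegrable_dgauss.
  by rewrite mulN1r mulNr.
rewrite -lee_fin (le_trans (cmod_Cint_le i3))//.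
have i4 := integrableZl measurableT (cmod h ^+ 2 * 17)
  (integrable_real_gaussian 0 (scale r) a20).
apply: (@le_trans _ _ (\int[mu]_x ((cmod h ^+ 2 * 17)%:E * (G x)%:E))%E).
  apply: le_integral => //; first exact: integrable_cmod.
  move=> x _; rewrite -EFinM lee_fin -mulrA (le_trans _ (cgauss_taylor x wr h1))//.
  by rewrite mulN1r mulNr.
rewrite integralZl//; last exact: (integrable_real_gaussian 0 (scale r) a20).
by rewrite iG -EFinM lee_fin -[leLHS]mulrA [leLHS]mulrC.
Qed.

(* Real translations leave M unchanged, so its derivative N vanishes. *)
Lemma Cint_dgauss w : N w = 0.
Proof.
have [K K0 HK] := Cint_cgauss_taylor (cmod w).
apply: cmod_eq0; apply/eqP; rewrite eq_le cmod_ge0 andbT.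
apply/ler_addgt0Pr => e e0; rewrite add0r -[e]mul1r.
have K1 : 0 < K + 1 by rewrite ltr_wpDl.
pose h := Num.min 1 (e / (K + 1)).
have h0 : 0 < h by rewrite lt_min ltr01 divr_gt0.
have h1 : h <= 1 by rewrite ge_min lexx.
have he : h <= e / (K + 1) by rewrite ge_min lexx orbT.
have := HK w h%:C (lexx _); rewrite cmodR_ge0 ?(ltW h0)// => /(_ h1).
rewrite /M Cint_cgauss_translate -/(M w) subrr sub0r cmodN cmodM cmodR_ge0 ?(ltW h0)//.
rewrite expr2 mulrA mulrC ler_pM2r// mul1r. move=> /le_trans; apply.
rewrite (le_trans (ler_wpM2l K0 he))// mulrCA ler_piMr ?(ltW e0)//.
by rewrite ler_pdivrMr// mul1r lerDl.
Qed.

(** Since the derivative vanishes, a step of length |w| / m along the segment from 0 to w changes M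
    by at most B / m^2, and all m steps together by at most B / m. *)
Lemma Cint_cgauss_center w : Cint mu (cgauss w) = Cint mu (cgauss 0).
Proof.
have [K K0 HK] := Cint_cgauss_taylor (cmod w).
apply/eqP; rewrite -subr_eq0; apply/eqP/cmod_eq0.
apply/eqP; rewrite eq_le cmod_ge0 andbT; apply/ler_addgt0Pr => e e0; rewrite add0r.
pose B := K * cmod w ^+ 2.
have B0 : 0 <= B by rewrite mulr_ge0// sqr_ge0.
(* m > |w| keeps each step in the range |h| <= 1 of the expansion; m > B / e makes the total B / m
   at most e. *)
have [m m0 mB] : exists2 m, 0 < m%:R :> R & cmod w + B / e < m%:R.
  exists (Num.truncn (cmod w + B / e)).+1; first exact: ltr0Sn.
  exact: truncnS_gt.
have Be0 : 0 <= B / e by rewrite divr_ge0// ltW.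
have mw : cmod w <= m%:R by rewrite ltW// (le_lt_trans _ mB)// lerDl.
have step j : (j < m)%N -> cmod (M (w * (j.+1%:R / m%:R)%:C) - M (w * (j%:R / m%:R)%:C))
    <= B / m%:R ^+ 2.
  move=> jm; set v := w * (j%:R / m%:R)%:C.
  have -> : w * (j.+1%:R / m%:R)%:C = v + w * (m%:R^-1)%:C.
    by rewrite /v -mulrDr -rmorphD/= -[in LHS]addn1 natrD mulrDl mul1r.
  have := HK v (w * (m%:R^-1)%:C); rewrite Cint_dgauss mulr0 subr0.
  rewrite /v !cmodM !cmodR_ge0 ?invr_ge0 ?divr_ge0 ?ler0n//.
  rewrite ler_piMr ?cmod_ge0//; last by rewrite ler_pdivrMr// mul1r ler_nat ltnW.
  rewrite ler_pdivrMr// mul1r => /(_ erefl mw) /le_trans; apply.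
  by rewrite exprMn mulrA exprVn.
have tele j : (j <= m)%N ->
    cmod (M (w * (j%:R / m%:R)%:C) - M 0) <= j%:R * (B / m%:R ^+ 2).
  elim: j => [_|j IH jm]; first by rewrite !mul0r mulr0 subrr cmod0.
  rewrite -(subrK (M (w * (j%:R / m%:R)%:C)) (M _)) -addrA.
  have -> : j.+1%:R * (B / m%:R ^+ 2) = B / m%:R ^+ 2 + j%:R * (B / m%:R ^+ 2).
    by rewrite -natr1 mulrDl mul1r addrC.
  by apply: le_trans (cmodD _ _) _; apply: lerD; [exact: step|exact/IH/ltnW].
have := tele m (leqnn m); rewrite divff ?gt_eqF// mulr1 => /le_trans; apply.
have -> : m%:R * (B / m%:R ^+ 2) = B / m%:R by field; rewrite gt_eqF.
rewrite ler_pdivrMr//.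
by rewrite mulrC -ler_pdivrMr// ltW// (le_lt_trans _ mB)// lerDr cmod_ge0.
Qed.

End gaussian_shift.

Lemma CintJ d (T : measurableType d) (R : realType) (mu : {measure set T -> \bar R})
  (f : T -> R[i]) : Cintegrable mu f ->
  Cintegrable mu (fun x => (f x)^*) /\ Cint mu (fun x => (f x)^*) = (Cint mu f)^*.
Proof.
move=> fi; have [f1 f2] := fi; split.
  apply: (Cintegrable_dom _ fi) => [|x]; last by rewrite cmodJ.
  exact/CmeasurableJ/Cmeasurable_integrable/fi.
rewrite /Cint/= -mulN1r -RintegralZl//.
by congr Complex; apply: eq_Rintegral => x _; case: (f x) => //= *; rewrite mulN1r.
Qed.

(** * Complex Gaussian integrals and their modulus *)

Section gaussian_integral.
Context {R : realType}.
Local Notation C := R[i].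
Local Notation mu := (@lebesgue_measure R).
Implicit Types (a x : R) (k be al : C).

(* The value is sqrt (2 pi / al); only its modulus is computed, which avoids
   choosing a branch of the complex square root. *)
Definition gaussJ al : C := Cint mu (cgauss al 0).

Lemma Re_neq0 al : 0 < complex.Re al -> al != 0.
Proof. by move=> al0; apply/eqP => e; rewrite e ltxx in al0. Qed.

(** Completing the square moves the centre to the complex point be / al, on which the integral does
    not depend. *)
Lemma Cint_cquad k be al : 0 < complex.Re al ->
  Cint mu (fun x => cexp (cquad k be al x)) = gaussJ al * cexp (k + be ^+ 2 / (2 * al)).
Proof.
move=> al0; have aln := Re_neq0 al0.
have e x : cexp (cquad k be al x) = cexp (k + be ^+ 2 / (2 * al)) * cgauss al (be / al) x.
  by rewrite cgaussE -cexpD; congr cexp; rewrite /cquad; field.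
rewrite (eq_Cint mu e) CintZl; last exact: Cintegrable_cgauss.
by rewrite Cint_cgauss_center// mulrC.
Qed.

Lemma cgauss0E al x : cgauss al 0 x = cexp (cquad 0 0 al x).
Proof. by rewrite /cgauss; congr cexp; rewrite /cquad; ring. Qed.

Lemma conj_cquad k be al x :
  conjc (cquad k be al x) = cquad (conjc k) (conjc be) (conjc al) x.
Proof.
rewrite /cquad inv2C -real_complexX.
case: k be al => [? ?] [? ?] [? ?]; apply/eqP; rewrite eq_complex/=.
by apply/andP; split; apply/eqP; ring.
Qed.

Lemma gaussJR a : 0 < a -> gaussJ a%:C = (Num.sqrt (2 * pi / a))%:C.
Proof.
move=> a0; rewrite /gaussJ /Cint.
have e x : cgauss a%:C 0 x = (expR (0 + 0 * x - a / 2 * x ^+ 2))%:C.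
  rewrite -cexpR cgauss0E; congr cexp; rewrite /cquad inv2C.
  by rewrite !rmorphB/= !rmorphD !rmorphM/=.
congr Complex.
  under eq_Rintegral do rewrite e/=.
  rewrite /Rintegral integral_real_gaussian//=.
  by rewrite expr0n/= mul0r addr0 expR0 mulr1.
under eq_Rintegral do rewrite e/=.
by rewrite /Rintegral integral0_eq.
Qed.

(* Fubini for exp (- al x^2 / 2 - conj al (x + v)^2 / 2), integrated in x first. *)
Let gaussJ_mul_conj al : 0 < complex.Re al ->
  gaussJ al * conjc (gaussJ al) =
  gaussJ (2 * complex.Re al)%:C * gaussJ (cmod al ^+ 2 / (2 * complex.Re al))%:C.
Proof.
move=> al0; set a := complex.Re al in al0 *.
have aJ : 0 < complex.Re (conjc al) by case: (al) @a al0.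
have aln := Re_neq0 al0.
have ig := Cintegrable_cgauss al0 0.
have [ig' eg'] := CintJ ig.
have mg := Cmeasurable_integrable ig; have mg' := Cmeasurable_integrable ig'.
pose G (p : measurableTypeR R * measurableTypeR R) : C :=
  cgauss al 0 p.1 * conjc (cgauss al 0 (p.2 + p.1)).
have mG : Cmeasurable G.
  apply: CmeasurableM; first exact: (Cmeasurable_comp mg measurable_fst).
  have mp : measurable_fun setT
      (fun p : measurableTypeR R * measurableTypeR R => p.2 + p.1 : measurableTypeR R).
    by apply: measurable_funD; [exact: measurable_snd|exact: measurable_fst].
  exact: (Cmeasurable_comp mg' mp).
have Gv (x v : R) : G (x, v) =
    cexp (cquad (- (al + conjc al) / 2 * x%:C ^+ 2) (- conjc al * x%:C) (conjc al) v).
  rewrite -[LHS]/(cgauss al 0 x * conjc (cgauss al 0 (v + x))) !cgauss0E conj_cexp -cexpD.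
  by rewrite conj_cquad conjc0; congr cexp; rewrite /cquad rmorphD/=; field.
have a2E : (2 * a)%:C = al + conjc al.
  by rewrite /a; case: (al) => p q; apply/eqP; rewrite eq_complex/=; apply/andP;
    split; apply/eqP; ring.
have Gx (x v : R) : G (x, v) =
    cexp (cquad (- conjc al / 2 * v%:C ^+ 2) (- conjc al * v%:C) (2 * a)%:C x).
  rewrite Gv; congr cexp; rewrite /cquad.
  by rewrite a2E; field.
have a2 : 0 < 2 * a by rewrite mulr_gt0.
have i1 (x : R) : Cintegrable mu (fun v => G (x, v)).
  by under eq_fun do rewrite Gv; exact: Cintegrable_cquad.
have i2 (v : R) : Cintegrable mu (fun x => G (x, v)).
  by under eq_fun do rewrite Gx; exact: Cintegrable_cquad.
have iG : Cintegrable (mu \x mu)%E G.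
  apply: Cintegrable_prod12 => //.
  have c (x v : R) : cmod (G (x, v)) = cmod (cgauss al 0 x) *
     expR (- (a / 2 * x ^+ 2) + - a * x * v - a / 2 * v ^+ 2).
    rewrite cmodM cmodJ; congr (_ * _); rewrite cgauss0E cmod_cexp Re_cquad/=.
    by congr expR; rewrite /a; field.
  under eq_integral do under eq_integral do rewrite c EFinM.
  under eq_integral => x _.
    rewrite integralZl//; last exact: integrable_real_gaussian.
    rewrite integral_real_gaussian//.
    (* The v-integral of the modulus is translation invariant: the exponents cancel and only the
       integrable factor in x remains. *)
    rewrite (_ : - (a / 2 * x ^+ 2) + (- a * x) ^+ 2 / (2 * a) = 0); last first.
      by field; rewrite gt_eqF.
    over.
  rewrite integralZr//; last exact: integrable_cmod.
  have /(integrable_fin_num measurableT) := integrable_cmod ig.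
  by move=> /fineK <-; rewrite -EFinM ltry.
transitivity (Cint mu (fun x => Cint mu (fun v => G (x, v)))).
  rewrite /gaussJ -eg' mulrC -CintZl//; apply: eq_Cint => x; rewrite mulrC.
  have it : Cintegrable mu (fun v : R => conjc (cgauss al 0 (v + x))).
    apply: (CintJ _).1; rewrite (_ : (fun _ => _) = cgauss al (- x%:C)).
      exact: Cintegrable_cgauss.
    by apply/funext => v; rewrite /cgauss rmorphD/= subr0 opprK.
  transitivity (Cint mu (fun v => cgauss al 0 x * conjc (cgauss al 0 (v + x)))); last by [].
  rewrite [RHS](CintZl (cgauss al 0 x) it); congr (_ * _).
  exact: (Cint_translate1 (s := x) mg' it).
rewrite Cfubini//.
(* The x-integral has the real coefficient al + conj al = 2 a, and the coefficient left in v is conj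
   al - (conj al)^2 / (2 a) = |al|^2 / (2 a), real again. *)
transitivity (Cint mu (fun v => gaussJ (2 * a)%:C *
    cexp (cquad 0 0 (cmod al ^+ 2 / (2 * a))%:C v))).
  apply: eq_Cint => v; under eq_Cint do rewrite Gx.
  rewrite Cint_cquad//; congr (_ * cexp _).
  have -> : (cmod al ^+ 2 / (2 * a))%:C = al * conjc al / (al + conjc al).
    rewrite -a2E; have <- : (cmod al ^+ 2)%:C = al * conjc al.
      by rewrite sqr_cmod; case: (al) => p q; apply/eqP; rewrite eq_complex/=; apply/andP;
        split; apply/eqP; ring.
    exact: (fmorph_div (real_complex R)).
  have : al + conjc al != 0 by rewrite -a2E; apply: Re_neq0.
  by rewrite a2E /cquad => sn; field.
have a3 : 0 < cmod al ^+ 2 / (2 * a) by rewrite divr_gt0// exprn_gt0// cmod_gt0.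
rewrite CintZl; last exact: Cintegrable_cquad.
by congr (_ * _); apply: eq_Cint => v; rewrite cgauss0E.
Qed.

(** The real coefficients 2 Re al and |al|^2 / (2 Re al) multiply to |al|^2, so |gaussJ al|^2 = 2 pi
    / |al|. *)
Lemma cmod_gaussJ al : 0 < complex.Re al ->
  cmod (gaussJ al) = Num.sqrt (2 * pi / cmod al).
Proof.
move=> al0; have c0 := cmod_gt0 (Re_neq0 al0).
have pi0 : 0 < 2 * pi :> R by rewrite mulr_gt0// pi_gt0.
have q0 : 0 <= 2 * pi / cmod al by rewrite divr_ge0 ?(ltW c0)// ltW.
have a0 : 0 < 2 * complex.Re al by rewrite mulr_gt0.
have b0 : 0 < cmod al ^+ 2 / (2 * complex.Re al) by rewrite divr_gt0// exprn_gt0.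
have := congr1 (@cmod R) (gaussJ_mul_conj al0).
rewrite !cmodM cmodJ -expr2 !gaussJR// !cmodR_ge0 ?sqrtr_ge0// -sqrtrM; last first.
  by rewrite divr_ge0 ?(ltW pi0)// ltW.
have -> : 2 * pi / (2 * complex.Re al) *
    (2 * pi / (cmod al ^+ 2 / (2 * complex.Re al))) = (2 * pi / cmod al) ^+ 2.
  by field; rewrite !gt_eqF.
rewrite sqrtr_sqr (ger0_norm q0) => e.
apply/eqP; rewrite -(@eqrXn2 _ 2) ?cmod_ge0 ?sqrtr_ge0// e.
by rewrite (sqr_sqrtr q0).
Qed.

Lemma cmod_gaussJ_gt0 al : 0 < complex.Re al -> 0 < cmod (gaussJ al).
Proof.
move=> al0; rewrite cmod_gaussJ// sqrtr_gt0 divr_gt0 ?cmod_gt0 ?Re_neq0//.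
by rewrite mulr_gt0// pi_gt0.
Qed.

End gaussian_integral.

(** * Integrals over row vectors of products over the coordinates *)

Section product_integrals.
Context {R : realType}.
Local Notation C := R[i].
Local Notation mu := (@lebesgue_measure R).

Lemma measurable_rV_prod n (h : 'I_n -> R -> R) :
  (forall i, measurable_fun [set: measurableTypeR R] (h i)) ->
  measurable_fun setT (fun x : 'rV[R]_n => \prod_i h i (x ord0 i)).
Proof.
move=> mh; apply: measurable_prod => i _.
exact: (measurableT_comp (mh i) (measurable_coor i)).
Qed.

Lemma Cmeasurable_rV_prod n (f : 'I_n -> R -> C) :
  (forall i, Cmeasurable (f i : measurableTypeR R -> C)) ->
  Cmeasurable (fun x : 'rV[R]_n => \prod_i f i (x ord0 i)).
Proof.
move=> mf; elim: (index_enum _) => [|i s IH].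
  by under eq_fun do rewrite big_nil; exact: Cmeasurable_cst.
under eq_fun do rewrite big_cons.
apply: CmeasurableM => //; exact: (Cmeasurable_comp (mf i) (measurable_coor i)).
Qed.

Lemma ge0_integral_rV_prod n (h : 'I_n -> R -> R) (c : 'I_n -> R) :
  (forall i, measurable_fun [set: measurableTypeR R] (h i)) ->
  (forall i x, 0 <= h i x) ->
  (forall i, \int[mu]_x (h i x)%:E = (c i)%:E)%E ->
  (\int[lebesgue_rV R n]_x (\prod_i h i (x ord0 i))%:E = (\prod_i c i)%:E)%E.
Proof.
elim: n h c => [|n IH] h c mh h0 hc.
  rewrite ge0_integral_rV0//; first by rewrite !big_ord0.
    by apply/measurable_EFinP; exact: measurable_rV_prod.
  by move=> x; rewrite lee_fin prodr_ge0.
rewrite ge0_integral_rVS; first last.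
- by move=> x; rewrite lee_fin prodr_ge0.
- by apply/measurable_EFinP; exact: measurable_rV_prod.
have /= IHh := IH (h \o lift ord0) (c \o lift ord0) (fun i => mh _)
  (fun i => h0 _) (fun i => hc _).
rewrite big_ord_recl EFinM -(hc ord0) -IHh.
have me i : measurable_fun [set: measurableTypeR R] (EFin \o h i).
  exact/measurable_EFinP.
have mp : measurable_fun setT (EFin \o (fun x : 'rV[R]_n =>
    \prod_i h (lift ord0 i) (x ord0 i))).
  apply/measurable_EFinP.
  exact: (@measurable_rV_prod n (fun i => h (lift ord0 i)) (fun i => mh _)).
have p0 (x : 'rV[R]_n) : (0 <= (\prod_i h (lift ord0 i) (x ord0 i))%:E)%E.
  by rewrite lee_fin prodr_ge0.
rewrite -(ge0_integralZr _ measurableT (me ord0)); last 2 first.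
- by move=> x _; rewrite lee_fin.
- by apply: integral_ge0 => x _; exact: p0.
apply: eq_integral => a _.
rewrite -(ge0_integralZl _ measurableT mp); last 2 first.
- by move=> x _; exact: p0.
- by rewrite lee_fin.
apply: eq_integral => v _; rewrite big_ord_recl rV_cons0/= EFinM.
by congr (_ * _%:E)%E; apply: eq_bigr => i _; rewrite rV_consS.
Qed.

Lemma fine_integral_cmod (f : measurableTypeR R -> C) : Cintegrable mu f ->
  (\int[mu]_x (cmod (f x))%:E = (\int[mu]_x cmod (f x))%:E)%E.
Proof.
by move=> fi; rewrite /Rintegral fineK//; apply: integrable_fin_num => //;
  exact: integrable_cmod.
Qed.

Lemma Cintegrable_rV_prod n (f : 'I_n -> R -> C) :
  (forall i, Cintegrable mu (f i)) ->
  Cintegrable (lebesgue_rV R n) (fun x => \prod_i f i (x ord0 i)).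
Proof.
move=> fi; have mf i := Cmeasurable_integrable (fi i).
apply: CintegrableP; first exact: Cmeasurable_rV_prod.
under eq_integral do rewrite cmod_prod.
rewrite (ge0_integral_rV_prod (h := fun i x => cmod (f i x))
  (c := fun i => \int[mu]_x cmod (f i x)))//.
- exact: ltry.
- by move=> i; exact: measurable_cmod.
- by move=> i x; exact: cmod_ge0.
- by move=> i; exact: fine_integral_cmod.
Qed.

Lemma Cint_rV_prod n (f : 'I_n -> R -> C) :
  (forall i, Cintegrable mu (f i)) ->
  Cint (lebesgue_rV R n) (fun x => \prod_i f i (x ord0 i)) =
  \prod_i Cint mu (f i).
Proof.
elim: n f => [|n IH] f fi.
  rewrite big_ord0 /Cint; under eq_Rintegral do rewrite big_ord0.
  under [X in _ +i* X]eq_Rintegral do rewrite big_ord0.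
  rewrite /Rintegral (integral_dirac _ measurableT)// (integral_dirac _ measurableT)//.
  by rewrite diracT !mul1e.
have mf i := Cmeasurable_integrable (fi i).
have mP := Cmeasurable_rV_prod mf; have mc := @measurable_rV_cons R n.
have fS i : Cintegrable mu (f (lift ord0 i)) by exact: fi.
have iP := Cintegrable_rV_prod fS.
have e (a : R) (v : 'rV[R]_n) : \prod_i f i (rV_cons (a, v) ord0 i) =
    f ord0 a * \prod_i f (lift ord0 i) (v ord0 i).
  by rewrite big_ord_recl rV_cons0; congr (_ * _); apply: eq_bigr => i _; rewrite rV_consS.
have iF : Cintegrable (mu \x lebesgue_rV R n)%E
    ((fun x : 'rV[R]_n.+1 => \prod_i f i (x ord0 i)) \o @rV_cons R n).
  apply: Cintegrable_prod12; first exact: (Cmeasurable_comp mP mc).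
  under eq_integral do under eq_integral do rewrite /= e cmodM EFinM.
  under eq_integral => x _.
    rewrite integralZl//; last exact: integrable_cmod.
    over.
  have /(integrable_fin_num measurableT)/fineK <- := integrable_cmod iP.
  rewrite integralZr//; last exact/integrable_cmod/fi.
  by rewrite fine_integral_cmod// -EFinM ltry.
rewrite (CintS mP iF).2 Cint_prod12//; last first.
  by move=> x; under eq_fun do rewrite /= e; exact: CintegrableZl.
rewrite big_ord_recl -(IH (f \o lift ord0))//= mulrC -CintZl//.
apply: eq_Cint => x; under eq_Cint do rewrite /= e.
by rewrite CintZl// mulrC.
Qed.

End product_integrals.

Section gaussian_rV.
Context {R : realType} {n : nat}.
Local Notation C := R[i].
Local Notation E := 'rV[R]_n.
Local Notation leb := (lebesgue_rV R n).
Implicit Types (k be al : 'I_n -> C).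

(** The constant term is spread over the coordinates too, so that [cexp] of the sum is a product of
    one-dimensional factors. *)
Definition cquadn k be al (x : E) : C := \sum_j cquad (k j) (be j) (al j) (x ord0 j).

Lemma cexp_cquadn k be al x : cexp (cquadn k be al x) =
  \prod_j cexp (cquad (k j) (be j) (al j) (x ord0 j)).
Proof. exact: cexp_sum. Qed.

Lemma Re_cquadn k be al x : complex.Re (cquadn k be al x) =
  \sum_j (complex.Re (k j) + complex.Re (be j) * x ord0 j -
          complex.Re (al j) / 2 * x ord0 j ^+ 2).
Proof. by rewrite Re_sum; apply: eq_bigr => j _; rewrite Re_cquad. Qed.

Lemma Cmeasurable_cquadn k be al : Cmeasurable (fun x => cexp (cquadn k be al x)).
Proof.
under eq_fun do rewrite cexp_cquadn.
apply: (Cmeasurable_rV_prod (f := fun j t => cexp (cquad (k j) (be j) (al j) t))) => j.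
exact: Cmeasurable_cquad.
Qed.

Lemma Cintegrable_cquadn k be al : (forall j, 0 < complex.Re (al j)) ->
  Cintegrable leb (fun x => cexp (cquadn k be al x)).
Proof.
move=> al0; under eq_fun do rewrite cexp_cquadn.
apply: (Cintegrable_rV_prod (f := fun j t => cexp (cquad (k j) (be j) (al j) t))) => j.
exact: Cintegrable_cquad.
Qed.

Lemma Cint_cquadn k be al : (forall j, 0 < complex.Re (al j)) ->
  Cint leb (fun x => cexp (cquadn k be al x)) =
  \prod_j (gaussJ (al j) * cexp (k j + be j ^+ 2 / (2 * al j))).
Proof.
move=> al0; under eq_Cint do rewrite cexp_cquadn.
rewrite (Cint_rV_prod (f := fun j t => cexp (cquad (k j) (be j) (al j) t))).
  by apply: eq_bigr => j _; rewrite Cint_cquad.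
by move=> j; exact: Cintegrable_cquad.
Qed.

Lemma integral_real_gaussian_rV (k b a : 'I_n -> R) : (forall j, 0 < a j) ->
  (\int[leb]_x (expR (\sum_j (k j + b j * x ord0 j - a j / 2 * x ord0 j ^+ 2)))%:E =
   (\prod_j (Num.sqrt (2 * pi / a j) * expR (k j + b j ^+ 2 / (2 * a j))))%:E)%E.
Proof.
move=> a0; under eq_integral do rewrite expR_sum.
apply: (ge0_integral_rV_prod
  (h := fun j t => expR (k j + b j * t - a j / 2 * t ^+ 2))).
- by move=> i; exact: measurable_real_gaussian.
- by move=> i x; exact: expR_ge0.
- by move=> i; exact: integral_real_gaussian.
Qed.

End gaussian_rV.

(** * Schwartz functions *)

Section schwartz_gaussian.
Context {R : realType} {n : nat}.
Local Notation C := R[i].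
Local Notation E := 'rV[R]_n.
Implicit Types (f g p q : E -> C) (df dg : 'I_n -> E -> C).

Definition has_partials f df : Prop := forall x,
  [/\ differentiable (fun y => complex.Re (f y)) x,
      differentiable (fun y => complex.Im (f y)) x &
      forall i, partial i f x = df i x].

Lemma has_partials_cst (c : C) : has_partials (fun=> c) (fun _ _ => 0).
Proof.
move=> x; split; [exact: differentiable_cst|exact: differentiable_cst|move=> i].
by rewrite /partial !derive_cst.
Qed.

Lemma has_partials_coor (j : 'I_n) :
  has_partials (fun x => (x ord0 j)%:C) (fun i _ => (i == j)%:R).
Proof.
move=> x; split; [exact: differentiable_coord|exact: differentiable_cst|move=> i].
rewrite /partial derive_cst.
have -> : 'D_(delta_mx ord0 i) (fun y : E => complex.Re (y ord0 j)%:C) x = (i == j)%:R.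
  have @l : {linear E -> R}.
    by exists (fun N : E => N ord0 j); do 2![eexists]; do ?[constructor];
      rewrite ?mxE// => ? *; rewrite ?mxE//; move=> ?; rewrite !mxE.
  rewrite deriveE; last exact: differentiable_coord.
  rewrite -[fun _ => _]/(l : E -> R) diff_lin/=; last exact: coord_continuous.
  by rewrite mxE eqxx eq_sym.
by case: (i == j).
Qed.

Lemma has_partialsD f df g dg : has_partials f df -> has_partials g dg ->
  has_partials (fun x => f x + g x) (fun i x => df i x + dg i x).
Proof.
move=> hf hg x; have [f1 f2 fi] := hf x; have [g1 g2 gi] := hg x.
have eR : (fun y => complex.Re (f y + g y)) =
    (fun y => complex.Re (f y)) + (fun y => complex.Re (g y)).
  by apply/funext => y; rewrite ReD.
have eI : (fun y => complex.Im (f y + g y)) =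
    (fun y => complex.Im (f y)) + (fun y => complex.Im (g y)).
  by apply/funext => y; rewrite ImD.
split; [by rewrite eR; exact: differentiableD|by rewrite eI; exact: differentiableD|].
move=> i; rewrite -fi -gi /partial eR eI.
by rewrite !deriveD//; exact: diff_derivable.
Qed.

Lemma has_partialsM f df g dg : has_partials f df -> has_partials g dg ->
  has_partials (fun x => f x * g x) (fun i x => df i x * g x + f x * dg i x).
Proof.
move=> hf hg x; have [f1 f2 fi] := hf x; have [g1 g2 gi] := hg x.
pose fR y := complex.Re (f y); pose fI y := complex.Im (f y).
pose gR y := complex.Re (g y); pose gI y := complex.Im (g y).
have eR : (fun y => complex.Re (f y * g y)) = fR * gR - fI * gI.
  by apply/funext => y; rewrite ReM.
have eI : (fun y => complex.Im (f y * g y)) = fR * gI + fI * gR.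
  by apply/funext => y; rewrite ImM.
have dRR : differentiable (fR * gR) x by exact: differentiableM.
have dII : differentiable (fI * gI) x by exact: differentiableM.
have dRI : differentiable (fR * gI) x by exact: differentiableM.
have dIR : differentiable (fI * gR) x by exact: differentiableM.
split; [by rewrite eR; exact: differentiableB|by rewrite eI; exact: differentiableD|].
move=> i; set v := delta_mx ord0 i : E.
have pf : partial i f x = ('D_v fR x) +i* ('D_v fI x) by [].
have pg : partial i g x = ('D_v gR x) +i* ('D_v gI x) by [].
rewrite -fi -gi pf pg /partial eR eI -/v.
have [hfR hfI hgR hgI] : [/\ derivable fR x v, derivable fI x v,
  derivable gR x v & derivable gI x v] by split; exact: diff_derivable.
rewrite deriveB; [|exact: diff_derivable|exact: diff_derivable].
rewrite deriveD; [|exact: diff_derivable|exact: diff_derivable].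
rewrite (deriveM hfR hgR) (deriveM hfI hgI) (deriveM hfR hgI) (deriveM hfI hgR).
move: ('D_v fR x) ('D_v fI x) ('D_v gR x) ('D_v gI x) => a b c d.
have [-> ->] : f x = fR x +i* fI x /\ g x = gR x +i* gI x.
  by rewrite /fR /fI /gR /gI; case: (f x); case: (g x).
by apply/eqP; rewrite eq_complex/= /GRing.scale/=; apply/andP; split; apply/eqP; ring.
Qed.

Lemma derive_comp1 (u : E -> R) (h : R -> R) (dh : R) (x v : E) :
  differentiable u x -> is_derive (u x) 1 h dh ->
  differentiable (h \o u) x /\ 'D_v (h \o u) x = dh * 'D_v u x.
Proof.
move=> du [dh1 dhE]; have dh' : differentiable h (u x) by apply/derivable1_diffP.
split; first exact: differentiable_comp.
rewrite deriveE; last exact: differentiable_comp.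
rewrite diff_comp//= diff1E// -deriveE// derive1E dhE.
by rewrite /GRing.scale/= mulrC.
Qed.

Lemma has_partials_cexp f df : has_partials f df ->
  has_partials (fun x => cexp (f x)) (fun i x => df i x * cexp (f x)).
Proof.
move=> hf x; have [f1 f2 fi] := hf x.
pose fR y := complex.Re (f y); pose fI y := complex.Im (f y).
have eR : (fun y => complex.Re (cexp (f y))) = (expR \o fR) * (cos \o fI).
  by apply/funext => y; rewrite /cexp ReM/= mul0r subr0.
have eI : (fun y => complex.Im (cexp (f y))) = (expR \o fR) * (sin \o fI).
  by apply/funext => y; rewrite /cexp ImM/= mul0r addr0.
have he v := derive_comp1 v f1 (is_derive_expR (fR x)).
have hc v := derive_comp1 v f2 (is_derive_cos (fI x)).
have hs v := derive_comp1 v f2 (is_derive_sin (fI x)).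
have [de _] := he 0; have [dc _] := hc 0; have [ds _] := hs 0.
split; [by rewrite eR; exact: differentiableM|by rewrite eI; exact: differentiableM|].
move=> i; set v := delta_mx ord0 i : E.
have pf : partial i f x = ('D_v fR x) +i* ('D_v fI x) by [].
rewrite -fi pf /partial eR eI -/v.
have [hde hdc hds] : [/\ derivable (expR \o fR) x v, derivable (cos \o fI) x v &
  derivable (sin \o fI) x v] by split; exact: diff_derivable.
rewrite (deriveM hde hdc) (deriveM hde hds) (he v).2 (hc v).2 (hs v).2.
move: ('D_v fR x) ('D_v fI x) => a b.
have -> : f x = fR x +i* fI x by rewrite /fR /fI; case: (f x).
by apply/eqP; rewrite eq_complex/= /GRing.scale/=; apply/andP; split; apply/eqP; ring.
Qed.

(** Polynomial functions with complex coefficients, as an inductive class: closure under partial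
    derivatives and the growth bound are then inductions on the construction. *)
Inductive cpoly : (E -> C) -> Prop :=
| cpoly_cst c : cpoly (fun=> c)
| cpoly_coor j : cpoly (fun x => (x ord0 j)%:C)
| cpolyD p q : cpoly p -> cpoly q -> cpoly (fun x => p x + q x)
| cpolyM p q : cpoly p -> cpoly q -> cpoly (fun x => p x * q x).

Lemma cpoly_partials p : cpoly p ->
  exists2 dp, forall i, cpoly (dp i) & has_partials p dp.
Proof.
elim=> {p} [c|j|p q cp [dp cdp hp] cq [dq cdq hq]|p q cp [dp cdp hp] cq [dq cdq hq]].
- by exists (fun _ _ => 0); [move=> i; exact: cpoly_cst|exact: has_partials_cst].
- by exists (fun i _ => (i == j)%:R); [move=> i; exact: cpoly_cst|exact: has_partials_coor].
- exists (fun i x => dp i x + dq i x); last exact: has_partialsD.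
  by move=> i; exact: cpolyD.
- exists (fun i x => dp i x * q x + p x * dq i x); last exact: has_partialsM.
  by move=> i; apply: cpolyD; exact: cpolyM.
Qed.

(** The functions p exp q with p, q polynomial are stable under derivatives: the prefactor p becomes
    dp + p dq. *)
Lemma cpoly_partials_cexp p q (t : seq 'I_n) : cpoly p -> cpoly q ->
  exists2 pt, cpoly pt & partials t (fun x => p x * cexp (q x)) =
    (fun x => pt x * cexp (q x)).
Proof.
move=> cp cq; have [dq cdq hq] := cpoly_partials cq.
elim: t => [|i t [pt cpt ept]]; first by exists p.
have [dpt cdpt hpt] := cpoly_partials cpt.
exists (fun x => dpt i x + pt x * dq i x).
  by apply: cpolyD => //; exact: cpolyM.
rewrite /= ept; apply/funext => x.
have [_ _ ->] := has_partialsM hpt (has_partials_cexp hq) x.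
by rewrite mulrDl mulrA.
Qed.

Definition sqnorm (x : E) : R := \sum_j x ord0 j ^+ 2.

(** A coordinate obeys |x_j| <= 1 + |x|^2 <= (1 + 1 / d) (1 + d |x|^2), and a product is handled by
    giving d / 2 to each factor; hence the quantification over all d > 0. *)
Lemma cpoly_growth p : cpoly p -> forall d : R, 0 < d ->
  exists K : R, forall x, cmod (p x) <= K * expR (d * sqnorm x).
Proof.
have s0 x : 0 <= sqnorm x by rewrite sumr_ge0// => i _; rewrite sqr_ge0.
elim=> {p} [c|j|p q cp hp cq hq|p q cp hp cq hq] d d0.
- exists (cmod c) => x; rewrite ler_peMr ?cmod_ge0// -expR0 ler_expR.
  by rewrite mulr_ge0// ltW.
- exists (1 + d^-1) => x; rewrite cmodR.
  have h : `|x ord0 j| <= 1 + x ord0 j ^+ 2.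
    rewrite -[_ ^+ 2]real_normK ?num_real//; move: `|_| => t.
    by have := sqr_ge0 (t - 1); have := sqr_ge0 t; nra.
  have h2 : x ord0 j ^+ 2 <= sqnorm x.
    by rewrite /sqnorm (bigD1 j)//= lerDl sumr_ge0// => i _; rewrite sqr_ge0.
  rewrite (le_trans h)// (@le_trans _ _ ((1 + d^-1) * (1 + d * sqnorm x)))//; last first.
    by rewrite ler_wpM2l ?addr_ge0 ?invr_ge0 ?(ltW d0)// expR_ge1Dx.
  have -> : (1 + d^-1) * (1 + d * sqnorm x) = 1 + sqnorm x + (d^-1 + d * sqnorm x).
    by field; rewrite gt_eqF.
  rewrite (@le_trans _ _ (1 + sqnorm x)) ?lerD2l// lerDl addr_ge0 ?invr_ge0 ?(ltW d0)//.
  by rewrite mulr_ge0// ltW.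
- have [Kp hKp] := hp d d0; have [Kq hKq] := hq d d0.
  by exists (Kp + Kq) => x; rewrite mulrDl (le_trans (cmodD _ _))// lerD.
- have d20 : 0 < d / 2 by rewrite divr_gt0.
  have [Kp hKp] := hp _ d20; have [Kq hKq] := hq _ d20.
  exists (Kp * Kq) => x; rewrite cmodM {1}(splitr d) mulrDl expRD mulrACA.
  by rewrite ler_pM ?cmod_ge0.
Qed.

Lemma cpoly_sum (I : Type) (s : seq I) (F : I -> E -> C) :
  (forall i, cpoly (F i)) -> cpoly (fun x => \sum_(i <- s) F i x).
Proof.
move=> cF; elim: s => [|i s IH].
  by under eq_fun do rewrite big_nil; exact: cpoly_cst.
by under eq_fun do rewrite big_cons; exact: cpolyD.
Qed.

Lemma cpoly_cquadn (k be al : 'I_n -> C) : cpoly (cquadn k be al).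
Proof.
apply: cpoly_sum => j.
rewrite (_ : (fun _ => _) = (fun x : E => (k j + be j * (x ord0 j)%:C) +
   (- (al j / 2)) * ((x ord0 j)%:C * (x ord0 j)%:C))).
  by apply: cpolyD; [apply: cpolyD; [exact: cpoly_cst|]|]; apply: cpolyM;
    rewrite ?[X in cpoly X]/(fun=> _); do ?[exact: cpoly_cst|exact: cpoly_coor];
    apply: cpolyM; exact: cpoly_coor.
by apply/funext => x; rewrite /cquad expr2 mulNr.
Qed.

Lemma cpoly_monomial (s : seq 'I_n) :
  cpoly (fun x => (\prod_(i <- s) x ord0 i)%:C).
Proof.
elim: s => [|i s IH].
  by under eq_fun do rewrite big_nil; exact: cpoly_cst.
under eq_fun do rewrite big_cons rmorphM/=.
by apply: (cpolyM (cpoly_coor i)).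
Qed.

Lemma cexp_cquadn_decay (k be al : 'I_n -> C) : (forall j, 0 < complex.Re (al j)) ->
  exists2 d : R, 0 < d & exists K : R, forall x,
    cmod (cexp (cquadn k be al x)) <= K * expR (- (d * sqnorm x)).
Proof.
(* Of the decay Re al / 2, one half absorbs the linear term and one half, Re al / 4, is kept. The
   default 1 keeps d positive when n = 0. *)
move=> al0; pose d := \big[Num.min/1]_j (complex.Re (al j) / 4).
have d0 : 0 < d by rewrite lt_bigmin// => j _; rewrite divr_gt0.
exists d => //.
exists (expR (\sum_j (complex.Re (k j) + complex.Re (be j) ^+ 2 / complex.Re (al j)))) => x.
rewrite cmod_cexp Re_cquadn -expRD ler_expR /sqnorm mulr_sumr -sumrN -big_split/=.
apply: ler_sum => j _.
have da : d <= complex.Re (al j) / 4 by exact: bigmin_le_cond.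
move: (complex.Re (al j)) (al0 j) da (complex.Re (be j)) (x ord0 j) => a a0 da b t.
have h : b * t <= a / 4 * t ^+ 2 + b ^+ 2 / a.
  rewrite -subr_ge0.
  have -> : a / 4 * t ^+ 2 + b ^+ 2 / a - b * t = (a / 2 * t - b) ^+ 2 / a.
    by field; rewrite gt_eqF.
  by rewrite divr_ge0 ?sqr_ge0// ltW.
have h2 : d * t ^+ 2 <= a / 4 * t ^+ 2 by rewrite ler_wpM2r// sqr_ge0.
by move: (t ^+ 2) (b ^+ 2 / a) (b * t) h h2 => *; lra.
Qed.

(** There are finitely many multi-indices of order at most N. The induction runs over the first
    letter, and a sum of absolute values dominates all the constants obtained; it is applied to the
    monomial and to the derivative in turn. *)
Lemma uniform_bound (P : seq 'I_n -> R -> Prop) N :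
  (forall s c c', P s c -> c <= c' -> P s c') ->
  (forall s, exists c, P s c) ->
  exists c, forall s, (size s <= N)%N -> P s c.
Proof.
elim: N P => [|N IH] P mP hP.
  by have [c hc] := hP [::]; exists c => -[].
have /fin_all_exists[c hc] (i : 'I_n) : exists c, forall s, (size s <= N)%N -> P (i :: s) c.
  by apply: (IH (fun s => P (i :: s))) => [s|s]; [exact: mP|exact: hP].
have [c0 hc0] := hP [::].
exists (`|c0| + \sum_i `|c i|) => -[_|i s sN].
  by apply: mP hc0 _; rewrite (le_trans (ler_norm _))// lerDl sumr_ge0.
apply: mP (hc i s sN) _; rewrite (le_trans (ler_norm _))//.
by rewrite (bigD1 i)//= addrCA lerDl addr_ge0// sumr_ge0.
Qed.

(** Any derivative times any monomial is again polynomial times the same Gaussian, and the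
    polynomial is bounded by exp (d |x|^2) with the very d at which the Gaussian decays. *)
Lemma schwartz_gaussian p (k be al : 'I_n -> C) : cpoly p ->
  (forall j, 0 < complex.Re (al j)) ->
  schwartz (fun x => p x * cexp (cquadn k be al x)).
Proof.
move=> cp al0; set q := cquadn k be al; have cq : cpoly q by exact: cpoly_cquadn.
have [dq cdq hq] := cpoly_partials cq.
split.
  move=> t x; have [pt cpt ->] := cpoly_partials_cexp t cp cq.
  have [dpt cdpt hpt] := cpoly_partials cpt.
  by have [] := has_partialsM hpt (has_partials_cexp hq) x.
move=> N; have [d d0 [K hK]] := cexp_cquadn_decay k be al0.
have B (s t : seq 'I_n) : exists c, forall x : E,
    cmod ((\prod_(i <- s) x ord0 i)%:C * partials t (fun x : E => p x * cexp (q x)) x) <= c.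
  have [pt cpt ->] := cpoly_partials_cexp t cp cq.
  have [K' hK'] := cpoly_growth (cpolyM (cpoly_monomial s) cpt) d0.
  exists (K' * K) => x; rewrite mulrA cmodM.
  rewrite (le_trans (ler_pM (cmod_ge0 _) (cmod_ge0 _) (hK' x) (hK x)))//.
  by rewrite mulrACA -expRD subrr expR0 mulr1.
have B2 (s : seq 'I_n) : exists c, forall t, (size t <= N)%N -> forall x : E,
    cmod ((\prod_(i <- s) x ord0 i)%:C * partials t (fun x : E => p x * cexp (q x)) x) <= c.
  apply: (@uniform_bound (fun t c => forall x : E, cmod ((\prod_(i <- s) x ord0 i)%:C *
    partials t (fun x : E => p x * cexp (q x)) x) <= c)); last exact: B.
  by move=> t c c' H cc' x; rewrite (le_trans (H x)).
have [c hc] := @uniform_bound (fun s c => forall t, (size t <= N)%N -> forall x : E,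
    cmod ((\prod_(i <- s) x ord0 i)%:C * partials t (fun x : E => p x * cexp (q x)) x) <= c) N
  (fun s c c' H cc' t tN x => le_trans (H t tN x) cc') B2.
by exists c => s t x sN tN; exact: hc.
Qed.

End schwartz_gaussian.

(** * Dominated convergence for complex integrands *)

Section complex_dominated_convergence.
Context d (T : measurableType d) (R : realType) (mu : {measure set T -> \bar R}).

Lemma Cint_dominated_cvg (f_ : nat -> T -> R[i]) (f : T -> R[i]) (g : T -> R) :
  (forall k, Cmeasurable (f_ k)) -> Cmeasurable f ->
  mu.-integrable setT (EFin \o g) ->
  (forall k x, cmod (f_ k x) <= g x) ->
  (forall x, complex.Re (f_ k x) @[k --> \oo] --> complex.Re (f x)) ->
  (forall x, complex.Im (f_ k x) @[k --> \oo] --> complex.Im (f x)) ->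
  complex.Re (Cint mu (f_ k)) @[k --> \oo] --> complex.Re (Cint mu f) /\
  complex.Im (Cint mu (f_ k)) @[k --> \oo] --> complex.Im (Cint mu f).
Proof.
move=> mf_ mf ig fg cR cI.
have H (h_ : nat -> T -> R) (h : T -> R) : (forall k, measurable_fun setT (h_ k)) ->
    measurable_fun setT h -> (forall k x, `|h_ k x| <= g x) ->
    (forall x, h_ k x @[k --> \oo] --> h x) ->
    (\int[mu]_x h_ k x)%R @[k --> \oo] --> (\int[mu]_x h x)%R.
  move=> mh_ mh hg ch.
  have [] := @dominated_convergence _ _ _ mu setT measurableT
    (fun k x => (h_ k x)%:E) (fun x => (h x)%:E) (EFin \o g).
  - by move=> k; apply/measurable_EFinP.
  - exact/measurable_EFinP.
  - by apply: aeW => x _; apply/cvg_EFin; [exact: nearW|exact: ch].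
  - exact: ig.
  - by apply: aeW => x k _; rewrite /= lee_fin.
  move=> ih _ cv; rewrite /Rintegral.
  have fin := integrable_fin_num measurableT ih.
  by apply: fine_cvg; rewrite fineK.
have [mR mI] := mf.
split; apply: H => //.
- by move=> k; have [] := mf_ k.
- by move=> k x; rewrite (le_trans (Re_le_cmod _)).
- by move=> k; have [] := mf_ k.
- by move=> k x; rewrite (le_trans (Im_le_cmod _)).
Qed.

End complex_dominated_convergence.

(** * Schwartz functions as integrands and as test functions *)

Section schwartz_integrable.
Context {R : realType} {n : nat}.
Local Notation C := R[i].
Local Notation E := 'rV[R]_n.
Local Notation leb := (lebesgue_rV R n).
Implicit Types f g phi : E -> C.

Lemma Cmeasurable_continuous f : continuous (fun x => complex.Re (f x)) ->
  continuous (fun x => complex.Im (f x)) -> Cmeasurable f.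
Proof. by move=> ? ?; split; exact: continuous_measurable_rV. Qed.

Lemma schwartz_continuous phi : schwartz phi ->
  continuous (fun x => complex.Re (phi x)) /\ continuous (fun x => complex.Im (phi x)).
Proof.
move=> [sm _]; split => x; apply: differentiable_continuous.
  by have [] := sm [::] x.
by have [] := sm [::] x.
Qed.

Lemma schwartz_Cmeasurable phi : schwartz phi -> Cmeasurable phi.
Proof. by move=> /schwartz_continuous[? ?]; exact: Cmeasurable_continuous. Qed.

Lemma schwartz_bounded phi : schwartz phi -> exists c, forall x, cmod (phi x) <= c.
Proof.
move=> [_ /(_ 0)[c hc]]; exists c => x.
by have := hc [::] [::] x isT isT; rewrite big_nil mul1r.
Qed.

Lemma integral_oneDsqrV : (\int[lebesgue_measure]_x ((oneDsqr (x : R))^-1)%:E = pi%:E)%E.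
Proof.
rewrite ge0_symfun_integralT//=.
- rewrite (_ : [set x | _] = `[0, +oo[%classic); last first.
    by apply/seteqP; split => x/=; rewrite in_itv/= andbT.
  by rewrite integral0y_oneDsqr -EFinM mulrCA divff// mulr1.
- exact: continuous_oneDsqrV.
- by move=> x/=; rewrite /oneDsqr sqrrN.
Qed.

(** Multiplying by one more factor 1 + x_j^2 costs two more letters in the monomial, so the
    seminorms suffice by induction on the list of coordinates. The weight is a product of integrable
    functions of one variable. *)
Lemma schwartz_decay phi : schwartz phi -> exists c, forall x,
  cmod (phi x) <= c * \prod_j (oneDsqr (x ord0 j))^-1.
Proof.
move=> [_ sp].
suff /(_ (index_enum 'I_n) [::])[c hc] (l s : seq 'I_n) : exists c, forall x : E,
    cmod ((\prod_(i <- s) x ord0 i)%:C * phi x) * \prod_(j <- l) oneDsqr (x ord0 j) <= c.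
  exists c => x; rewrite prodfV ler_pdivlMr; last first.
    by apply: prodr_gt0 => j _; rewrite (lt_le_trans ltr01)// oneDsqr_ge1.
  by have := hc x; rewrite big_nil mul1r.
elim: l s => [|j l IH] s.
  have [c hc] := sp (size s); exists c => x; rewrite big_nil mulr1.
  by have := hc s [::] x (leqnn _) isT.
have [c1 h1] := IH s; have [c2 h2] := IH [:: j, j & s].
exists (c1 + c2) => x; rewrite big_cons /oneDsqr -/(oneDsqr _).
rewrite mulrCA mulrDl mul1r lerD//; apply: le_trans (h2 x).
have -> : (\prod_(i <- [:: j, j & s]) x ord0 i)%:C * phi x =
    (x ord0 j ^+ 2)%:C * ((\prod_(i <- s) x ord0 i)%:C * phi x).
  by rewrite !big_cons !rmorphM/=; ring.
by rewrite [X in _ <= X * _]cmodM cmodR_ge0 ?sqr_ge0// mulrA.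
Qed.

Lemma schwartz_integrable phi : schwartz phi -> Cintegrable leb phi.
Proof.
move=> sp; have [c hc] := schwartz_decay sp.
have iw : leb.-integrable setT (EFin \o (fun x : E => \prod_j (oneDsqr (x ord0 j))^-1)).
  have w0 (t : R) : 0 <= (oneDsqr t)^-1.
    by rewrite invr_ge0 (le_trans ler01)// oneDsqr_ge1.
  have mw : measurable_fun [set: measurableTypeR R] (fun t : R => (oneDsqr t)^-1).
    exact: (continuous_measurable_fun continuous_oneDsqrV).
  apply/integrableP; split.
    by apply/measurable_EFinP; exact: (@measurable_rV_prod R n (fun _ t => (oneDsqr t)^-1)).
  under eq_integral do rewrite /= ger0_norm ?prodr_ge0//.
  rewrite (ge0_integral_rV_prod (h := fun _ t => (oneDsqr t)^-1) (c := fun=> pi))//.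
  - exact: ltry.
  - by move=> i; exact: integral_oneDsqrV.
apply: (Cintegrable_le (schwartz_Cmeasurable sp) (integrableZl measurableT c iw)).
by move=> x; exact: hc.
Qed.

Lemma Cint_affine (c : R) (b : E) (c0 : 0 < c) f :
  Cmeasurable f -> Cintegrable leb (fun x => f (c *: x + b)) ->
  Cint leb f = (c ^+ n)%:C * Cint leb (fun x => f (c *: x + b)).
Proof.
move=> [mf1 mf2] [f1 f2].
have H (h : E -> R) : measurable_fun setT h ->
    leb.-integrable setT (fun x => (h (c *: x + b))%:E) ->
    (\int[leb]_x h x = c ^+ n * \int[leb]_x h (c *: x + b))%R.
  move=> mh ih; have mh' : measurable_fun setT (EFin \o h) by exact/measurable_EFinP.
  rewrite /Rintegral integralE.
  rewrite (ge0_integral_rV_affine b c0 (measurable_funepos mh'))//.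
  rewrite (ge0_integral_rV_affine b c0 (measurable_funeneg mh'))//.
  pose A (x : E) : E := c *: x + b.
  have ihA : leb.-integrable setT (EFin \o (h \o A)) by exact: ih.
  pose P := (\int[leb]_x (EFin \o (h \o A))^\+ x)%E.
  pose N := (\int[leb]_x (EFin \o (h \o A))^\- x)%E.
  have ip : P \is a fin_num by exact: integrable_pos_fin_num.
  have im : N \is a fin_num by exact: integrable_neg_fin_num.
  have eP : (\int[leb]_x (EFin \o h)^\+ (A x) = P)%E.
    by apply: eq_integral => x _; rewrite !funeposE.
  have eN : (\int[leb]_x (EFin \o h)^\- (A x) = N)%E.
    by apply: eq_integral => x _; rewrite !funenegE.
  have eh : (\int[leb]_x (h (A x))%:E = P - N)%E.
    by rewrite -[LHS]/(\int[leb]_x (EFin \o (h \o A)) x)%E integralE.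
  rewrite eP eN eh; move: P N ip im {eP eN eh} => [p| |]// [m| |]// _ _.
  by rewrite /= mulrBr.
rewrite /Cint (H _ mf1 f1) (H _ mf2 f2).
by apply/eqP; rewrite eq_complex/=; apply/andP; split; apply/eqP; ring.
Qed.

(** This makes [function_of] well defined. The difference is tested against Gaussians of width 1 /
    (k + 1) centred at x0; after rescaling, dominated convergence yields its value at x0 times the
    nonzero integral of a fixed Gaussian. *)
Lemma bounded_continuous_eq f g : bounded_continuous f -> bounded_continuous g ->
  (forall phi, schwartz phi -> distr f phi = distr g phi) -> f = g.
Proof.
move=> [[B1 hB1] f1 f2] [[B2 hB2] g1 g2] fg; apply/funext => x0.
have mf := Cmeasurable_continuous f1 f2; have mg := Cmeasurable_continuous g1 g2.
pose h x := f x - g x.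
have mh : Cmeasurable h.
  rewrite (_ : h = fun x => f x + -1 * g x); last by apply/funext => x; rewrite mulN1r.
  by apply: CmeasurableD => //; apply: CmeasurableM => //; exact: Cmeasurable_cst.
have hB x : cmod (h x) <= B1 + B2 by rewrite (le_trans (cmodD _ _))// cmodN lerD.
have hR x : complex.Re (h x) = complex.Re (f x) - complex.Re (g x) by rewrite ReD ReN.
have hI x : complex.Im (h x) = complex.Im (f x) - complex.Im (g x) by rewrite ImD ImN.
pose e (x : E) : C := cexp (cquadn (fun=> 0) (fun=> 0) (fun=> 1) x).
have ie : Cintegrable leb e by exact: Cintegrable_cquadn.
have me := Cmeasurable_integrable ie.
have dom (F : E -> C) : Cmeasurable F -> (forall x, cmod (F x) <= B1 + B2) ->
    Cintegrable leb (fun x => F x * e x).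
  move=> mF FB; apply: (Cintegrable_le _ (integrableZl measurableT (B1 + B2)
    (integrable_cmod ie))); first exact: CmeasurableM.
  by move=> x; rewrite cmodM ler_wpM2r// cmod_ge0.
have approx k : Cint leb (fun z => h (k.+1%:R^-1 *: z + x0) * e z) = 0.
  pose c : R := k.+1%:R; have c0 : 0 < c by rewrite /c ltr0n.
  (* This is exp (- c^2 |y - x0|^2 / 2), expanded coordinate by coordinate. *)
  pose phi (y : E) : C := 1 * cexp (cquadn
    (fun j => - (c ^+ 2 / 2 * x0 ord0 j ^+ 2)%:C)
    (fun j => (c ^+ 2 * x0 ord0 j)%:C) (fun=> (c ^+ 2)%:C) y).
  have sphi : schwartz phi.
    apply: schwartz_gaussian; first exact: cpoly_cst.
    by move=> j; rewrite exprn_gt0.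
  have phiE (z : E) : phi (c^-1 *: z + x0) = e z.
    rewrite /phi mul1r /e; congr cexp; apply: eq_bigr => j _.
    rewrite /cquad !mxE -!real_complexX inv2C; apply/eqP; rewrite eq_complex/=.
    by apply/andP; split; apply/eqP; [field; rewrite gt_eqF|ring].
  have ih : Cintegrable leb (fun z => h (c^-1 *: z + x0) * phi (c^-1 *: z + x0)).
    under eq_fun do rewrite phiE.
    apply: (dom (fun z => h (c^-1 *: z + x0))) => //.
    exact: (Cmeasurable_comp mh (measurable_rV_affine _ _)).
  have mhphi : Cmeasurable (fun y => h y * phi y).
    by apply: CmeasurableM => //; exact: schwartz_Cmeasurable.
  have c1 : 0 < c^-1 by rewrite invr_gt0.
  have := Cint_affine c1 mhphi ih.
  have -> : Cint leb (fun y => h y * phi y) = 0.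
    have bphi (F : E -> C) B : Cmeasurable F -> (forall x, cmod (F x) <= B) ->
        Cintegrable leb (fun x => F x * phi x).
      move=> mF FB; apply: (Cintegrable_le _ (integrableZl measurableT B
        (integrable_cmod (schwartz_integrable sphi)))).
        by apply: CmeasurableM => //; exact: schwartz_Cmeasurable.
      by move=> x; rewrite cmodM ler_wpM2r// cmod_ge0.
    have := fg phi sphi; rewrite -[distr f phi]/(Cint leb (fun y => f y * phi y)).
    rewrite -[distr g phi]/(Cint leb (fun y => g y * phi y)) => fgE.
    transitivity (Cint leb (fun y => f y * phi y + -1 * (g y * phi y))).
      by apply: eq_Cint => y; rewrite /h mulrBl mulN1r.
    rewrite CintD; [|exact: bphi hB1|apply: CintegrableZl; exact: bphi hB2].
    by rewrite CintZl ?fgE ?mulN1r ?subrr//; exact: bphi hB2.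
  move/eqP; rewrite eq_sym mulf_eq0 fmorph_eq0 expf_eq0 invr_eq0 (gt_eqF c0) andbF/=.
  by move=> /eqP H; rewrite -[RHS]H; apply: eq_Cint => z; rewrite phiE.
suff : h x0 = 0 by move/eqP; rewrite subr_eq0 => /eqP.
have cx (z : E) : (k.+1%:R^-1 *: z + x0) @[k --> \oo] --> x0.
  rewrite -[X in _ --> X]add0r -(scale0r z); apply: cvgD; last exact: cvg_cst.
  by apply: cvgZr_tmp; exact: cvg_harmonic.
have chR z : complex.Re (h (k.+1%:R^-1 *: z + x0)) @[k --> \oo] --> complex.Re (h x0).
  under eq_fun do rewrite hR; rewrite hR.
  apply: cvgB; [exact: (cvg_comp _ _ (cx z) (f1 x0))|exact: (cvg_comp _ _ (cx z) (g1 x0))].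
have chI z : complex.Im (h (k.+1%:R^-1 *: z + x0)) @[k --> \oo] --> complex.Im (h x0).
  under eq_fun do rewrite hI; rewrite hI.
  apply: cvgB; [exact: (cvg_comp _ _ (cx z) (f2 x0))|exact: (cvg_comp _ _ (cx z) (g2 x0))].
pose a (k : nat) := Cint leb (fun z => h (k.+1%:R^-1 *: z + x0) * e z).
have [cR cI] : complex.Re (a k) @[k --> \oo] --> complex.Re (Cint leb (fun z => h x0 * e z)) /\
    complex.Im (a k) @[k --> \oo] --> complex.Im (Cint leb (fun z => h x0 * e z)).
  apply: (@Cint_dominated_cvg _ _ _ leb
    (fun k z => h (k.+1%:R^-1 *: z + x0) * e z) _ (fun z => (B1 + B2) * cmod (e z))).
- move=> k; apply: CmeasurableM => //.
  exact: (Cmeasurable_comp mh (measurable_rV_affine _ _)).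
- by apply: CmeasurableM => //; exact: Cmeasurable_cst.
- exact: (integrableZl measurableT (B1 + B2) (integrable_cmod ie)).
- by move=> k z; rewrite cmodM ler_wpM2r// cmod_ge0.
- move=> z; under eq_fun do rewrite ReM; rewrite ReM.
  by apply: cvgB; apply: cvgM => //; exact: cvg_cst.
- move=> z; under eq_fun do rewrite ImM; rewrite ImM.
  by apply: cvgD; apply: cvgM => //; exact: cvg_cst.
have aE : a = fun=> 0 by apply/funext => k; exact: approx.
rewrite aE CintZl// in cR cI.
have zR : complex.Re (h x0 * Cint leb e) = 0.
  by apply/esym/(cvg_unique _ (cvg_cst _) cR).
have zI : complex.Im (h x0 * Cint leb e) = 0.
  by apply/esym/(cvg_unique _ (cvg_cst _) cI).
have : h x0 * Cint leb e = 0.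
  by apply/eqP; rewrite eq_complex zR zI !eqxx.
move/eqP; rewrite mulf_eq0 => /orP[/eqP//|/eqP ie0].
have := @Cint_cquadn R n (fun=> 0) (fun=> 0) (fun=> 1) (fun=> ltr01).
rewrite -[X in X = _ -> _]/(Cint leb e) ie0 => /(congr1 (@cmod R)); rewrite cmod0 cmod_prod => /eqP.
rewrite eq_sym gt_eqF// prodr_gt0// => j _.
by rewrite cmodM cmod_cexp mulr_gt0 ?expR_gt0// cmod_gaussJ_gt0//= ltr01.
Qed.

End schwartz_integrable.

Section fubini_bound.
Context d1 d2 (T1 : measurableType d1) (T2 : measurableType d2) (R : realType).
Variables (m1 : {sigma_finite_measure set T1 -> \bar R})
  (m2 : {sigma_finite_measure set T2 -> \bar R}).

Lemma Cintegrable_fubini_F (F : T1 * T2 -> R[i]) : Cintegrable (m1 \x m2)%E F ->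
  (forall x, Cintegrable m2 (fun y => F (x, y))) ->
  Cintegrable m1 (fun x => Cint m2 (fun y => F (x, y))).
Proof.
move=> [F1 F2] sF; split.
  apply: eq_integrable (integrable_fubini_F F1) => // x _.
  by rewrite /fubini_F /Rintegral/= fineK//; apply: integrable_fin_num => //; have [] := sF x.
apply: eq_integrable (integrable_fubini_F F2) => // x _.
by rewrite /fubini_F /Rintegral/= fineK//; apply: integrable_fin_num => //; have [] := sF x.
Qed.

(** An integrable majorant of the inner integrals of the modulus gives joint integrability by
    Tonelli and the integrability of the sections in y; the remaining sections are Gaussian wherever
    this is applied. *)
Lemma Cfubini_le (F : T1 * T2 -> R[i]) (A : T1 -> R) :
  Cmeasurable F -> m1.-integrable setT (EFin \o A) ->
  (forall x, \int[m2]_y (cmod (F (x, y)))%:E <= (A x)%:E)%E ->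
  (forall y, Cintegrable m1 (fun x => F (x, y))) ->
  Cintegrable m1 (fun x => Cint m2 (fun y => F (x, y))) /\
  Cint m1 (fun x => Cint m2 (fun y => F (x, y))) =
  Cint m2 (fun y => Cint m1 (fun x => F (x, y))).
Proof.
move=> mF iA FA F1.
have iF : Cintegrable (m1 \x m2)%E F.
  apply: Cintegrable_prod12 => //.
  have mcF : measurable_fun setT (fun z => (cmod (F z))%:E).
    by apply/measurable_EFinP/measurable_cmod.
  apply: (@le_lt_trans _ _ (\int[m1]_x (A x)%:E)%E).
    apply: ge0_le_integral => //.
    - by move=> x _; apply: integral_ge0 => y _; rewrite lee_fin cmod_ge0.
    - apply: (measurable_fun_fubini_tonelli_F _ mcF) => z.
      by rewrite lee_fin cmod_ge0.
    - by have /measurable_int := iA.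
  have /(integrable_fin_num measurableT)/fineK <- := iA; exact: ltry.
have F2 x : Cintegrable m2 (fun y => F (x, y)).
  apply: CintegrableP; first exact: (Cmeasurable_comp mF (measurable_pair1 _)).
  by apply: le_lt_trans (FA x) _; exact: ltry.
by split; [exact: Cintegrable_fubini_F|exact: Cfubini].
Qed.

End fubini_bound.

Section lower_integral.
Local Open Scope ereal_scope.
Context d (T : measurableType d) (R : realType) (mu : {measure set T -> \bar R}).

(* Neither function need be measurable: the integral of a nonnegative function
   is the supremum of the integrals of the simple functions below it. *)
Lemma ge0_le_lower_integral (f g : T -> \bar R) :
  (forall x, 0 <= f x) -> (forall x, f x <= g x) ->
  \int[mu]_x f x <= \int[mu]_x g x.
Proof.
move=> f0 fg; rewrite !ge0_integralTE//; last by move=> x; exact: le_trans (fg x).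
apply: ge_ereal_sup => _ [h hf <-]; apply: ereal_sup_ubound.
by exists h => // x; exact: le_trans (fg x).
Qed.

End lower_integral.

(** * Gabor transforms of Gaussians *)

Arguments gaussJ : simpl never.
Arguments cexp : simpl never.
Arguments Cint : simpl never.
Arguments cmod : simpl never.

Section phase_space_formulas.
Context {R : realType} {n : nat} (h : R) (h0 : 0 < h).
Local Notation C := R[i].
Local Notation E := 'rV[R]_n.
Local Notation leb := (lebesgue_rV R n).
Local Notation I := (0 +i* 1 : C).
Implicit Types (x y xi : E) (g : E -> C).

Definition hconst : R := (2 * pi * h) `^ (- (n%:R / 2)).

Lemma sqrI : I ^+ 2 = -1.
Proof. by rewrite expr2; apply/eqP; rewrite eq_complex/=; apply/andP; split; apply/eqP; ring. Qed.

Lemma twopih_gt0 : 0 < 2 * pi * h.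
Proof. by rewrite !mulr_gt0// pi_gt0. Qed.

Lemma hconstE : hconst = \prod_(j < n) (Num.sqrt (2 * pi * h))^-1.
Proof.
rewrite prodr_const card_ord /hconst powRN (mulrC n%:R) powRrM powR12_sqrt; last first.
  exact: (ltW twopih_gt0).
by rewrite powR_mulrn ?sqrtr_ge0// exprVn.
Qed.

Lemma hconst_gt0 : 0 < hconst.
Proof. exact: (powR_gt0 _ twopih_gt0). Qed.

Lemma expi_real_sum (F : 'I_n -> R) : expi (\sum_j F j) = cexp (\sum_j I * (F j)%:C).
Proof.
rewrite expiE; congr cexp; rewrite -mulr_sumr -rmorph_sum/=.
by apply/eqP; rewrite eq_complex/=; apply/andP; split; apply/eqP; ring.
Qed.

Lemma expi_dotp xi y : expi (dotp xi y / h) =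
  cexp (\sum_j I * (xi ord0 j)%:C * (y ord0 j)%:C / h%:C).
Proof.
rewrite /dotp mulr_suml expi_real_sum; congr cexp; apply: eq_bigr => j _.
by rewrite !rmorphM/= fmorphV !mulrA.
Qed.

Lemma chirpE x : chirp h x = cexp (\sum_j I * (x ord0 j)%:C ^+ 2 / (2 * h%:C)).
Proof.
rewrite /chirp /dotp mulr_suml expi_real_sum; congr cexp; apply: eq_bigr => j _.
by rewrite rmorphM/= fmorphV !rmorphM/= -expr2 (rmorph_nat (real_complex R) 2) mulrA.
Qed.

Lemma gaussianE (q : nat -> R) x : gaussian h q x =
  hconst%:C * cexp (\sum_(j < n) - ((q j.+1)%:C * (x ord0 j)%:C ^+ 2 / (2 * h%:C))).
Proof.
rewrite /gaussian -/hconst rmorphM/=; congr (_ * _); rewrite -cexpR; congr cexp.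
rewrite mulr_sumr -sumrN rmorph_sum/=; apply: eq_bigr => j _.
by rewrite rmorphN/= !rmorphM/= fmorphV !rmorphM/= (rmorph_nat (real_complex R) 2) expr2 mulrC.
Qed.

Lemma conjcM (z w : C) : conjc (z * w) = conjc z * conjc w.
Proof. exact: rmorphM. Qed.

Lemma conj_tfshift g x xi y : conjc (tfshift h x xi g y) =
  hconst%:C * cexp (\sum_j - (I * (xi ord0 j)%:C * (y ord0 j)%:C / h%:C)) *
  conjc (g (y - x)).
Proof.
rewrite /tfshift -/hconst !conjcM conjc_real expi_dotp conj_cexp.
congr (_ * cexp _ * _); rewrite (rmorph_sum conjc); apply: eq_bigr => j _.
rewrite -[LHS]/(conjc (I * (xi ord0 j)%:C * (y ord0 j)%:C / h%:C)).
rewrite !conjcM conjc_inv !conjc_real.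
have -> : conjc I = - I by apply/eqP; rewrite eq_complex/= oppr0 !eqxx.
by rewrite !mulNr.
Qed.

Lemma conj_gaussian (q : nat -> R) x : conjc (gaussian h q x) = gaussian h q x.
Proof. by rewrite /gaussian conjc_real. Qed.

Lemma gaborE f g x xi : gabor h g (distr f) x xi =
  Cint leb (fun y => f y * conjc (tfshift h x xi g y)).
Proof. by []. Qed.

Lemma cmod_fresnel_cst : cmod (@fresnel_cst R n h) = hconst.
Proof. by rewrite /fresnel_cst cmodM cmod_expi mulr1 cmodR_ge0// ltW//; exact: hconst_gt0. Qed.

End phase_space_formulas.

(** * The infimum over windows *)

Section lower_bound_window.
Context {R : realType} {n : nat} (h : R) (h0 : 0 < h) (q : nat -> R)
  (q0 : forall j, 0 < q j).
Local Notation C := R[i].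
Local Notation E := 'rV[R]_n.
Local Notation leb := (lebesgue_rV R n).
Local Notation I := (0 +i* 1 : C).
Local Notation K := (@hconst R n h).

Lemma hC_neq0 : h%:C != 0 :> C.
Proof. by rewrite fmorph_eq0 gt_eqF. Qed.

Lemma hconstC_neq0 : K%:C != 0 :> C.
Proof. by rewrite fmorph_eq0 gt_eqF//; exact: hconst_gt0. Qed.

Lemma Re_divh (al : C) : complex.Re (al / h%:C) = complex.Re al / h.
Proof. by rewrite -fmorphV ReMr. Qed.

Lemma Re_divh_gt0 (al : C) : 0 < complex.Re al -> 0 < complex.Re (al / h%:C).
Proof. by move=> al0; rewrite Re_divh divr_gt0. Qed.

(** One factor [hconst] cancels the sqrt (2 pi h) of every coordinate, so the result is free of
    h. *)
Lemma cmod_prod_gaussJ (al : 'I_n -> C) : (forall j, 0 < complex.Re (al j)) ->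
  K * cmod (\prod_j gaussJ (al j / h%:C)) = \prod_j (Num.sqrt (cmod (al j)))^-1.
Proof.
move=> al0; rewrite hconstE// cmod_prod -big_split/=; apply: eq_bigr => j _.
have m0 := cmod_gt0 (Re_neq0 (al0 j)); have t0 := twopih_gt0 h0.
rewrite cmod_gaussJ ?Re_divh_gt0// cmodM cmodV cmodR_ge0 ?(ltW h0)//.
have -> : 2 * pi / (cmod (al j) / h) = (2 * pi * h) * (cmod (al j))^-1.
  by field; rewrite !gt_eqF.
by rewrite (sqrtrM _ (ltW t0)) sqrtrV ?(ltW m0)// mulKf// gt_eqF// sqrtr_gt0.
Qed.

Lemma prod_mul_cexp (a b : 'I_n -> C) :
  \prod_j (a j * cexp (b j)) = (\prod_j a j) * cexp (\sum_j b j).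
Proof. by rewrite big_split/= cexp_sum. Qed.

(** The z_j of the overview; ordinals start at 0 and the sequence is used from q 1 on. *)
Definition qi (j : 'I_n) : C := q j.+1 +i* 1.

Lemma cmod_qi j : cmod (qi j) = Num.sqrt (q j.+1 ^+ 2 + 1).
Proof. by rewrite cmodE/= expr1n. Qed.

Lemma qi_neq0 j : qi j != 0.
Proof. by apply: Re_neq0 => /=; exact: q0. Qed.

Lemma Re_inv (z : C) : complex.Re z^-1 = complex.Re z / cmod z ^+ 2.
Proof. by rewrite sqr_cmod; case: z. Qed.

Lemma Re_qiV_gt0 j : 0 < complex.Re (qi j)^-1.
Proof.
rewrite Re_inv; apply: divr_gt0; first exact: q0.
by rewrite exprn_gt0// cmod_gt0// qi_neq0.
Qed.

Lemma sqrt_cmodV (z : C) : (Num.sqrt (cmod z^-1))^-1 = Num.sqrt (cmod z).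
Proof. by rewrite cmodV sqrtrV ?cmod_ge0// invrK. Qed.

Lemma cmod_prod_gaussJ_qiV :
  K * cmod (\prod_j gaussJ ((qi j)^-1 / h%:C)) = \prod_j Num.sqrt (cmod (qi j)).
Proof.
rewrite (cmod_prod_gaussJ Re_qiV_gt0).
by under eq_bigr do rewrite sqrt_cmodV.
Qed.

Lemma cmod_chirp (x : E) : cmod (chirp h x) = 1.
Proof. exact: cmod_expi. Qed.

Lemma chirp_cquadn (x : E) :
  chirp h x = cexp (cquadn (fun=> 0) (fun=> 0) (fun=> - I / h%:C) x).
Proof.
rewrite chirpE//; congr cexp; apply: eq_bigr => j _; rewrite /cquad.
by field; exact: hC_neq0.
Qed.

Lemma Cmeasurable_chirp : Cmeasurable (chirp h : E -> C).
Proof.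
have -> : (chirp h : E -> C) =
    fun x => cexp (cquadn (fun=> 0) (fun=> 0) (fun=> - I / h%:C) x).
  by apply/funext => x; exact: chirp_cquadn.
exact: Cmeasurable_cquadn.
Qed.

Lemma gaussian_cquadn (x : E) : gaussian h q x = K%:C *
  cexp (cquadn (fun=> 0) (fun=> 0) (fun j => (q j.+1)%:C / h%:C) x).
Proof.
rewrite gaussianE//; congr (_ * cexp _); apply: eq_bigr => j _; rewrite /cquad.
by field; exact: hC_neq0.
Qed.

Lemma schwartz_gaussian_window : schwartz (gaussian h q : E -> C).
Proof.
rewrite (_ : gaussian h q = fun x => K%:C *
  cexp (cquadn (fun=> 0) (fun=> 0) (fun j => (q j.+1)%:C / h%:C) x)).
  apply: schwartz_gaussian; first exact: cpoly_cst.
  by move=> j; apply: Re_divh_gt0 => /=; exact: q0.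
by apply/funext => x; exact: gaussian_cquadn.
Qed.

Lemma cmod_gaussian_le (x : E) : cmod (gaussian h q x) <= K.
Proof.
have K0 : 0 < K by exact: hconst_gt0.
rewrite /gaussian -/K cmodR_ge0 ?mulr_ge0 ?(ltW K0) ?expR_ge0// ler_piMr ?(ltW K0)//.
rewrite -expR0 ler_expR oppr_le0 mulr_ge0 ?invr_ge0 ?mulr_ge0 ?(ltW h0)//.
by rewrite sumr_ge0// => j _; rewrite mulr_ge0 ?sqr_ge0// ltW.
Qed.

Lemma measurable_rV_translate (b : E) : measurable_fun setT (fun y : E => y + b).
Proof.
rewrite (_ : (fun _ => _) = (fun y : E => 1 *: y + b)).
  exact: measurable_rV_affine.
by apply/funext => y; rewrite scale1r.
Qed.

Lemma measurable_rV_add : measurable_fun setT (fun p : E * E => p.2 + p.1).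
Proof.
apply: measurable_fun_rV => i; under eq_fun do rewrite mxE.
apply: measurable_funD.
  exact: (measurableT_comp (measurable_coor i) measurable_snd).
exact: (measurableT_comp (measurable_coor i) measurable_fst).
Qed.

Lemma normM1inf_ge (gamma : E -> C) : schwartz gamma ->
  (((\prod_j Num.sqrt (cmod (qi j))) * cmod (inner (gaussian h q) gamma))%:E <=
   normM1inf h gamma (distr (Fplus h)))%E.
Proof.
move=> sg; have ig := schwartz_integrable sg; have mg := schwartz_Cmeasurable sg.
(* The integral of w x * chirp (x + y) over x is a multiple of gaussian y, so
   testing V against w recovers the inner product of gaussian and gamma. *)
pose om j : C := I + (qi j)^-1.
pose w x : C := cexp (cquadn (fun=> 0) (fun=> 0) (fun j => om j / h%:C) x).
have Re_om j : 0 < complex.Re (om j) by rewrite ReD/= add0r Re_qiV_gt0.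
have iw : Cintegrable leb w.
  by apply: Cintegrable_cquadn => j; exact: Re_divh_gt0.
have mw := Cmeasurable_integrable iw.
have w1 x : cmod (w x) <= 1.
  rewrite cmod_cexp Re_cquadn -expR0 ler_expR sumr_le0// => j _.
  rewrite mul0r !add0r oppr_le0 mulr_ge0 ?sqr_ge0// divr_ge0// ltW//.
  exact: Re_divh_gt0.
pose V x := gabor h gamma (distr (Fplus h)) x 0.
pose F (p : E * E) : C := conjc (gamma p.2) * (chirp h (p.2 + p.1) * w p.1).
have mF : Cmeasurable F.
  apply: CmeasurableM; first exact: (Cmeasurable_comp (CmeasurableJ mg) measurable_snd).
  apply: CmeasurableM; last exact: (Cmeasurable_comp mw measurable_fst).
  exact: (Cmeasurable_comp Cmeasurable_chirp measurable_rV_add).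
have cF x y : cmod (F (x, y)) = cmod (w x) * cmod (gamma y).
  by rewrite /F/= !cmodM cmodJ cmod_chirp mul1r mulrC.
(* Replacing y by y + x moves the shift from gamma to the chirp; at xi = 0 the modulation is
   trivial. *)
have VE x : V x * w x = (@fresnel_cst R n h * K%:C) * Cint leb (fun y => F (x, y)).
  pose f y : C := chirp h y * conjc (gamma (y - x)).
  have mf : Cmeasurable f.
    apply: CmeasurableM; first exact: Cmeasurable_chirp.
    exact: (Cmeasurable_comp (CmeasurableJ mg) (measurable_rV_translate (- x))).
  have fx y : f (y + x) = chirp h (y + x) * conjc (gamma y) by rewrite /f addrK.
  have ifx : Cintegrable leb (fun y => f (y + x)).
    apply: (Cintegrable_dom _ ig) => [|y]; last first.
      by rewrite fx cmodM cmod_chirp mul1r cmodJ.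
    exact: (Cmeasurable_comp mf (measurable_rV_translate x)).
  have [i_f fE] := Cint_translate mf ifx.
  have -> : V x = (@fresnel_cst R n h * K%:C) * Cint leb f.
    rewrite -CintZl// /V gaborE; apply: eq_Cint => y.
    rewrite conj_tfshift /Fplus /f.
    under eq_bigr do rewrite mxE mulr0 !mul0r oppr0.
    by rewrite big1// cexp0 mulr1 mulrACA.
  rewrite fE -mulrA; congr (_ * _); rewrite mulrC -CintZl//.
  by apply: eq_Cint => y; rewrite fx /F/=; ring.
have FE y : (fun x => F (x, y)) = fun x => conjc (gamma y) *
    cexp (cquadn (fun j => I * (y ord0 j)%:C ^+ 2 / (2 * h%:C))
      (fun j => I * (y ord0 j)%:C / h%:C) (fun j => (qi j)^-1 / h%:C) x).
  apply/funext => x; rewrite /F/= chirpE// /w -cexpD; congr (_ * cexp _).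
  rewrite -big_split/=; apply: eq_bigr => j _; rewrite /cquad mxE rmorphD/= /om.
  by field; rewrite hC_neq0 qi_neq0.
pose G := (\int[leb]_y cmod (gamma y))%R.
have GE : (\int[leb]_y (cmod (gamma y))%:E = G%:E)%E.
  by rewrite /G /Rintegral fineK//; apply: integrable_fin_num => //; exact: integrable_cmod.
have [] := @Cfubini_le _ _ _ _ _ leb leb F (fun x => cmod (w x) * G) mF _ _ _.
- exact: (integrableZr measurableT G (integrable_cmod iw)).
- move=> x; under eq_integral do rewrite cF EFinM.
  by rewrite integralZl ?GE//; exact: integrable_cmod.
- move=> y; rewrite FE; apply: CintegrableZl.
  by apply: Cintegrable_cquadn => j; apply: Re_divh_gt0; exact: Re_qiV_gt0.
move=> iCF CFE.
have [J JE] : exists J, J = \prod_j gaussJ ((qi j)^-1 / h%:C) by eexists.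
have CxF y : Cint leb (fun x => F (x, y)) =
    (J / K%:C) * (gaussian h q y * conjc (gamma y)).
  rewrite FE CintZl; last first.
    by apply: Cintegrable_cquadn => j; apply: Re_divh_gt0; exact: Re_qiV_gt0.
  rewrite Cint_cquadn; last by move=> j; apply: Re_divh_gt0; exact: Re_qiV_gt0.
  rewrite prod_mul_cexp gaussianE.
  (* The chirp reduces the quadratic coefficient of the weight from om to om - i = 1 / z. Completing
     the square then leaves (i + i^2 z) y^2 / 2h = - q y^2 / 2h, the exponent of the window. *)
  have -> : \sum_j (I * (y ord0 j)%:C ^+ 2 / (2 * h%:C) +
      (I * (y ord0 j)%:C / h%:C) ^+ 2 / (2 * ((qi j)^-1 / h%:C))) =
      \sum_(j < n) - ((q j.+1)%:C * (y ord0 j)%:C ^+ 2 / (2 * h%:C)).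
    apply: eq_bigr => j _.
    have -> : I * (y ord0 j)%:C ^+ 2 / (2 * h%:C) +
      (I * (y ord0 j)%:C / h%:C) ^+ 2 / (2 * ((qi j)^-1 / h%:C)) =
      (I + I ^+ 2 * qi j) * ((y ord0 j)%:C ^+ 2 / (2 * h%:C)).
      by field; rewrite hC_neq0 qi_neq0.
    have -> : I + I ^+ 2 * qi j = - (q j.+1)%:C.
      rewrite sqrI; apply/eqP; rewrite eq_complex/=.
      by apply/andP; split; apply/eqP; ring.
    by rewrite mulNr mulrA.
  have aux (P c k g : C) : k != 0 -> g * (P * c) = P / k * (k * c * g).
    by move=> k0; field.
  by rewrite JE; exact/aux/hconstC_neq0.
have iV : Cintegrable leb (fun x => V x * w x).
  by under eq_fun do rewrite VE; exact: CintegrableZl.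
have VwE : Cint leb (fun x => V x * w x) =
    @fresnel_cst R n h * J * inner (gaussian h q) gamma.
  have K0 := hconstC_neq0.
  have igg : Cintegrable leb (fun y => gaussian h q y * conjc (gamma y)).
    apply: (Cintegrable_le _ (integrableZl measurableT K (integrable_cmod ig))).
      apply: CmeasurableM; last exact: CmeasurableJ.
      exact/schwartz_Cmeasurable/schwartz_gaussian_window.
      move=> y; rewrite cmodM cmodJ.
    exact: (ler_wpM2r (cmod_ge0 (gamma y)) (cmod_gaussian_le y)).
  apply: (etrans (eq_Cint _ VE)); apply: (etrans (CintZl _ iCF)).
  rewrite CFE; apply: (etrans (congr1 _ (etrans (eq_Cint _ CxF) (CintZl _ igg)))).
  have aux (P c k i : C) : k != 0 -> c * k * (P / k * i) = c * P * i.
    by move=> k0; field.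
  exact: aux.
have cVw : cmod (Cint leb (fun x => V x * w x)) =
    (\prod_j Num.sqrt (cmod (qi j))) * cmod (inner (gaussian h q) gamma).
  have aux (a b c : C) : cmod (a * b * c) = cmod a * cmod b * cmod c by rewrite !cmodM.
  rewrite VwE JE; apply: (etrans (aux _ _ _)); congr (_ * _).
  by rewrite (cmod_fresnel_cst h0) cmod_prod_gaussJ_qiV.
rewrite -cVw; apply: (le_trans (cmod_Cint_le iV)).
(* Dropping w costs nothing in the limit of optimal windows: their transforms concentrate at x = 0,
   where w = 1. *)
apply: (@le_trans _ _ (\int[leb]_x (cmod (V x))%:E)%E).
  apply: ge0_le_lower_integral => x; rewrite lee_fin; first exact: cmod_ge0.
  by rewrite cmodM; exact: (ler_piMr (cmod_ge0 (V x)) (w1 x)).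
by apply: ereal_sup_ubound; exists 0.
Qed.

End lower_bound_window.

(** * One-sided limits *)

Section limits_at_right.
Context {R : realType}.
Implicit Types (F : R -> R) (A : R) (x : \bar R).

Lemma le_of_cvg_right F A x : (forall a, 0 < a -> (x <= (F a)%:E)%E) ->
  F a @[a --> 0^'+] --> A -> (x <= A%:E)%E.
Proof.
case: x => [x||] Fx FA; last exact: leNye.
- rewrite lee_fin; apply: (cvgr_to_ge FA).
  by near=> a; rewrite -lee_fin; apply: Fx; near: a; exact: nbhs_right_gt.
- by have := Fx 1 ltr01; rewrite leye_eq.
Unshelve. all: by end_near. Qed.

Lemma ge_of_cvg_right F A x : (forall a, 0 < a -> ((F a)%:E <= x)%E) ->
  F a @[a --> 0^'+] --> A -> (A%:E <= x)%E.
Proof.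
case: x => [x||] Fx FA; first last.
- by have := Fx 1 ltr01; rewrite leeNy_eq.
- exact: leey.
- rewrite lee_fin; apply: (cvgr_to_le FA).
  by near=> a; rewrite -lee_fin; apply: Fx; near: a; exact: nbhs_right_gt.
Unshelve. all: by end_near. Qed.

Lemma cvg_sqrt (T : Type) (G : set_system T) (FG : Filter G) (f : T -> R) (l : R) :
  f t @[t --> G] --> l -> Num.sqrt (f t) @[t --> G] --> Num.sqrt l.
Proof.
move=> fl; apply: (@continuous_cvg _ _ _ G FG f Num.sqrt l _ fl).
exact: sqrt_continuous.
Qed.

Lemma cvg_prod_ord n (F : 'I_n -> R -> R) (A : 'I_n -> R) (G : set_system R) :
  Filter G -> (forall j, F j a @[a --> G] --> A j) ->
  \prod_j F j a @[a --> G] --> \prod_j A j.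
Proof.
move=> FG FA; elim: (index_enum _) => [|j s IH].
  by under eq_fun do rewrite big_nil; rewrite big_nil; exact: cvg_cst.
by under eq_fun do rewrite big_cons; rewrite big_cons; exact: cvgM.
Qed.

End limits_at_right.

(** * Windows approaching the chirp *)

Section upper_bound_window.
Context {R : realType} {n : nat} (h : R) (h0 : 0 < h) (q : nat -> R)
  (q0 : forall j, 0 < q j).
Local Notation C := R[i].
Local Notation E := 'rV[R]_n.
Local Notation leb := (lebesgue_rV R n).
Local Notation I := (0 +i* 1 : C).
Local Notation K := (@hconst R n h).

Lemma cmodM3 (u v w : C) : cmod (u * v * w) = cmod u * cmod v * cmod w.
Proof. by rewrite !cmodM. Qed.

Lemma Cint_cquadn0 (al : 'I_n -> C) : (forall j, 0 < complex.Re (al j)) ->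
  Cint leb (fun x => cexp (cquadn (fun=> 0) (fun=> 0) al x)) = \prod_j gaussJ (al j).
Proof.
move=> al0; rewrite (Cint_cquadn _ _ al0); apply: eq_bigr => j _.
by rewrite expr2 !mul0r addr0 cexp0 mulr1.
Qed.

(* A Schwartz approximation of the formal optimal window exp (i |y|^2 / 2h). *)
Definition chirp_window (a : R) (y : E) : C :=
  cexp (cquadn (fun=> 0) (fun=> 0) (fun=> (a%:C - I) / h%:C) y).

Lemma schwartz_chirp_window a : 0 < a -> schwartz (chirp_window a).
Proof.
move=> a0; rewrite (_ : chirp_window a = fun x => 1 * chirp_window a x).
  apply: schwartz_gaussian; first exact: cpoly_cst.
  by move=> j; apply: Re_divh_gt0; rewrite //= subr0.
by apply/funext => x; rewrite mul1r.
Qed.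

Lemma conj_chirp_window a y : conjc (chirp_window a y) =
  cexp (cquadn (fun=> 0) (fun=> 0) (fun=> (a%:C + I) / h%:C) y).
Proof.
rewrite /chirp_window conj_cexp; congr cexp; rewrite /cquadn (rmorph_sum conjc).
apply: eq_bigr => j _; rewrite -[LHS]/(conjc (cquad 0 0 ((a%:C - I) / h%:C) (y ord0 j))).
have -> : (a%:C + I) / h%:C = conjc ((a%:C - I) / h%:C).
  rewrite conjcM conjc_inv conjc_real; congr (_ / _).
  by apply/eqP; rewrite eq_complex/=; apply/andP; split; apply/eqP; ring.
by rewrite conj_cquad !conjc_real.
Qed.

(** The phase of the conjugate window cancels that of F_+, leaving a real Gaussian in y of
    coefficient a / h with a complex linear term. The exponent stated is - |x - xi|^2 / (2 a h),
    expanded as a quadratic in x. *)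
Lemma cmod_gabor_chirp_window a x xi : 0 < a ->
  cmod (gabor h (chirp_window a) (distr (Fplus h)) x xi) =
  K * \prod_(j < n) (Num.sqrt a)^-1 *
  expR (\sum_j (- (xi ord0 j ^+ 2 / (2 * (a * h))) +
    xi ord0 j / (a * h) * x ord0 j - (a * h)^-1 / 2 * x ord0 j ^+ 2)).
Proof.
move=> a0.
pose k j : C := - ((a%:C + I) * (x ord0 j)%:C ^+ 2 / (2 * h%:C)).
pose be j : C := ((a%:C + I) * (x ord0 j)%:C - I * (xi ord0 j)%:C) / h%:C.
have al0 (j : 'I_n) : 0 < complex.Re (a%:C / h%:C) by exact: Re_divh_gt0.
have -> : gabor h (chirp_window a) (distr (Fplus h)) x xi =
    @fresnel_cst R n h * K%:C * Cint leb (fun y => cexp (cquadn k be (fun=> a%:C / h%:C) y)).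
  rewrite gaborE -CintZl; last exact: Cintegrable_cquadn.
  apply: eq_Cint => y; rewrite conj_tfshift conj_chirp_window /Fplus chirpE//.
  have aux (c u s v w : C) : (c * u) * (s * v * w) = c * s * (u * v * w) by ring.
  rewrite aux -!cexpD; congr (_ * cexp _); rewrite /cquadn -!big_split/=.
  apply: eq_bigr => j _; rewrite /cquad !mxE rmorphB/= /k /be.
  by field; exact: hC_neq0.
rewrite cmodM3 (cmod_fresnel_cst h0) Cint_cquadn// prod_mul_cexp cmodM cmod_cexp.
rewrite cmodR_ge0 ?(ltW (hconst_gt0 h0))// mulrA -(mulrA K K).
rewrite (cmod_prod_gaussJ h0 (al := fun=> a%:C))//; congr (_ * _ * expR _).
  by apply: eq_bigr => j _; rewrite cmodR_ge0// ltW.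
rewrite Re_sum; apply: eq_bigr => j _.
(* At w = i, with the other variables real, this separates the real part - (X - Z)^2 / (2 A H) from
   a purely imaginary rest. *)
have aux2 (A H X Z w : C) : A != 0 -> H != 0 ->
    - ((A + w) * X ^+ 2 / (2 * H)) + (((A + w) * X - w * Z) / H) ^+ 2 / (2 * (A / H)) =
    w ^+ 2 * (X - Z) ^+ 2 / (2 * (A * H)) + w * (X * (X - 2 * Z) / (2 * H)).
  by move=> A0 H0; field; rewrite A0 H0.
have a0' : a%:C != 0 :> C by rewrite fmorph_eq0 gt_eqF.
rewrite /k /be aux2//; last exact: hC_neq0.
rewrite sqrI.
have -> : -1 * ((x ord0 j)%:C - (xi ord0 j)%:C) ^+ 2 / (2 * (a%:C * h%:C)) =
    (- (x ord0 j - xi ord0 j) ^+ 2 / (2 * (a * h)))%:C :> C.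
  by rewrite mulN1r !rmorphM/= fmorphV !rmorphM/= rmorphN/= rmorphXn/= rmorphB/= rmorph_nat.
have -> : (x ord0 j)%:C * ((x ord0 j)%:C - 2 * (xi ord0 j)%:C) / (2 * h%:C) =
    (x ord0 j * (x ord0 j - 2 * xi ord0 j) / (2 * h))%:C :> C.
  by rewrite !rmorphM/= fmorphV !rmorphM/= rmorphB/= !rmorphM/= rmorph_nat.
rewrite ReD ReMr mul0r addr0/=.
by field; rewrite !gt_eqF.
Qed.

Lemma normM1inf_chirp_window_le a : 0 < a ->
  (normM1inf h (chirp_window a) (distr (Fplus h)) <= 1)%E.
Proof.
move=> a0; apply: ge_ereal_sup => _ [xi _ <-].
under eq_integral do rewrite (cmod_gabor_chirp_window _ _ a0) EFinM.
pose k (j : 'I_n) := - (xi ord0 j ^+ 2 / (2 * (a * h))).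
pose b (j : 'I_n) := xi ord0 j / (a * h).
have ah0 : 0 < (a * h)^-1 by rewrite invr_gt0 mulr_gt0.
have I1 := @integral_real_gaussian_rV R n k b (fun=> (a * h)^-1) (fun=> ah0).
have mf : measurable_fun [set: E] (fun x => (expR (\sum_j (k j + b j * x ord0 j -
    (a * h)^-1 / 2 * x ord0 j ^+ 2)))%:E).
  apply/measurable_EFinP; apply: measurableT_comp => //.
  apply: measurable_sum => j; apply: measurable_funB; last first.
    by apply: measurable_funM => //; apply: measurable_funX; exact: measurable_coor.
  by apply: measurable_funD => //; apply: measurable_funM => //; exact: measurable_coor.
have c0 : 0 <= K * \prod_(j < n) (Num.sqrt a)^-1.
  by rewrite mulr_ge0 ?(ltW (hconst_gt0 h0))// prodr_ge0// => j _; rewrite invr_ge0 sqrtr_ge0.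
rewrite ge0_integralZl_EFin//.
apply: (@le_trans _ _ ((K * \prod_(j < n) (Num.sqrt a)^-1)%:E *
  (\prod_(j < n) (Num.sqrt (2 * pi / (a * h)^-1) *
     expR (k j + b j ^+ 2 / (2 * (a * h)^-1))))%:E)%E); first by rewrite I1.
rewrite -EFinM lee_fin hconstE// -!big_split/= big1// => j _.
have -> : k j + b j ^+ 2 / (2 * (a * h)^-1) = 0.
  by rewrite /k /b; field; rewrite !gt_eqF.
have -> : 2 * pi / (a * h)^-1 = (2 * pi * h) * a by rewrite invrK; ring.
have t0 := twopih_gt0 h0.
rewrite expR0 mulr1 (sqrtrM _ (ltW t0)) mulrACA !mulVf ?mul1r// gt_eqF//.
all: by rewrite sqrtr_gt0.
Qed.

Lemma cmod_inner_chirp_window a : 0 < a ->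
  cmod (inner (gaussian h q) (chirp_window a)) =
  \prod_(j < n) (Num.sqrt (Num.sqrt ((a + q j.+1) ^+ 2 + 1)))^-1.
Proof.
move=> a0; pose al (j : 'I_n) : C := (a + q j.+1) +i* 1.
have al0 (j : 'I_n) : 0 < complex.Re (al j) by rewrite /= addr_gt0.
have -> : inner (gaussian h q) (chirp_window a) =
    K%:C * Cint leb (fun y : E => cexp (cquadn (fun=> 0) (fun=> 0) (fun j => al j / h%:C) y)).
  rewrite -CintZl; last by apply: Cintegrable_cquadn => j; exact: Re_divh_gt0.
  apply: eq_Cint => y; rewrite gaussian_cquadn// -[X in _ * X]/(conjc (chirp_window a y)).
  rewrite conj_chirp_window -mulrA -cexpD; congr (_ * cexp _).
  rewrite /cquadn -big_split/=; apply: eq_bigr => j _; rewrite /cquad.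
  have -> : al j = a%:C + (q j.+1)%:C + I.
    by apply/eqP; rewrite eq_complex/=; apply/andP; split; apply/eqP; ring.
  by field; exact: hC_neq0.
rewrite Cint_cquadn0; last by move=> j; exact: Re_divh_gt0.
rewrite cmodM cmodR_ge0 ?(ltW (hconst_gt0 h0))//.
apply: (etrans (cmod_prod_gaussJ h0 al0)); apply: eq_bigr => j _.
by rewrite cmodE/= expr1n.
Qed.

Lemma normM1inf_inf_le :
  (ereal_inf [set ((cmod (inner (gaussian h q) gamma))^-1%:E *
                   normM1inf h gamma (distr (Fplus h)))%E
             | gamma in [set gamma : E -> C | schwartz gamma /\
                 (inner (gaussian h q) gamma != 0)%R]] <=
   (\prod_(j < n) Num.sqrt (Num.sqrt (q j.+1 ^+ 2 + 1)))%:E)%E.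
Proof.
pose F (j : 'I_n) (a : R) := Num.sqrt (Num.sqrt ((a + q j.+1) ^+ 2 + 1)).
have F0 j a : 0 < F j a by rewrite !sqrtr_gt0 ltr_wpDl// sqr_ge0.
apply: (@le_of_cvg_right _ (fun a => \prod_j F j a)) => [a a0|]; last first.
  apply: cvg_prod_ord => j; apply: cvg_at_right_filter.
  rewrite -[q j.+1 in X in _ --> X]add0r.
  do 2 apply: cvg_sqrt; apply: cvgD; last exact: cvg_cst.
  have c1 : a + q j.+1 @[a --> (0 : R)] --> 0 + q j.+1.
    by apply: cvgD; [exact: cvg_id|exact: cvg_cst].
  exact: cvgM.
have ig : cmod (inner (gaussian h q) (chirp_window a)) = (\prod_j F j a)^-1.
  by rewrite cmod_inner_chirp_window// -prodfV.
have P0 : 0 < \prod_j F j a by rewrite prodr_gt0.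
apply: (@le_trans _ _ ((cmod (inner (gaussian h q) (chirp_window a)))^-1%:E *
    normM1inf h (chirp_window a) (distr (Fplus h)))%E).
  apply: ereal_inf_lbound; exists (chirp_window a) => //; split.
    exact: schwartz_chirp_window.
  by apply/eqP => /(congr1 cmod); rewrite cmod0 ig => /eqP; rewrite gt_eqF// invr_gt0.
rewrite ig invrK -[leRHS]mule1; apply: lee_wpmul2l; first by rewrite lee_fin ltW.
exact: normM1inf_chirp_window_le.
Qed.

End upper_bound_window.

(** * The operator norm *)

Section upper_bound_functional.
Context {R : realType} {n : nat} (h : R) (h0 : 0 < h) (q : nat -> R)
  (q0 : forall j, 0 < q j).
Local Notation C := R[i].
Local Notation E := 'rV[R]_n.
Local Notation leb := (lebesgue_rV R n).
Local Notation I := (0 +i* 1 : C).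
Local Notation K := (@hconst R n h).
Local Notation qi := (@qi R n q).

(** The square of [hconst] collects the normalisation of the time-frequency shift and that of the
    window. *)
Lemma conj_tfshift_gaussian (x xi y : E) : conjc (tfshift h x xi (gaussian h q) y) =
  (K ^+ 2)%:C * cexp (cquadn
    (fun j => - ((q j.+1)%:C * (x ord0 j)%:C ^+ 2 / (2 * h%:C)))
    (fun j => ((q j.+1)%:C * (x ord0 j)%:C - I * (xi ord0 j)%:C) / h%:C)
    (fun j => (q j.+1)%:C / h%:C) y).
Proof.
rewrite conj_tfshift conj_gaussian gaussianE//.
have aux (a b c d : C) : a * b * (c * d) = (a * c) * (b * d) by ring.
rewrite aux -cexpD -rmorphM/= -expr2; congr (_ * cexp _).
rewrite -big_split/=; apply: eq_bigr => j _; rewrite /cquad !mxE rmorphB/=.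
by field; exact: hC_neq0.
Qed.

Lemma schwartz_conj_tfshift (x xi : E) :
  schwartz (fun y => conjc (tfshift h x xi (gaussian h q) y)).
Proof.
rewrite (funext (conj_tfshift_gaussian x xi)).
apply: schwartz_gaussian; first exact: cpoly_cst.
by move=> j; apply: (Re_divh_gt0 h0) => /=; exact: q0.
Qed.

Section regularized.
Variables (d : R) (d0 : 0 < d) (dq : forall j : 'I_n, d <= q j.+1).

(* om is chosen so that integrating the Gabor transform at (- xi, xi) against
   exp (- om xi^2 / 2h) gives the integral of f against exp ((i - d) y^2 / 2h). *)
Let zd (j : 'I_n) : C := (q j.+1 - d) +i* 1.
Let om (j : 'I_n) : C := I + d%:C + (d ^+ 2)%:C / zd j.

Let zd_neq0 j : zd j != 0.
Proof. by rewrite eq_complex/= oner_eq0 andbF. Qed.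

(** The condition d <= q_j enters here: it makes Re (1 / zd) nonnegative, so that Re om >= d > 0. *)
Let Re_om j : 0 < complex.Re (om j).
Proof.
rewrite /om [_%:C / _]mulrC !ReD ReMr Re_inv/= add0r ltr_wpDr// mulr_ge0 ?sqr_ge0//.
by rewrite divr_ge0 ?sqr_ge0// subr_ge0.
Qed.

(** With z = zd + d the sum is zd + 2 d + d^2 / zd, a perfect square over zd. The factor z^2 will
    cancel against the square of the linear coefficient. *)
Let omE (j : 'I_n) : (q j.+1)%:C + om j = qi j ^+ 2 / zd j.
Proof.
have -> : (q j.+1)%:C + om j = qi j + d%:C + (d ^+ 2)%:C / zd j.
  rewrite /om !addrA; congr (_ + _ + _).
  by apply/eqP; rewrite eq_complex/=; apply/andP; split; apply/eqP; ring.
have -> : qi j = zd j + d%:C.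
  by apply/eqP; rewrite eq_complex/=; apply/andP; split; apply/eqP; ring.
by rewrite rmorphXn/=; field; exact: zd_neq0.
Qed.

Let cmod_al j : cmod (qi j ^+ 2 / zd j) =
  (q j.+1 ^+ 2 + 1) / Num.sqrt ((q j.+1 - d) ^+ 2 + 1).
Proof. by rewrite cmodM cmodV cmodX cmod_qi sqr_sqrtr ?addr_ge0 ?sqr_ge0// cmodE/= expr1n. Qed.

Let Re_al j : 0 < complex.Re (qi j ^+ 2 / zd j).
Proof. by rewrite -omE ReD; exact: (addr_gt0 (q0 j.+1) (Re_om j)). Qed.

(** Completing the square in xi contributes zd y^2 / 2h, and zd - q = i - d. *)
Let Cint_window_fiber (y : E) : Cint leb (fun xi => cexp (cquadn
    (fun j => - ((q j.+1)%:C * (y ord0 j)%:C ^+ 2 / (2 * h%:C)))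
    (fun j => - (qi j * (y ord0 j)%:C / h%:C))
    (fun j => (qi j ^+ 2 / zd j) / h%:C) xi)) =
  (\prod_j gaussJ ((qi j ^+ 2 / zd j) / h%:C)) *
  (chirp h y * cexp (cquadn (fun=> 0) (fun=> 0) (fun=> d%:C / h%:C) y)).
Proof.
have al0 (j : 'I_n) : 0 < complex.Re ((qi j ^+ 2 / zd j) / h%:C) by exact: (Re_divh_gt0 h0).
apply: (etrans (Cint_cquadn _ _ al0)); apply: (etrans (prod_mul_cexp _ _)).
rewrite chirpE// -cexpD /cquadn -big_split/=; congr (_ * cexp _); apply: eq_bigr => j _.
have eI : I = zd j + d%:C - (q j.+1)%:C.
  by apply/eqP; rewrite eq_complex/=; apply/andP; split; apply/eqP; ring.
by rewrite eI /cquad; field; rewrite hC_neq0// zd_neq0 qi_neq0.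
Qed.

Let prefactor_gt0 :
  0 < \prod_(j < n) Num.sqrt ((q j.+1 ^+ 2 + 1) / Num.sqrt ((q j.+1 - d) ^+ 2 + 1)).
Proof.
rewrite prodr_gt0// => j _.
by rewrite sqrtr_gt0 divr_gt0 ?sqrtr_gt0// ltr_wpDl ?sqr_ge0.
Qed.

Let cmod_prefactor :
  cmod (K%:C * (K%:C * \prod_j gaussJ ((qi j ^+ 2 / zd j) / h%:C))) =
  K * (\prod_(j < n) Num.sqrt ((q j.+1 ^+ 2 + 1) / Num.sqrt ((q j.+1 - d) ^+ 2 + 1)))^-1.
Proof.
rewrite cmodM (cmodM K%:C) cmodR_ge0 ?(ltW (hconst_gt0 h0))// (cmod_prod_gaussJ h0 Re_al).
by rewrite -prodfV; congr (_ * _); apply: eq_bigr => j _; rewrite cmod_al.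
Qed.

(** The supremum over x inside the norm dominates the value at x = - xi, so the norm bounds the
    integral of |V (- xi, xi)|. The regularization d > 0 provides the absolute convergence for
    Fubini. *)
Lemma cmod_osc_gaussian_le (f : E -> C) (u : (E -> C) -> C) :
  bounded_continuous f -> (forall phi, schwartz phi -> u phi = distr f phi) ->
  ((K * cmod (Cint leb (fun y => chirp h y * f y *
      cexp (cquadn (fun=> 0) (fun=> 0) (fun=> d%:C / h%:C) y))))%:E <=
   (\prod_(j < n) Num.sqrt ((q j.+1 ^+ 2 + 1) / Num.sqrt ((q j.+1 - d) ^+ 2 + 1)))%:E *
   normMinf1 h (gaussian h q) u)%E.
Proof.
move=> [[B fB] f1 f2] uf; have mf := Cmeasurable_continuous f1 f2.
pose w (x : E) : C := cexp (cquadn (fun=> 0) (fun=> 0) (fun j => om j / h%:C) x).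
have iw : Cintegrable leb w by apply: Cintegrable_cquadn => j; exact: Re_divh_gt0.
have mw := Cmeasurable_integrable iw.
have w1 x : cmod (w x) <= 1.
  rewrite cmod_cexp Re_cquadn -expR0 ler_expR sumr_le0// => j _.
  rewrite mul0r !add0r oppr_le0 mulr_ge0 ?sqr_ge0// divr_ge0// ltW//.
  exact: Re_divh_gt0.
pose V xi := gabor h (gaussian h q) u (- xi) xi.
pose k (xi : E) (j : 'I_n) : C := - ((q j.+1)%:C * (xi ord0 j)%:C ^+ 2 / (2 * h%:C)).
pose b (xi : E) (j : 'I_n) : C := - (qi j * (xi ord0 j)%:C / h%:C).
pose T (p : E * E) : C :=
  cexp (cquadn (k p.1) (b p.1) (fun j => (q j.+1)%:C / h%:C) p.2).
have TE xi y : conjc (tfshift h (- xi) xi (gaussian h q) y) = (K ^+ 2)%:C * T (xi, y).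
  rewrite conj_tfshift_gaussian; congr (_ * cexp _); apply: eq_bigr => j _.
  rewrite mxE rmorphN/= sqrrN; congr (cquad _ _ _ _); rewrite /b.
  have -> : qi j = (q j.+1)%:C + I.
    by apply/eqP; rewrite eq_complex/=; apply/andP; split; apply/eqP; ring.
  by field; exact: hC_neq0.
have mT : Cmeasurable T.
  have mc (p : E * E -> E) : measurable_fun setT p ->
      forall j, Cmeasurable (fun x => (p x ord0 j)%:C : C).
    by move=> mp j; apply: CmeasurableR; exact: (measurableT_comp (measurable_coor j) mp).
  have m1 := mc _ measurable_fst; have m2 := mc _ measurable_snd.
  apply: Cmeasurable_cexp; apply: Cmeasurable_sum => j.
  rewrite /cquad /k /b /=.
  rewrite (_ : (fun x => _) = fun p : E * E =>
      - ((q j.+1)%:C / (2 * h%:C)) * ((p.1 ord0 j)%:C * (p.1 ord0 j)%:C) +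
      - (qi j / h%:C) * ((p.1 ord0 j)%:C * (p.2 ord0 j)%:C) +
      - ((q j.+1)%:C / h%:C / 2) * ((p.2 ord0 j)%:C * (p.2 ord0 j)%:C)); last first.
    by apply/funext => p; field; exact: hC_neq0.
  by do 2 (apply: CmeasurableD; last by
    apply: CmeasurableM; [exact: Cmeasurable_cst|exact: CmeasurableM]);
    apply: CmeasurableM; [exact: Cmeasurable_cst|exact: CmeasurableM].
pose F (p : E * E) : C := (K ^+ 2)%:C * f p.2 * T p * w p.1.
have mF : Cmeasurable F.
  apply: CmeasurableM; last exact: (Cmeasurable_comp mw measurable_fst).
  apply: CmeasurableM => //; apply: CmeasurableM; first exact: Cmeasurable_cst.
  exact: (Cmeasurable_comp mf measurable_snd).
have mf' : Cmeasurable (fun y : E => (K ^+ 2)%:C * f y).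
  by apply: CmeasurableM => //; exact: Cmeasurable_cst.
have FE xi y : F (xi, y) = w xi * (f y * conjc (tfshift h (- xi) xi (gaussian h q) y)).
  by rewrite TE /F/=; ring.
have VE xi : V xi * w xi = Cint leb (fun y => F (xi, y)).
  rewrite /V /gabor uf; last exact: schwartz_conj_tfshift.
  rewrite (eq_Cint _ (FE xi)); apply: (etrans (mulrC _ _)); apply/esym/CintZl.
  have sg := schwartz_conj_tfshift (- xi) xi.
  have ig := integrable_cmod (schwartz_integrable sg).
  apply: (Cintegrable_le _ (integrableZl measurableT B ig)).
    by apply: CmeasurableM => //; exact: schwartz_Cmeasurable.
  by move=> y; rewrite cmodM; exact: (ler_wpM2r (cmod_ge0 _) (fB y)).
have cT (xi y : E) : cmod (T (xi, y)) = expR (\sum_(j < n)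
    (- (q j.+1 * xi ord0 j ^+ 2 / (2 * h)) + - (q j.+1 * xi ord0 j / h) * y ord0 j -
     q j.+1 / h / 2 * y ord0 j ^+ 2)).
  rewrite /T cmod_cexp Re_cquadn; congr expR; apply: eq_bigr => j _.
  have e1 : k xi j = (- (q j.+1 * xi ord0 j ^+ 2 / (2 * h)))%:C.
    rewrite /k rmorphN/= rmorphM/= fmorphV !rmorphM/=.
    by rewrite (rmorph_nat (real_complex R) 2) -expr2.
  have e2 : b xi j = qi j * (- (xi ord0 j / h))%:C.
    by rewrite rmorphN/= rmorphM/= fmorphV mulrN mulrA.
  rewrite -[(xi, y).1]/xi -[(xi, y).2]/y e1 e2 ReMr Re_divh.
  by rewrite /=; ring.
pose D := \prod_(j < n) Num.sqrt (2 * pi / (q j.+1 / h)).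
have IT xi : (\int[leb]_y (cmod (T (xi, y)))%:E = D%:E)%E.
  under eq_integral do rewrite cT.
  have qh0 (j : 'I_n) : 0 < q j.+1 / h by rewrite divr_gt0.
  rewrite (@integral_real_gaussian_rV R n (fun j => - (q j.+1 * xi ord0 j ^+ 2 / (2 * h)))
    (fun j => - (q j.+1 * xi ord0 j / h)) (fun j => q j.+1 / h) qh0).
  congr EFin; apply: eq_bigr => j _.
  (* Up to a constant, the modulus of the kernel at (- xi, xi) is the window translated by - xi, so
     its integral in y does not depend on xi. *)
  rewrite [X in expR X](_ : _ = 0) ?expR0 ?mulr1//.
  by field; rewrite !gt_eqF.
have TwE y : (fun xi => F (xi, y)) = fun xi => ((K ^+ 2)%:C * f y) *
    cexp (cquadn (fun j => - ((q j.+1)%:C * (y ord0 j)%:C ^+ 2 / (2 * h%:C)))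
      (fun j => - (qi j * (y ord0 j)%:C / h%:C)) (fun j => (qi j ^+ 2 / zd j) / h%:C) xi).
  apply/funext => xi; rewrite /F -mulrA; congr (_ * _).
  rewrite /T /w -cexpD; congr cexp; rewrite /cquadn -big_split/=; apply: eq_bigr => j _.
  by rewrite -omE /cquad /k /b /=; field; exact: hC_neq0.
have B0 : 0 <= B by apply: le_trans (fB 0); exact: cmod_ge0.
have [] := @Cfubini_le _ _ _ _ _ leb leb F (fun xi => (B * K ^+ 2 * D) * cmod (w xi)) mF _ _ _.
- exact: (integrableZl measurableT _ (integrable_cmod iw)).
- move=> xi; rewrite (@le_trans _ _ (\int[leb]_y
      ((B * K ^+ 2 * cmod (w xi))%:E * (cmod (T (xi, y)))%:E))%E)//; last first.
    have c0 : 0 <= B * K ^+ 2 * cmod (w xi).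
      exact: (mulr_ge0 (mulr_ge0 B0 (sqr_ge0 K)) (cmod_ge0 (w xi))).
    have mTx : measurable_fun [set: E] (fun y => (cmod (T (xi, y)))%:E).
      apply/measurable_EFinP; apply: measurable_cmod.
      exact: (Cmeasurable_comp mT (pair1_measurable xi)).
    rewrite ge0_integralZl_EFin//; last by move=> y _; rewrite lee_fin cmod_ge0.
    by rewrite IT -EFinM lee_fin mulrAC.
  apply: ge0_le_lower_integral => y; first by rewrite lee_fin cmod_ge0.
  rewrite -EFinM lee_fin /F cmodM3 cmodM cmodR_ge0 ?sqr_ge0//.
  have := ler_wpM2r (mulr_ge0 (mulr_ge0 (sqr_ge0 K) (cmod_ge0 (T (xi, y)))) (cmod_ge0 (w xi))) (fB y).
  by congr (_ <= _); rewrite /=; ring.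
- move=> y; rewrite TwE; apply: CintegrableZl.
  by apply: Cintegrable_cquadn => j; exact: (Re_divh_gt0 h0).
move=> iCF CFE.
pose psi (y : E) : C := chirp h y * f y *
  cexp (cquadn (fun=> 0) (fun=> 0) (fun=> d%:C / h%:C) y).
have [J JE] : exists J, J = \prod_j gaussJ ((qi j ^+ 2 / zd j) / h%:C) by eexists.
have CxF y : Cint leb (fun xi => F (xi, y)) = (K%:C * (K%:C * J)) * psi y.
  rewrite TwE; apply: (etrans (CintZl _ _)).
    by apply: Cintegrable_cquadn => j; exact: (Re_divh_gt0 h0).
  rewrite Cint_window_fiber -JE /psi.
  have aux (a c s t g : C) : a ^+ 2 * c * (g * (s * t)) = a * (a * g) * (s * c * t) by ring.
  by rewrite rmorphXn/=; exact: aux.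
have ipsi : Cintegrable leb psi.
  have ic : Cintegrable leb (fun y : E => cexp (cquadn (fun=> 0) (fun=> 0) (fun=> d%:C / h%:C) y)).
    by apply: Cintegrable_cquadn => j; exact: (Re_divh_gt0 h0).
  apply: (Cintegrable_le _ (integrableZl measurableT B (integrable_cmod ic))).
    exact: (CmeasurableM (CmeasurableM (Cmeasurable_chirp h0) mf) (Cmeasurable_integrable ic)).
  move=> y; rewrite cmodM3 cmod_chirp mul1r; exact: (ler_wpM2r (cmod_ge0 _) (fB y)).
have iV : Cintegrable leb (fun xi => V xi * w xi).
  by under eq_fun do rewrite VE; exact: iCF.
have VwE : Cint leb (fun xi => V xi * w xi) = (K%:C * (K%:C * J)) * Cint leb psi.
  by rewrite (eq_Cint _ VE) CFE (eq_Cint _ CxF); exact: CintZl.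
have KX : K * cmod (Cint leb psi) =
    (\prod_(j < n) Num.sqrt ((q j.+1 ^+ 2 + 1) / Num.sqrt ((q j.+1 - d) ^+ 2 + 1))) *
    cmod (Cint leb (fun xi => V xi * w xi)).
  have aux (P s X : R) : 0 < P -> s * X = P * (s * P^-1 * X).
    by move=> P0; field; rewrite gt_eqF.
  rewrite VwE JE; apply: (etrans (aux _ _ _ prefactor_gt0)); congr (_ * _).
  by rewrite -cmod_prefactor; exact/esym/cmodM.
rewrite KX EFinM; apply: lee_wpmul2l.
  by rewrite lee_fin prodr_ge0// => j _; exact: sqrtr_ge0.
apply: (le_trans (cmod_Cint_le iV)); apply: ge0_le_lower_integral => xi.
  by rewrite lee_fin cmod_ge0.
apply: (@le_trans _ _ (cmod (V xi))%:E).
  by rewrite lee_fin cmodM; exact: (ler_piMr (cmod_ge0 (V xi)) (w1 xi)).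
by apply: ereal_sup_ubound; exists (- xi).
Qed.

End regularized.
End upper_bound_functional.

(** * The upper bound for the operator norm *)

Section operator_norm_upper_bound.
Context {R : realType} {n : nat} (h : R) (h0 : 0 < h) (q : nat -> R)
  (q0 : forall j, 0 < q j).
Local Notation C := R[i].
Local Notation E := 'rV[R]_n.
Local Notation leb := (lebesgue_rV R n).
Local Notation K := (@hconst R n h).
Local Notation A := (\prod_(j < n) Num.sqrt (Num.sqrt (q j.+1 ^+ 2 + 1))).

Definition std_gaussian (x : E) : C :=
  cexp (cquadn (fun=> 0) (fun=> 0) (fun=> 1 / h%:C) x).

Lemma schwartz_std_gaussian : schwartz std_gaussian.
Proof.
rewrite (_ : std_gaussian = fun x => 1 * std_gaussian x).
  apply: schwartz_gaussian; first exact: cpoly_cst.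
  by move=> j; apply: (Re_divh_gt0 h0); exact: ltr01.
by apply/funext => x; rewrite mul1r.
Qed.

Lemma std_gaussian0 : std_gaussian 0 = 1.
Proof.
rewrite /std_gaussian /cquadn big1 ?cexp0// => j _.
by rewrite /cquad mxE rmorph0 expr2 !mulr0 oppr0 !addr0.
Qed.

Lemma std_gaussianZ (e : R) (x : E) : std_gaussian (e *: x) =
  cexp (cquadn (fun=> 0) (fun=> 0) (fun=> (e ^+ 2)%:C / h%:C) x).
Proof.
congr cexp; apply: eq_bigr => j _; rewrite /cquad mxE rmorphM/= rmorphXn/=.
by field; exact: hC_neq0.
Qed.

Lemma cmod_osc_approx_std (f : E -> C) (e : R) :
  cmod (osc_approx h f std_gaussian e) =
  K * cmod (Cint leb (fun x => chirp h x * f x *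
    cexp (cquadn (fun=> 0) (fun=> 0) (fun=> (e ^+ 2)%:C / h%:C) x))).
Proof.
rewrite /osc_approx cmodM (cmod_fresnel_cst h0); congr (_ * cmod _).
by apply: (@eq_Cint _ _ _ leb) => x; rewrite std_gaussianZ.
Qed.

Lemma normMinf1_ge0 (g : E -> C) u : (0 <= normMinf1 h g u)%E.
Proof.
apply: integral_ge0 => xi _; apply: (@le_trans _ _ (cmod (gabor h g u 0 xi))%:E).
  by rewrite lee_fin cmod_ge0.
by apply: ereal_sup_ubound; exists 0.
Qed.

Lemma cvg_cmod (G : set_system R) (FG : Filter G) (f : R -> C) (l : C) :
  complex.Re (f x) @[x --> G] --> complex.Re l ->
  complex.Im (f x) @[x --> G] --> complex.Im l ->
  cmod (f x) @[x --> G] --> cmod l.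
Proof.
move=> f1 f2; rewrite [cmod l]cmodE.
under eq_fun do rewrite cmodE.
by apply: cvg_sqrt; apply: cvgD; [exact: (cvgM f1 f1)|exact: (cvgM f2 f2)].
Qed.

Lemma amplitude_gt0 : 0 < A.
Proof.
by rewrite prodr_gt0// => j _; rewrite !sqrtr_gt0 ltr_wpDl// sqr_ge0.
Qed.

Lemma cmod_osc_limit_le (f : E -> C) u (l : C) :
  bounded_continuous f -> (forall phi, schwartz phi -> u phi = distr f phi) ->
  complex.Re (osc_approx h f std_gaussian e) @[e --> 0^'+] --> complex.Re l ->
  complex.Im (osc_approx h f std_gaussian e) @[e --> 0^'+] --> complex.Im l ->
  ((cmod l)%:E <= A%:E * normMinf1 h (gaussian h q) u)%E.
Proof.
move=> bf uf l1 l2; have N0 := normMinf1_ge0 (gaussian h q) u.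
pose G (e : R) := \prod_(j < n)
  Num.sqrt ((q j.+1 ^+ 2 + 1) / Num.sqrt ((q j.+1 - e ^+ 2) ^+ 2 + 1)).
have GA : G e @[e --> 0^'+] --> A.
  apply: cvg_prod_ord => j; apply: cvg_sqrt.
  have s0 : 0 < q j.+1 ^+ 2 + 1 by rewrite ltr_wpDl// sqr_ge0.
  have -> : Num.sqrt (q j.+1 ^+ 2 + 1) = (q j.+1 ^+ 2 + 1) / Num.sqrt (q j.+1 ^+ 2 + 1).
    by rewrite -[X in X / _](sqr_sqrtr (ltW s0)) expr2 mulfK// gt_eqF// sqrtr_gt0.
  apply: cvgM; first exact: cvg_cst.
  apply: cvgV; first by rewrite gt_eqF// sqrtr_gt0.
  have c1 : q j.+1 - e ^+ 2 @[e --> 0^'+] --> q j.+1.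
    rewrite -[X in _ --> X]subr0; apply: cvgB; first exact: cvg_cst.
    have c0 : e * e @[e --> (0 : R)^'+] --> (0 : R) * 0.
      by apply: cvg_at_right_filter; apply: cvgM; exact: cvg_id.
    by rewrite mulr0 in c0; under eq_fun do rewrite expr2.
  by apply: cvg_sqrt; apply: cvgD; [exact: (cvgM c1 c1)|exact: cvg_cst].
have bound : \forall e \near 0^'+, ((cmod (osc_approx h f std_gaussian e))%:E <=
    (G e)%:E * normMinf1 h (gaussian h q) u)%E.
  (* The default 1 forces e <= 1, hence e^2 <= e <= q_j for every j. *)
  pose m := \big[Num.min/1]_(j < n) q j.+1.
  have m0 : 0 < m by rewrite lt_bigmin.
  near=> e.
  have e0 : 0 < e by near: e; exact: nbhs_right_gt.
  have em : e <= m by near: e; exact: nbhs_right_le.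
  have e2m : e ^+ 2 <= m.
    by rewrite expr2 (le_trans _ em)// ler_piMl ?(ltW e0)// (le_trans em)// bigmin_le_id.
  have dq (j : 'I_n) : e ^+ 2 <= q j.+1 by rewrite (le_trans e2m)// bigmin_le.
  by rewrite cmod_osc_approx_std; exact: (cmod_osc_gaussian_le h0 q0 (exprn_gt0 2 e0) dq bf uf).
have lc : cmod (osc_approx h f std_gaussian e) @[e --> 0^'+] --> cmod l.
  exact: cvg_cmod.
case: (normMinf1 h (gaussian h q) u) N0 bound => [r r0 bound|_ _|//].
  rewrite -EFinM lee_fin.
  have GAr : G e * r @[e --> 0^'+] --> A * r by apply: cvgM => //; exact: cvg_cst.
  apply: (ler_cvg_to lc GAr).
  by apply: filterS bound => e; rewrite -EFinM lee_fin.
by rewrite gt0_muley ?lte_fin ?amplitude_gt0// leey.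
Unshelve. all: by end_near. Qed.

(** Arbitrary u are covered by the default values: without a common limit [osc_integral] is 0, and
    without a representing function [function_of u] is the zero function, all of whose regularized
    integrals vanish. *)
Lemma cmod_fresnel_functional_le (u : (E -> C) -> C) :
  ((cmod (fresnel_functional h u))%:E <= A%:E * normMinf1 h (gaussian h q) u)%E.
Proof.
have R0 : (0 <= A%:E * normMinf1 h (gaussian h q : E -> C) u)%E.
  by rewrite mule_ge0 ?normMinf1_ge0// lee_fin ltW// amplitude_gt0.
rewrite /fresnel_functional /osc_integral; case: xgetP => [l _ lP|_]; last by rewrite cmod0.
have [] := lP _ schwartz_std_gaussian std_gaussian0.
rewrite /function_of; case: xgetP => [f _ [bf uf]|_ l1 l2].
  exact: cmod_osc_limit_le.
have z e : osc_approx h (fun=> 0) std_gaussian e = 0.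
  rewrite /osc_approx (_ : Cintegral _ = 0) ?mulr0//.
  rewrite -[LHS]/(Cint leb (fun x => chirp h x * 0 * std_gaussian (e *: x))).
  under eq_Cint do rewrite mulr0 mul0r.
  by rewrite /Cint /Rintegral /= integral0.
have -> : l = 0; last by rewrite cmod0.
move: l1 l2; under eq_fun do rewrite z; move=> l1.
under eq_fun do rewrite z; move=> l2.
apply/eqP; rewrite eq_complex/=; apply/andP; split; apply/eqP.
  by apply: (cvg_unique _ l1 (cvg_cst _)).
by apply: (cvg_unique _ l2 (cvg_cst _)).
Qed.

Lemma opnorm_fresnel_le : (opnorm_fresnel h (gaussian h q : E -> C) <= A%:E)%E.
Proof.
apply: ge_ereal_sup => _ [u _ <-].
have N0 := normMinf1_ge0 (gaussian h q : E -> C) u; have := cmod_fresnel_functional_le u.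
have A0 := ltW amplitude_gt0; have L0 := cmod_ge0 (fresnel_functional h u).
case: (normMinf1 h (gaussian h q) u) N0 => [r||//].
  (* The inverse of 0 is +oo in the extended reals; at norm 0 the numerator vanishes too, and 0
     times +oo is 0. *)
  rewrite -EFinM !lee_fin => r0; case: (eqVneq r 0) => [->|rn0] h1.
    have -> : cmod (fresnel_functional h u) = 0.
      by apply/eqP; rewrite eq_le L0 andbT -(mulr0 A).
    by rewrite mul0e lee_fin.
  by rewrite inver (negPf rn0) -EFinM lee_fin ler_pdivrMr// lt_neqAle eq_sym rn0.
by move=> _ _; rewrite invey mule0 lee_fin.
Qed.

End operator_norm_upper_bound.

(** * Schwartz functions as distributions *)

Section schwartz_distributions.
Context {R : realType} {n : nat}.
Local Notation C := R[i].
Local Notation E := 'rV[R]_n.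
Local Notation leb := (lebesgue_rV R n).
Implicit Types f phi : E -> C.

Lemma Cintegrable_schwartzM f phi : schwartz f -> schwartz phi ->
  Cintegrable leb (fun x => f x * phi x).
Proof.
move=> sf sp; have [c fc] := schwartz_bounded sp.
have i_f := schwartz_integrable sf.
apply: (Cintegrable_le _ (integrableZl measurableT c (integrable_cmod i_f))).
  exact: (CmeasurableM (schwartz_Cmeasurable sf) (schwartz_Cmeasurable sp)).
by move=> x; rewrite cmodM mulrC; exact: (ler_wpM2r (cmod_ge0 _) (fc x)).
Qed.

Lemma tempered_distr_schwartz f : schwartz f -> tempered (distr f).
Proof.
move=> sf; have i_f := schwartz_integrable sf; split.
  move=> a phi psi sp sq.
  have i1 := Cintegrable_schwartzM sf sp; have i2 := Cintegrable_schwartzM sf sq.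
  rewrite -[LHS]/(Cint leb (fun y => f y * (a * phi y + psi y))).
  rewrite -[RHS]/(a * Cint leb (fun y => f y * phi y) + Cint leb (fun y => f y * psi y)).
  rewrite -(CintZl a i1) -(CintD (CintegrableZl a i1) i2).
  by apply: eq_Cint => y; ring.
move=> e e0; pose G := (\int[leb]_y cmod (f y))%R.
have GE : (\int[leb]_y (cmod (f y))%:E = G%:E)%E.
  by rewrite /G /Rintegral fineK//; apply: integrable_fin_num => //; exact: integrable_cmod.
have G0 : 0 <= G by rewrite -lee_fin -GE; apply: integral_ge0 => y _; rewrite lee_fin cmod_ge0.
have G1 : 0 < G + 1 by rewrite ltr_wpDl.
(* Order 0 suffices: the pairing is at most the L^1 norm G of f times sup |phi|. Dividing by G + 1
   covers G = 0. *)
exists 0%N; exists (e / (G + 1)); first by rewrite divr_gt0.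
move=> phi sp /(_ [::] [::])bp.
have {}bp y : cmod (phi y) <= e / (G + 1).
  by have := bp y isT isT; rewrite big_nil mul1r.
rewrite -lee_fin -[distr f phi]/(Cint leb (fun y => f y * phi y)).
apply: (le_trans (cmod_Cint_le (Cintegrable_schwartzM sf sp))).
apply: (@le_trans _ _ (\int[leb]_y ((e / (G + 1))%:E * (cmod (f y))%:E))%E).
  apply: ge0_le_lower_integral => y; first by rewrite lee_fin cmod_ge0.
  by rewrite -EFinM lee_fin cmodM mulrC; exact: (ler_wpM2r (cmod_ge0 _) (bp y)).
rewrite integralZl ?GE//; last exact: integrable_cmod.
by rewrite -EFinM lee_fin mulrAC ler_pdivrMr// ler_wpM2l ?(ltW e0)// lerDl.
Qed.

Lemma bounded_continuous_schwartz f : schwartz f -> bounded_continuous f.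
Proof.
move=> sf; have [f1 f2] := schwartz_continuous sf.
by split => //; exact: schwartz_bounded.
Qed.

Lemma function_of_distr f : schwartz f -> function_of (distr f) = f.
Proof.
move=> sf; have bf := bounded_continuous_schwartz sf.
apply: xget_unique; first by split.
by move=> g [bg fg]; apply: bounded_continuous_eq => // phi sp; rewrite fg.
Qed.

End schwartz_distributions.

(** * Oscillatory integrals of integrable functions *)

Section oscillatory_limit.
Context {R : realType} {n : nat} (h : R) (h0 : 0 < h).
Local Notation C := R[i].
Local Notation E := 'rV[R]_n.
Local Notation leb := (lebesgue_rV R n).

Lemma Ccvg_mull (T : Type) (G : set_system T) (FG : Filter G) (c : C) (f : T -> C) (l : C) :
  complex.Re (f t) @[t --> G] --> complex.Re l /\
  complex.Im (f t) @[t --> G] --> complex.Im l ->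
  complex.Re (c * f t) @[t --> G] --> complex.Re (c * l) /\
  complex.Im (c * f t) @[t --> G] --> complex.Im (c * l).
Proof.
move=> [f1 f2]; split.
  under eq_fun do rewrite ReM; rewrite ReM.
  by apply: cvgB; apply: cvgM => //; exact: cvg_cst.
under eq_fun do rewrite ImM; rewrite ImM.
by apply: cvgD; apply: cvgM => //; exact: cvg_cst.
Qed.

(** phi (e x) tends boundedly to phi 0 = 1, so dominated convergence gives the same limit for every
    regularizer. No other value qualifies because a regularizer exists, namely [std_gaussian]. *)
Lemma osc_integral_integrable (f : E -> C) : Cintegrable leb f ->
  osc_integral h f = @fresnel_cst R n h * Cint leb (fun x => chirp h x * f x).
Proof.
move=> i_f; set l := _ * _; have mf := Cmeasurable_integrable i_f.
have lP phi : schwartz phi -> phi 0 = 1 ->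
    complex.Re (osc_approx h f phi e) @[e --> 0^'+] --> complex.Re l /\
    complex.Im (osc_approx h f phi e) @[e --> 0^'+] --> complex.Im l.
  move=> sp p0; have [c pc] := schwartz_bounded sp.
  have [p1 p2] := schwartz_continuous sp; have mp := schwartz_Cmeasurable sp.
  suff H (v : R^nat) : (forall k, v k > 0) /\ (v k @[k --> \oo] --> (0 : R)) ->
      complex.Re (osc_approx h f phi (v k)) @[k --> \oo] --> complex.Re l /\
      complex.Im (osc_approx h f phi (v k)) @[k --> \oo] --> complex.Im l.
    by split; apply/cvg_at_rightP => v /H[].
  move=> [v0 vc].
  have vx (x : E) : v k *: x @[k --> \oo] --> (0 : E).
    by rewrite -(scale0r x); apply: cvgZr_tmp.
  have pv (x : E) : complex.Re (phi (v k *: x)) @[k --> \oo] --> complex.Re (1 : C) /\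
      complex.Im (phi (v k *: x)) @[k --> \oo] --> complex.Im (1 : C).
    rewrite -p0; split.
      exact: (cvg_comp (fun k => v k *: x) (fun y => complex.Re (phi y)) (vx x) (p1 0)).
    exact: (cvg_comp (fun k => v k *: x) (fun y => complex.Im (phi y)) (vx x) (p2 0)).
  apply: Ccvg_mull.
  apply: (@Cint_dominated_cvg _ _ _ leb
    (fun k x => chirp h x * f x * phi (v k *: x)) (fun x => chirp h x * f x)
    (fun x => c * cmod (f x))).
  - move=> k; apply: (CmeasurableM (CmeasurableM (Cmeasurable_chirp h0) mf)).
    have -> : (fun x : E => phi (v k *: x)) = fun x => phi (v k *: x + 0).
      by apply/funext => x; rewrite addr0.
    exact: (Cmeasurable_comp mp (measurable_rV_affine (v k) 0)).
  - exact: (CmeasurableM (Cmeasurable_chirp h0) mf).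
  - exact: (integrableZl measurableT c (integrable_cmod i_f)).
  - move=> k x; rewrite cmodM3 cmod_chirp mul1r mulrC.
    exact: (ler_wpM2r (cmod_ge0 _) (pc _)).
  - by move=> x; have [] := Ccvg_mull _ (chirp h x * f x) (pv x); rewrite mulr1.
  - by move=> x; have [] := Ccvg_mull _ (chirp h x * f x) (pv x); rewrite mulr1.
apply: xget_unique; first exact: lP.
move=> l' l'P; have [r1 r2] := lP _ (schwartz_std_gaussian h0) (std_gaussian0 h).
have [s1 s2] := l'P _ (schwartz_std_gaussian h0) (std_gaussian0 h).
apply/eqP; rewrite eq_complex; apply/andP; split; apply/eqP.
  exact: (cvg_unique _ s1 r1).
exact: (cvg_unique _ s2 r2).
Qed.

End oscillatory_limit.

(** * The lower bound for the operator norm *)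

Section lower_bound_functional.
Context {R : realType} {n : nat} (h : R) (h0 : 0 < h) (q : nat -> R)
  (q0 : forall j, 0 < q j).
Local Notation C := R[i].
Local Notation E := 'rV[R]_n.
Local Notation leb := (lebesgue_rV R n).
Local Notation I := (0 +i* 1 : C).
Local Notation K := (@hconst R n h).

(** One coordinate of the exponent in the transform of the extremizer after integration in y, with s
    for q_j and p for a + q_j. *)
Lemma Re_gabor_exponent (p s x xi : R) :
  complex.Re (- (s%:C * x%:C ^+ 2 / (2 * h%:C)) +
    ((s%:C * x%:C - I * xi%:C) / h%:C) ^+ 2 / (2 * ((p +i* 1) / h%:C))) =
  (- (s * x ^+ 2) + (p * ((s * x) ^+ 2 - xi ^+ 2) - 2 * s * x * xi) / (p ^+ 2 + 1)) /
  (2 * h).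
Proof.
have P0 : (p +i* 1 : C) != 0 by rewrite eq_complex/= oner_eq0 andbF.
have p1 : p ^+ 2 + 1 != 0 by rewrite gt_eqF// ltr_wpDl// sqr_ge0.
have -> : - (s%:C * x%:C ^+ 2 / (2 * h%:C)) +
    ((s%:C * x%:C - I * xi%:C) / h%:C) ^+ 2 / (2 * ((p +i* 1) / h%:C)) =
    (- (s * x ^+ 2)%:C + ((s * x) +i* (- xi)) ^+ 2 * (p +i* 1)^-1) * ((2 * h)^-1)%:C.
  have -> : (s * x) +i* (- xi) = s%:C * x%:C - I * xi%:C :> C.
    by apply/eqP; rewrite eq_complex/=; apply/andP; split; apply/eqP; ring.
  rewrite fmorphV !rmorphM/= (rmorph_nat (real_complex R) 2).
  by field; rewrite hC_neq0// P0.
have -> : (p +i* 1 : C)^-1 = (p / (p ^+ 2 + 1)) +i* (- (1 / (p ^+ 2 + 1))).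
  apply: (mulfI P0); rewrite mulfV//; apply/eqP; rewrite eq_complex/=.
  by apply/andP; split; apply/eqP; field.
rewrite ReMr ReD ReN ReM expr2 ReM ImM/=.
by field; rewrite p1 gt_eqF.
Qed.

(** The gap is a positive multiple of ((a (a + s) + 1) x + xi)^2, so this bound is the exact maximum
    over x, reached at x = - xi / (a (a + s) + 1). *)
Lemma Re_gabor_exponent_le (a s x xi : R) : 0 < a -> 0 < s ->
  (- (s * x ^+ 2) + ((a + s) * ((s * x) ^+ 2 - xi ^+ 2) - 2 * s * x * xi) /
    ((a + s) ^+ 2 + 1)) / (2 * h) <=
  0 + 0 * xi - a / ((a * (a + s) + 1) * h) / 2 * xi ^+ 2.
Proof.
move=> a0 s0; have p1 : 0 < (a + s) ^+ 2 + 1 by rewrite ltr_wpDl// sqr_ge0.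
have p2 : 0 < a * (a + s) + 1 by rewrite ltr_wpDl// ltW// mulr_gt0// addr_gt0.
rewrite -subr_ge0.
have -> : 0 + 0 * xi - a / ((a * (a + s) + 1) * h) / 2 * xi ^+ 2 -
    (- (s * x ^+ 2) + ((a + s) * ((s * x) ^+ 2 - xi ^+ 2) - 2 * s * x * xi) /
    ((a + s) ^+ 2 + 1)) / (2 * h) =
    s / (((a + s) ^+ 2 + 1) * (a * (a + s) + 1) * (2 * h)) *
    ((a * (a + s) + 1) * x + xi) ^+ 2.
  by field; rewrite !gt_eqF.
rewrite mulr_ge0 ?sqr_ge0// divr_ge0 ?(ltW s0)// mulr_ge0 ?mulr_ge0 ?(ltW h0)//.
  exact: ltW.
exact: ltW.
Qed.

(* A Schwartz approximation of exp (- i |y|^2 / 2h), on which the phase of the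
   oscillatory integral is cancelled. *)
Definition extremizer (a : R) (y : E) : C :=
  cexp (cquadn (fun=> 0) (fun=> 0) (fun=> (a%:C + I) / h%:C) y).

Lemma schwartz_extremizer a : 0 < a -> schwartz (extremizer a).
Proof.
move=> a0; rewrite (_ : extremizer a = fun x => 1 * extremizer a x).
  apply: schwartz_gaussian; first exact: cpoly_cst.
  by move=> j; apply: (Re_divh_gt0 h0); rewrite /= addr0.
by apply/funext => x; rewrite mul1r.
Qed.

Lemma cmod_gabor_extremizer_le a x xi : 0 < a ->
  cmod (gabor h (gaussian h q) (distr (extremizer a)) x xi) <=
  K * \prod_(j < n) (Num.sqrt (Num.sqrt ((a + q j.+1) ^+ 2 + 1)))^-1 *
  expR (\sum_(j < n) (0 + 0 * xi ord0 j -
    a / ((a * (a + q j.+1) + 1) * h) / 2 * xi ord0 j ^+ 2)).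
Proof.
move=> a0; pose al (j : 'I_n) : C := (a + q j.+1) +i* 1.
have al0 (j : 'I_n) : 0 < complex.Re (al j) by rewrite /= addr_gt0.
pose k (j : 'I_n) : C := - ((q j.+1)%:C * (x ord0 j)%:C ^+ 2 / (2 * h%:C)).
pose b (j : 'I_n) : C := ((q j.+1)%:C * (x ord0 j)%:C - I * (xi ord0 j)%:C) / h%:C.
have alh (j : 'I_n) : 0 < complex.Re (al j / h%:C) by exact: (Re_divh_gt0 h0).
have -> : gabor h (gaussian h q) (distr (extremizer a)) x xi =
    (K ^+ 2)%:C * Cint leb (fun y => cexp (cquadn k b (fun j => al j / h%:C) y)).
  rewrite gaborE -CintZl; last exact: Cintegrable_cquadn.
  apply: eq_Cint => y; rewrite conj_tfshift_gaussian// /extremizer mulrCA -cexpD.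
  congr (_ * cexp _); rewrite /cquadn -big_split/=; apply: eq_bigr => j _.
  have -> : al j = a%:C + (q j.+1)%:C + I.
    by apply/eqP; rewrite eq_complex/=; apply/andP; split; apply/eqP; ring.
  by rewrite /cquad /k /b; field; exact: hC_neq0.
rewrite (Cint_cquadn k b alh) prod_mul_cexp cmodM cmodM cmod_cexp.
rewrite cmodR_ge0 ?sqr_ge0// expr2 mulrA -(mulrA K K) (cmod_prod_gaussJ h0 al0).
have -> : \prod_j (Num.sqrt (cmod (al j)))^-1 =
    \prod_(j < n) (Num.sqrt (Num.sqrt ((a + q j.+1) ^+ 2 + 1)))^-1.
  by apply: eq_bigr => j _; rewrite cmodE/= expr1n.
apply: ler_wpM2l; first by rewrite mulr_ge0 ?(ltW (hconst_gt0 h0))// prodr_ge0.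
rewrite ler_expR Re_sum; apply: ler_sum => j _.
by rewrite Re_gabor_exponent; exact: Re_gabor_exponent_le.
Qed.

Lemma normMinf1_extremizer_le a : 0 < a ->
  (normMinf1 h (gaussian h q) (distr (extremizer a)) <=
   (\prod_(j < n) ((Num.sqrt (Num.sqrt ((a + q j.+1) ^+ 2 + 1)))^-1 *
      Num.sqrt ((a * (a + q j.+1) + 1) / a)))%:E)%E.
Proof.
move=> a0; set c := K * \prod_(j < n) (Num.sqrt (Num.sqrt ((a + q j.+1) ^+ 2 + 1)))^-1.
pose be (j : 'I_n) := a / ((a * (a + q j.+1) + 1) * h).
have p2 (j : 'I_n) : 0 < a * (a + q j.+1) + 1 by rewrite ltr_wpDl// ltW// mulr_gt0// addr_gt0.
have be0 (j : 'I_n) : 0 < be j by rewrite divr_gt0// mulr_gt0.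
have c0 : 0 <= c.
  by rewrite mulr_ge0 ?(ltW (hconst_gt0 h0))// prodr_ge0.
have I1 := @integral_real_gaussian_rV R n (fun=> 0) (fun=> 0) be be0.
have mf : measurable_fun [set: E] (fun x => (expR (\sum_j (0 + 0 * x ord0 j -
    be j / 2 * x ord0 j ^+ 2)))%:E).
  apply/measurable_EFinP; apply: measurableT_comp => //.
  apply: measurable_sum => j; apply: measurable_funB; last first.
    by apply: measurable_funM => //; apply: measurable_funX; exact: measurable_coor.
  by apply: measurable_funD => //; apply: measurable_funM => //; exact: measurable_coor.
apply: (@le_trans _ _ (\int[leb]_xi (c%:E * (expR (\sum_j (0 + 0 * xi ord0 j -
    be j / 2 * xi ord0 j ^+ 2)))%:E))%E).
  apply: ge0_le_lower_integral => xi.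
    apply: (@le_trans _ _ (cmod (gabor h (gaussian h q) (distr (extremizer a)) 0 xi))%:E).
      by rewrite lee_fin cmod_ge0.
    by apply: ereal_sup_ubound; exists 0.
  apply: ge_ereal_sup => _ [x _ <-]; rewrite -EFinM lee_fin.
  exact: cmod_gabor_extremizer_le.
rewrite ge0_integralZl_EFin//.
apply: (@le_trans _ _ (c%:E * (\prod_j (Num.sqrt (2 * pi / be j) *
   expR (0 + 0 ^+ 2 / (2 * be j))))%:E)%E); first by rewrite I1.
rewrite -EFinM lee_fin /c hconstE// -!big_split/= le_eqVlt; apply/orP; left; apply/eqP.
apply: eq_bigr => j _.
have -> : 0 + 0 ^+ 2 / (2 * be j) = 0 by rewrite expr0n/= mul0r addr0.
rewrite expR0 mulr1.
have t0 := twopih_gt0 h0.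
have -> : 2 * pi / be j = (2 * pi * h) * ((a * (a + q j.+1) + 1) / a).
  by rewrite /be; field; rewrite !gt_eqF.
rewrite (sqrtrM _ (ltW t0)) mulrACA mulVf ?mul1r// gt_eqF//.
by rewrite sqrtr_gt0.
Qed.

Lemma Minf1_extremizer a : 0 < a -> Minf1 h (distr (extremizer a)).
Proof.
move=> a0; split; first exact/tempered_distr_schwartz/schwartz_extremizer.
exists (gaussian h q); split; first exact: schwartz_gaussian_window.
  exists 0; rewrite gaussianE// mulf_neq0 ?cexp_neq0//; exact: hconstC_neq0.
by apply: (le_lt_trans (normMinf1_extremizer_le a0)); rewrite ltry.
Qed.

Lemma nonzero_extremizer a : 0 < a -> nonzero_distr (distr (extremizer a)).
Proof.
(* The phases of [extremizer] and [chirp_window] are opposite: their product is a real Gaussian,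
   whose integral is not 0. *)
move=> a0; exists (chirp_window h a); first exact: schwartz_chirp_window.
have a1 (j : 'I_n) : 0 < complex.Re ((a + a)%:C / h%:C).
  by apply: (Re_divh_gt0 h0); exact: addr_gt0.
rewrite -[distr _ _]/(Cint leb (fun y => extremizer a y * chirp_window h a y)).
have -> : (fun y => extremizer a y * chirp_window h a y) = fun y =>
    cexp (cquadn (fun=> 0) (fun=> 0) (fun=> (a + a)%:C / h%:C) y).
  apply/funext => y; rewrite -cexpD; congr cexp; rewrite /cquadn -big_split/=.
  by apply: eq_bigr => j _; rewrite /cquad rmorphD/=; field; exact: hC_neq0.
rewrite (Cint_cquadn0 a1); apply/prodf_neq0 => j _.
by apply/eqP => /(congr1 cmod); rewrite cmod0 => /eqP; rewrite (gt_eqF (cmod_gaussJ_gt0 (a1 j))).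
Qed.

Lemma cmod_fresnel_extremizer a : 0 < a ->
  cmod (fresnel_functional h (distr (extremizer a))) = \prod_(j < n) (Num.sqrt a)^-1.
Proof.
move=> a0; have sf := schwartz_extremizer a0.
have a1 (j : 'I_n) : 0 < complex.Re (a%:C : C) by [].
have a2 (j : 'I_n) : 0 < complex.Re (a%:C / h%:C) by exact: (Re_divh_gt0 h0).
rewrite /fresnel_functional function_of_distr// osc_integral_integrable//; last first.
  exact: schwartz_integrable.
have -> : (fun x => chirp h x * extremizer a x) = fun x : E =>
    cexp (cquadn (fun=> 0) (fun=> 0) (fun=> a%:C / h%:C) x).
  apply/funext => x; rewrite chirp_cquadn// -cexpD; congr cexp; rewrite /cquadn -big_split/=.
  by apply: eq_bigr => j _; rewrite /cquad; field; exact: hC_neq0.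
rewrite (Cint_cquadn0 a2) cmodM (cmod_fresnel_cst h0) (cmod_prod_gaussJ h0 a1).
by apply: eq_bigr => j _; rewrite cmodR_ge0// ltW.
Qed.

(** The functional at the extremizer and the bound N a on its norm both grow like a^(- n / 2) as a
    -> 0+; their quotient G a stays finite and tends to the claimed product. *)
Lemma opnorm_fresnel_ge :
  ((\prod_(j < n) Num.sqrt (Num.sqrt (q j.+1 ^+ 2 + 1)))%:E <=
   opnorm_fresnel h (gaussian h q : E -> C))%E.
Proof.
pose N (a : R) := \prod_(j < n) ((Num.sqrt (Num.sqrt ((a + q j.+1) ^+ 2 + 1)))^-1 *
      Num.sqrt ((a * (a + q j.+1) + 1) / a)).
pose G (a : R) := \prod_(j < n) (Num.sqrt (Num.sqrt ((a + q j.+1) ^+ 2 + 1)) *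
  (Num.sqrt (a * (a + q j.+1) + 1))^-1).
apply: (@ge_of_cvg_right _ G) => [a a0|]; last first.
  apply: cvg_prod_ord => j; apply: cvg_at_right_filter.
  have c1 : a + q j.+1 @[a --> (0 : R)] --> q j.+1.
    by rewrite -[X in _ --> X]add0r; apply: cvgD; [exact: cvg_id|exact: cvg_cst].
  rewrite -[X in _ --> X]mulr1; apply: cvgM.
    do 2 apply: cvg_sqrt.
    by apply: cvgD; [exact: (cvgM c1 c1)|exact: cvg_cst].
  rewrite -[X in _ --> X]invr1; apply: cvgV; first exact: oner_neq0.
  rewrite -[X in _ --> X](@sqrtr1 R); apply: cvg_sqrt.
  rewrite -[X in _ --> X]add0r; apply: cvgD; last exact: cvg_cst.
  by rewrite -[X in _ --> X](mul0r (q j.+1)); apply: cvgM => //; exact: cvg_id.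
apply: (@le_trans _ _ ((cmod (fresnel_functional h (distr (extremizer a))))%:E /
    normMinf1 h (gaussian h q) (distr (extremizer a)))%E); last first.
  apply: ereal_sup_ubound; exists (distr (extremizer a)) => //.
  by split; [exact: Minf1_extremizer|exact: nonzero_extremizer].
have N0 := normMinf1_ge0 h (gaussian h q) (distr (extremizer a)).
have NN := normMinf1_extremizer_le a0.
have L0 : 0 < cmod (fresnel_functional h (distr (extremizer a))).
  by rewrite cmod_fresnel_extremizer// prodr_gt0// => j _; rewrite invr_gt0 sqrtr_gt0.
have GE : G a * N a = cmod (fresnel_functional h (distr (extremizer a))).
  rewrite cmod_fresnel_extremizer// -big_split/=; apply: eq_bigr => j _.
  have p1 : 0 < (a + q j.+1) ^+ 2 + 1 by rewrite ltr_wpDl// sqr_ge0.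
  have p2 : 0 < a * (a + q j.+1) + 1 by rewrite ltr_wpDl// ltW// mulr_gt0// addr_gt0.
  rewrite (sqrtrM _ (ltW p2)) sqrtrV ?(ltW a0)//.
  by field; rewrite !gt_eqF// !sqrtr_gt0.
have G0 : 0 <= G a.
  by rewrite prodr_ge0// => j _; rewrite mulr_ge0 ?invr_ge0 ?sqrtr_ge0.
move: N0 NN; rewrite -/(N a).
case: (normMinf1 h _ _) => [r|//|//] N0 NN.
(* At norm 0 the quotient is +oo, the numerator being positive. *)
have [->|rn0] := eqVneq r 0; first by rewrite inve0 gt0_muley ?lte_fin// leey.
rewrite inver (negPf rn0) -EFinM lee_fin ler_pdivlMr ?lt_neqAle 1?eq_sym ?rn0//.
by rewrite -GE; apply: ler_wpM2l.
Qed.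

End lower_bound_functional.

Theorem theorem4p1 (R : realType) (hbar : R) (hbar_gt0 : 0 < hbar)
    (hbar_le1 : hbar <= 1) (q : nat -> R) (q_gt0 : forall j, 0 < q j)
    (n : nat) (n_ge1 : (1 <= n)%N) :
  let g : 'rV[R]_n -> R[i] := gaussian hbar q in
  opnorm_fresnel hbar g = (\prod_(1 <= j < n.+1) (q j ^+ 2 + 1) `^ (4^-1))%:E
  /\
  (\prod_(1 <= j < n.+1) (q j ^+ 2 + 1) `^ (4^-1))%:E =
    ereal_inf [set ((cmod (inner g gamma))^-1%:E
                    * normM1inf hbar gamma (distr (Fplus hbar)))%E
              | gamma in [set gamma | schwartz gamma /\ inner g gamma != 0]].
Proof.
move=> g.
(* The fourth root becomes a nested square root, and the range 1, ..., n becomes the ordinals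
   shifted by one. *)
have AE : \prod_(1 <= j < n.+1) (q j ^+ 2 + 1) `^ (4^-1) =
    \prod_(j < n) Num.sqrt (Num.sqrt (q j.+1 ^+ 2 + 1)).
  rewrite big_add1/= big_mkord; apply: eq_bigr => j _.
  have s0 : 0 <= q j.+1 ^+ 2 + 1 by rewrite addr_ge0// sqr_ge0.
  rewrite -!powR12_sqrt ?powR_ge0// -powRrM; congr (_ `^ _).
  by rewrite -invfM -natrM.
rewrite AE; split; apply/eqP; rewrite eq_le; apply/andP; split.
- exact: opnorm_fresnel_le.
- exact: opnorm_fresnel_ge.
- apply: le_ereal_inf_tmp => _ [gamma [sg ig] <-].
  have c0 := cmod_gt0 ig.
  have := normM1inf_ge hbar_gt0 q_gt0 sg.
  have -> : \prod_(j < n) Num.sqrt (cmod (qi q j)) =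
      \prod_(j < n) Num.sqrt (Num.sqrt (q j.+1 ^+ 2 + 1)).
    by apply: eq_bigr => j _; rewrite cmod_qi.
  by move=> H; rewrite muleC lee_pdivlMr// -EFinM.
- exact: normM1inf_inf_le.
Qed.
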